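(* Let $k\in\mathbb Z$ and $x\in\mathbb R$. If $\alpha\in(0,1)$, then $$\mathcal D^{\alpha}[\lambda_k](x)=e^{-i\,\mathrm{sgn}(k)\alpha\frac{\pi}{2}}(-\Delta)^{\alpha/2}\lambda_k(x)=-\frac{2|k|\,\Gamma(1+\alpha)\,e^{-i\,\mathrm{sgn}(k)\alpha\frac{\pi}{2}}}{(i\,\mathrm{sgn}(k)x+1)^{1+\alpha}}\;{}_2F_1\!\left(1-|k|,1+\alpha;2;\frac{2}{i\,\mathrm{sgn}(k)x+1}\right),$$ $$\overline{\mathcal D^{\alpha}}[\lambda_k](x)=-e^{i\,\mathrm{sgn}(k)\alpha\frac{\pi}{2}}(-\Delta)^{\alpha/2}\lambda_k(x)=\frac{2|k|\,\Gamma(1+\alpha)\,e^{i\,\mathrm{sgn}(k)\alpha\frac{\pi}{2}}}{(i\,\mathrm{sgn}(k)x+1)^{1+\alpha}}\;{}_2F_1\!\left(1-|k|,1+\alpha;2;\frac{2}{i\,\mathrm{sgn}(k)x+1}\right).$$ If $\alpha\in(1,2)$, then $$\partial_x\mathcal D^{\alpha-1}[\lambda_k](x)=e^{-i\,\mathrm{sgn}(k)\alpha\frac{\pi}{2}}(-\Delta)^{\alpha/2}\lambda_k(x)=-\frac{2|k|\,\Gamma(1+\alpha)\,e^{-i\,\mathrm{sgn}(k)\alpha\frac{\pi}{2}}}{(i\,\mathrm{sgn}(k)x+1)^{1+\alpha}}\;{}_2F_1\!\left(1-|k|,1+\alpha;2;\frac{2}{i\,\mathrm{sgn}(k)x+1}\right),$$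 $$\partial_x\overline{\mathcal D^{\alpha-1}}[\lambda_k](x)=e^{i\,\mathrm{sgn}(k)\alpha\frac{\pi}{2}}(-\Delta)^{\alpha/2}\lambda_k(x)=-\frac{2|k|\,\Gamma(1+\alpha)\,e^{i\,\mathrm{sgn}(k)\alpha\frac{\pi}{2}}}{(i\,\mathrm{sgn}(k)x+1)^{1+\alpha}}\;{}_2F_1\!\left(1-|k|,1+\alpha;2;\frac{2}{i\,\mathrm{sgn}(k)x+1}\right).$$ For $k=0$ the hypergeometric expressions (which carry the factor $|k|=0$) are understood to be $0$.
   Context: For $k\in\mathbb Z$, the complex Higgins functions are $\lambda_k(x)=\left(\frac{ix-1}{ix+1}\right)^k=\frac{(x+i)^{2k}}{(1+x^2)^k}$, $x\in\mathbb R$. For $\beta\in(0,1)$ and bounded $C^1$ functions $u$ on $\mathbb R$ with bounded derivative (for which the integrals converge), the Weyl-Marchaud type operators are $$\mathcal D^{\beta}[u](x)=\frac{1}{\Gamma(1-\beta)}\int_0^\infty\frac{u'(x-z)}{z^\beta}\,dz,\qquad \overline{\mathcal D^{\beta}}[u](x)=\frac{1}{\Gamma(1-\beta)}\int_0^\infty\frac{u'(x+z)}{z^\beta}\,dz$$ (the bar is part of the name of the operator; it does not denote complex conjugation). For $\alpha\in(1,2)$, $\partial_x\mathcal D^{\alpha-1}[u](x)=\frac{d}{dx}\big(\mathcal D^{\alpha-1}[u](x)\big)$ and $\partial_x\overline{\mathcal D^{\alpha-1}}[u](x)=\frac{d}{dx}\big(\overline{\mathcal D^{\alpha-1}}[u](x)\big)$.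 For $\alpha\in(0,2)$, the fractional Laplacian is $(-\Delta)^{\alpha/2}u(x)=c_\alpha\,\mathrm{p.v.}\!\int_{-\infty}^\infty\frac{u(x)-u(x+y)}{|y|^{1+\alpha}}dy$, with $c_\alpha=\alpha\frac{2^{\alpha-1}\Gamma(\frac12+\frac\alpha2)}{\sqrt\pi\,\Gamma(1-\frac\alpha2)}$. ${}_2F_1(a,b;c;z)=\sum_{n\ge0}\frac{(a)_n(b)_n}{(c)_n}\frac{z^n}{n!}$ is the Gaussian hypergeometric function, $(z)_n=z(z+1)\cdots(z+n-1)$, $(z)_0=1$; for $a=1-|k|$ with $k\neq0$ it is a finite sum. Complex powers use the principal branch, $-\pi<\arg\le\pi$; $\mathrm{sgn}$ is the sign function. *)

(* Defs.v *)
From HB Require Import structures.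
From mathcomp Require Import all_boot all_order all_algebra.
From mathcomp Require Import complex.
From mathcomp Require Import all_classical all_reals all_analysis.

Set Implicit Arguments.
Unset Strict Implicit.
Unset Printing Implicit Defensive.

Import Order.TTheory GRing.Theory Num.Theory.
Import numFieldNormedType.Exports.

Local Open Scope classical_set_scope.
Local Open Scope ring_scope.
Local Open Scope complex_scope.

Local Notation Re := complex.Re.
Local Notation Im := complex.Im.
Local Notation normc := ComplexField.Normc.normc.

Section Defs.
Variable R : realType.
Implicit Types (f u : R -> R[i]) (z w : R[i]) (D : set R).

(* 'i would be read as the imaginary unit of the numClosedFieldType R[i]. *)
Definition Ci : R[i] := 0 +i* 1.

Definition cexp z : R[i] :=
  (expR (Re z))%:C * (cos (Im z) +i* sin (Im z)).

(* principal argument, in ]-pi, pi] for z != 0 *)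
Definition carg z : R :=
  if 0 <= Im z then acos (Re z / normc z) else - acos (Re z / normc z).

Definition clog z : R[i] := ln (normc z) +i* carg z.

Definition cpow z w : R[i] :=
  if z == 0 then (w == 0)%:R else cexp (w * clog z).

(* Calculus of functions R -> C is done componentwise: the library has no
   normed-module structure over R on R[i]. *)

Definition cderivable f (x : R) : Prop :=
  derivable (fun t => Re (f t)) x 1 /\ derivable (fun t => Im (f t)) x 1.

Definition cderive f (x : R) : R[i] :=
  derive1 (fun t => Re (f t)) x +i* derive1 (fun t => Im (f t)) x.

Definition cintegrable D f : Prop :=
  (@lebesgue_measure R).-integrable D (fun t => (Re (f t))%:E) /\
  (@lebesgue_measure R).-integrable D (fun t => (Im (f t))%:E).

Definition cintegral D f : R[i] :=
  (\int[@lebesgue_measure R]_(t in D) Re (f t)) +i*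
  (\int[@lebesgue_measure R]_(t in D) Im (f t)).

(* only used at s > 0, where the integral converges *)
Definition Gamma (s : R) : R :=
  \int[@lebesgue_measure R]_(t in `]0, +oo[) (t `^ (s - 1) * expR (- t)).

Definition pochhammer z (n : nat) : R[i] := \prod_(j < n) (z + j%:R).

Definition hyp2F1_sum (a b c z : R[i]) (N : nat) : R[i] :=
  \sum_(n < N)
    pochhammer a n * pochhammer b n / pochhammer c n * (z ^+ n / n`!%:R).

(* The series is summed componentwise; for a = 1 - m with m >= 1 its partial sums
   are eventually constant. *)
Definition hyp2F1 (a b c z : R[i]) : R[i] :=
  limn (fun N => Re (hyp2F1_sum a b c z N)) +i*
  limn (fun N => Im (hyp2F1_sum a b c z N)).

Definition higgins (k : int) (x : R) : R[i] :=
  ((Ci * x%:C - 1) / (Ci * x%:C + 1)) ^ k.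

(* The integrals over ]0, +oo[ are Lebesgue integrals, so converging means
   converging absolutely. *)
Definition wm_integrand (beta : R) u (x z : R) : R[i] :=
  cderive u (x - z) / (z `^ beta)%:C.

Definition wm_converges (beta : R) u (x : R) : Prop :=
  cintegrable `]0, +oo[ (wm_integrand beta u x).

Definition weyl_marchaud (beta : R) u (x : R) : R[i] :=
  ((Gamma (1 - beta))^-1)%:C * cintegral `]0, +oo[ (wm_integrand beta u x).

Definition wm_bar_integrand (beta : R) u (x z : R) : R[i] :=
  cderive u (x + z) / (z `^ beta)%:C.

Definition wm_bar_converges (beta : R) u (x : R) : Prop :=
  cintegrable `]0, +oo[ (wm_bar_integrand beta u x).

Definition weyl_marchaud_bar (beta : R) u (x : R) : R[i] :=
  ((Gamma (1 - beta))^-1)%:C * cintegral `]0, +oo[ (wm_bar_integrand beta u x).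

Definition fraclap_integrand (alpha : R) u (x y : R) : R[i] :=
  (u x - u (x + y)) / (`|y| `^ (1 + alpha))%:C.

Definition fraclap_trunc (alpha : R) u (x eps : R) : R[i] :=
  cintegral [set y : R | eps < `|y|] (fraclap_integrand alpha u x).

Definition fraclap_const (alpha : R) : R :=
  alpha * (2 `^ (alpha - 1) * Gamma (2^-1 + alpha / 2)) /
  (Num.sqrt pi * Gamma (1 - alpha / 2)).

(* the principal value is the limit of the symmetric truncations *)
Definition fraclap_converges (alpha : R) u (x : R) : Prop :=
  [/\ forall eps : R, 0 < eps ->
        cintegrable [set y : R | eps < `|y|] (fraclap_integrand alpha u x),
      cvg (Re (fraclap_trunc alpha u x eps) @[eps --> (0 : R)^'+]) &
      cvg (Im (fraclap_trunc alpha u x eps) @[eps --> (0 : R)^'+])].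

Definition fraclap (alpha : R) u (x : R) : R[i] :=
  (fraclap_const alpha)%:C *
  (lim (Re (fraclap_trunc alpha u x eps) @[eps --> (0 : R)^'+]) +i*
   lim (Im (fraclap_trunc alpha u x eps) @[eps --> (0 : R)^'+])).

End Defs.

Arguments Ci {R}.

(* Main.v *)
Require Import Defs.
From HB Require Import structures.
From mathcomp Require Import all_boot all_order all_algebra.
From mathcomp Require Import complex.
From mathcomp Require Import all_classical all_reals all_analysis.
From mathcomp Require Import measurable_realfun.
From mathcomp Require Import ring lra.

(** Put [s = sgn k] and [w = 1 + i s x]. Then [higgins k x = (1 - 2 / w)^|k|], so
    that a Higgins function is, up to an additive constant, a finite combination
    of the powers [w^-(n+1)], [n < |k|]. All the operators are linear and kill
    constants, so it is enough to know what they do to one power.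

    Fractional Laplacian. The power [w^-a] is a superposition of oscillations of
    one sign: [Gamma a * w^-a] is the integral of [t^(a-1) e^(-t w)] over [t > 0]
    ([cintegral_laplace]). Folding the two half-lines turns the principal value
    into the absolutely convergent integral of a second difference
    ([principal_value]). This difference multiplies frequency [t] by
    [2 (1 - cos (t y))], and after an exchange of integrals
    ([fubini_one_sub_cos]) the [y]-integral is [2 K t^al], with [K] the integral
    of [(1 - cos y) y^(-al-1)]. The value of [K] follows from averaging over [t]
    against a Gaussian ([integral_one_sub_cos1]), and the normalising constant is
    exactly [1 / (2 K)] ([fraclap_constE]). Hence [w^-a] is sent to
    [Gamma (a + al) / Gamma a * w^(-a-al)] ([has_pv_pow1]).

    One-sided operators. The derivative of [w^-(n+1)] is a multiple of
    [w^-(n+2)]; along the ray [x - z] or [x + z] the latter is, up to powers of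
    [i], [(zeta + z)^-(n+2)] with [zeta] outside the negative half-line. For
    [zeta > 0] its integral against [z^-be] is a beta integral
    ([beta_integralE]), and turning [zeta] by an angle below [pi] only changes it
    by the expected power of a phase ([cintegral_rotate]). The result
    ([has_cint_power]) is the fractional Laplacian of order [be] times
    [e^(-i s be pi/2)] on the left and [- e^(i s be pi/2)] on the right. For an
    order [al] in [1 < al < 2] these formulas, with [be = al - 1], are
    differentiated in [x]; the functional equation of Gamma gives the formula of
    order [be + 1], and the factor [- i s] completes the phase
    ([dhiggins_fraclap]).

    Closed form. The sum of the images of the powers is the stated terminating
    hypergeometric series, term by term ([higgins_fraclap_hyp2F1]).

    No contour is ever deformed in the plane: the Laplace, beta and Gaussian
    integrals are shown to be constant, up to an explicit factor, in a real
    parameter, because the derivative of the integrand in the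
    parameter is a derivative in the variable of integration
    ([integral_const_param]). *)

Set Implicit Arguments.
Unset Strict Implicit.
Unset Printing Implicit Defensive.

Import Order.TTheory GRing.Theory Num.Theory.
Import numFieldNormedType.Exports.

Local Open Scope classical_set_scope.
Local Open Scope ring_scope.
Local Open Scope complex_scope.

(** * The fundamental theorem of calculus on the open half-line *)

Section HalfLine.
Context {R : realType}.
Implicit Types (f F G h : R -> R).
Local Notation mu := (@lebesgue_measure R).
Local Notation Ioy := (`]0%R, +oo[%classic : set R).

Lemma derive_continuous f (x d : R) : is_derive x 1 f d -> {for x, continuous f}.
Proof.
by move=> [fd _]; apply: differentiable_continuous; apply/derivable1_diffP.
Qed.

Lemma measurable_continuous_oy f :
  (forall t : R, 0 < t -> {for t, continuous f}) -> measurable_fun Ioy f.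
Proof.
move=> cf; apply: open_continuous_measurable_fun; first exact: interval_open.
by move=> t; rewrite inE/= in_itv/= andbT => /cf.
Qed.

(** Both ends of the half-line are approached at once, so that the same compact
    intervals serve for primitives that are singular at [0] and at infinity. *)
Definition exhaust (n : nat) : set R := `[n.+1%:R^-1, n.+1%:R]%classic.

Lemma exhaust_nd : nondecreasing_seq exhaust.
Proof.
move=> m n mn; rewrite subsetEset; apply: subset_itv; rewrite bnd_simp.
  by rewrite lef_pV2 ?posrE// ler_nat.
by rewrite ler_nat.
Qed.

Lemma bigcup_exhaust : \bigcup_n exhaust n = Ioy.
Proof.
apply/seteqP; split => [t [n _]|t].
  rewrite /exhaust/= !in_itv/= andbT => /andP[+ _]; apply: lt_le_trans.
  by rewrite invr_gt0.
rewrite /= in_itv/= andbT => t0.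
exists (maxn (Num.truncn t) (Num.truncn t^-1)) => //=.
rewrite /exhaust/= in_itv/=; apply/andP; split.
  rewrite invf_ple ?posrE//; apply: (le_trans (ltW (truncnS_gt _))).
  by rewrite ler_nat ltnS leq_maxr.
apply: (le_trans (ltW (truncnS_gt _))).
by rewrite ler_nat ltnS leq_maxl.
Qed.

Lemma exhaust_pos n t : exhaust n t -> 0 < t.
Proof.
by rewrite /exhaust/= in_itv/= => /andP[+ _]; apply: lt_le_trans; rewrite invr_gt0.
Qed.

Lemma exhaust_oy n : exhaust n `<=` Ioy.
Proof. by move=> t /exhaust_pos; rewrite /= in_itv/= andbT. Qed.

Lemma FTC_segment F f (a b : R) : 0 < a -> a < b ->
  (forall t : R, 0 < t -> is_derive t 1 F (f t)) ->
  (forall t : R, 0 < t -> {for t, continuous f}) ->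
  (\int[mu]_(t in `[a, b]) (f t)%:E = (F b - F a)%:E)%E.
Proof.
move=> a0 ab dF cf; rewrite EFinB.
apply: (@continuous_FTC2 _ f F) => //.
- apply: continuous_in_subspaceT => t; rewrite inE/= in_itv/= => /andP[at_ _].
  by apply: cf; apply: lt_le_trans at_.
- split.
  + by move=> t; rewrite in_itv/= => /andP[at_ _]; case: (dF t (lt_trans a0 at_)).
  + by apply: cvg_at_right_filter; apply: derive_continuous (dF _ a0).
  + apply: cvg_at_left_filter; apply: derive_continuous (dF _ _).
    exact: lt_trans ab.
- move=> t; rewrite in_itv/= => /andP[at_ _].
  by rewrite derive1E; case: (dF t (lt_trans a0 at_)).
Qed.

(** The index starts at [n.+1] because the interval of index [0] is reduced to a
    point. *)
Lemma FTC_exhaust F f n :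
  (forall t : R, 0 < t -> is_derive t 1 F (f t)) ->
  (forall t : R, 0 < t -> {for t, continuous f}) ->
  (\int[mu]_(t in exhaust n.+1) (f t)%:E = (F n.+2%:R - F n.+2%:R^-1)%:E)%E.
Proof.
move=> dF cf; apply: FTC_segment => //.
by rewrite (@lt_trans _ _ 1)// ?invf_lt1// ltr1n.
Qed.

Lemma FTC_ends F (l L : R) : F t @[t --> 0^'+] --> l -> F t @[t --> +oo] --> L ->
  (F n.+2%:R - F n.+2%:R^-1) @[n --> \oo] --> L - l.
Proof.
move=> F0 Foo.
have a : F n.+1%:R @[n --> \oo] --> L.
  have /cvg_pinftyP/(_ (fun n => n.+1%:R)) := Foo; apply.
  apply/cvgryPge => A; near=> n.
  have : n%:R <= n.+1%:R :> R by rewrite ler_nat.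
  apply: le_trans; near: n; exact: nbhs_infty_ger.
have b : F n.+1%:R^-1 @[n --> \oo] --> l.
  have /cvg_at_rightP/(_ (fun n => n.+1%:R^-1)) := F0; apply; split.
    by move=> n; rewrite invr_gt0.
  exact: cvg_harmonic.
apply: cvgB.
  by rewrite -(@cvg_shiftS _ (fun n => F n.+1%:R)) in a.
by rewrite -(@cvg_shiftS _ (fun n => F n.+1%:R^-1)) in b.
Unshelve. all: end_near. Qed.

(** For a nonnegative derivative the limit of the compact integrals is monotone,
    and integrability is a consequence rather than a hypothesis. *)
Lemma ge0_FTC_oy F f (l L : R) :
  (forall t : R, 0 < t -> 0 <= f t) ->
  (forall t : R, 0 < t -> is_derive t 1 F (f t)) ->
  (forall t : R, 0 < t -> {for t, continuous f}) ->
  F t @[t --> 0^'+] --> l -> F t @[t --> +oo] --> L ->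
  (\int[mu]_(t in Ioy) (f t)%:E = (L - l)%:E)%E.
Proof.
move=> f0 dF cf F0 Foo.
have /cvg_lim <- // : (\int[mu]_(x in exhaust i) (EFin \o f) x)%E @[i --> \oo] -->
  (\int[mu]_(x in Ioy) (EFin \o f) x)%E.
  rewrite -bigcup_exhaust; apply: ge0_nondecreasing_set_cvg_integral.
  - exact: exhaust_nd.
  - by move=> i; exact: measurable_itv.
  - move=> i; apply/measurable_EFinP; apply: measurable_funS (@exhaust_oy i) _ => //.
    exact: measurable_continuous_oy.
  - by move=> i t /exhaust_pos t0; rewrite lee_fin f0.
apply/cvg_lim => //.
rewrite -(@cvg_shiftS _ (fun i => \int[mu]_(x in exhaust i) (EFin \o f) x)%E).
under eq_fun do rewrite FTC_exhaust//.
by apply: cvg_EFin; [exact: nearW|exact: FTC_ends].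
Qed.

(** Here the truncations of [f] are dominated by [f] itself. *)
Lemma FTC_oy F f (l L : R) :
  mu.-integrable Ioy (EFin \o f) ->
  (forall t : R, 0 < t -> is_derive t 1 F (f t)) ->
  (forall t : R, 0 < t -> {for t, continuous f}) ->
  F t @[t --> 0^'+] --> l -> F t @[t --> +oo] --> L ->
  \int[mu]_(t in Ioy) f t = L - l.
Proof.
move=> fi dF cf F0 Foo.
pose f_ n := ((EFin \o f) \_ (exhaust n)).
have mf : measurable_fun Ioy (EFin \o f) by case/integrableP: fi.
have mex n : measurable (exhaust n) by exact: measurable_itv.
have [] := @dominated_convergence _ _ R lebesgue_measure Ioy (measurable_itv _) f_
   (EFin \o f) (abse \o (EFin \o f)).
- move=> n; apply/(measurable_restrict (EFin \o f) (mex n) (measurable_itv _)).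
  by apply: measurable_funS mf => //; apply: subIsetl.
- exact: mf.
- apply: aeW => t t0.
  have : Ioy t by [].
  rewrite -bigcup_exhaust => -[N _ Nt].
  apply: cvg_near_cst; exists N => // n /= Nn.
  rewrite /f_ patchE mem_set//.
  by move: t Nt {t0}; apply/subsetPset/exhaust_nd.
- exact: integrable_abse.
- apply: aeW => t n t0; rewrite /f_ patchE; case: ifPn => // _.
  by rewrite abse0 abse_ge0.
move=> _ _ H.
rewrite /Rintegral.
have /cvg_lim <- // : (\int[mu]_(x in Ioy) f_ i x)%E @[i --> \oo] -->
  (\int[mu]_(x in Ioy) (EFin \o f) x)%E := H.
suff -> : limn (fun i => (\int[mu]_(x in Ioy) f_ i x)%E) = (L - l)%:E by [].
apply/cvg_lim => //.
rewrite -(@cvg_shiftS _ (fun i => \int[mu]_(x in Ioy) f_ i x)%E).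
have E n : (\int[mu]_(x in Ioy) f_ n x)%E = (\int[mu]_(x in exhaust n) (f x)%:E)%E.
  rewrite /f_ -integral_mkcondr; congr (integral _ _ _).
  by apply/setIidPr; exact: exhaust_oy.
under eq_fun do rewrite E FTC_exhaust//.
by apply: cvg_EFin; [exact: nearW|exact: FTC_ends].
Qed.

End HalfLine.

(** * Parametric integrals that do not depend on the parameter *)

Section ParametricIntegral.
Context {R : realType}.
Implicit Types (f F G h : R -> R).
Local Notation mu := (@lebesgue_measure R).
Local Notation Ioy := (`]0%R, +oo[%classic : set R).

Lemma is_derive0_const f (u v : R) :
  (forall b, b \in `]u, v[ -> is_derive b 1 f 0) ->
  {in `]u, v[ &, forall a b, f a = f b}.
Proof.
move=> df; suff H a b : a \in `]u, v[ -> b \in `]u, v[ -> a < b -> f a = f b.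
  move=> a b au bu; case: (ltgtP a b) => [ab|ba|->//]; first exact: H.
  by apply/esym; exact: H.
rewrite !in_itv/= => /andP[ua _] /andP[_ bv] ab.
have I c : c \in `[a, b] -> c \in `]u, v[.
  by rewrite !in_itv/= => /andP[ac cb]; rewrite (lt_le_trans ua)//= (le_lt_trans cb).
have [|c _] := @MVT _ f (cst 0) _ _ ab (fun c cab => df _ (I _ (subset_itv_oo_cc cab))).
  apply: continuous_in_subspaceT => c; rewrite inE => /I cI.
  exact: derive_continuous (df _ cI).
by rewrite mul0r => H; apply/esym/eqP; rewrite -subr_eq0 H.
Qed.

(** The derivative of the integral in [b] is the integral of [P' b], which is the
    variation of its primitive [X b] in [t] between the two ends, hence zero. This
    replaces each deformation of a contour: the integral of a holomorphic
    function along a moving ray has a derivative in the parameter of the ray that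
    is the integral of an exact derivative along the ray. *)
Lemma integral_const_param (u v : R) (P P' X : R -> R -> R) (g : R -> R) :
  (forall b, b \in `]u, v[ -> mu.-integrable Ioy (EFin \o P b)) ->
  (forall b t : R, b \in `]u, v[ -> 0 < t -> is_derive b 1 (P^~ t) (P' b t)) ->
  (forall b t : R, b \in `]u, v[ -> 0 < t -> is_derive t 1 (X b) (P' b t)) ->
  (forall b t : R, b \in `]u, v[ -> 0 < t -> {for t, continuous (P' b)}) ->
  mu.-integrable Ioy (EFin \o g) ->
  (forall b t : R, b \in `]u, v[ -> 0 < t -> `|P' b t| <= g t) ->
  (forall b, b \in `]u, v[ -> X b t @[t --> 0^'+] --> (0 : R)) ->
  (forall b, b \in `]u, v[ -> X b t @[t --> +oo] --> (0 : R)) ->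
  {in `]u, v[ &, forall a b,
    \int[mu]_(t in Ioy) P a t = \int[mu]_(t in Ioy) P b t}.
Proof.
move=> iP dP dX cP' ig Pg X0 Xoo.
have d1E b t : b \in `]u, v[ -> 0 < t -> derive1 (P ^~ t) b = P' b t.
  by move=> bu t0; rewrite derive1E; case: (dP b t bu t0).
have g0 t : 0 <= `|g t| by [].
have ig' : mu.-integrable Ioy (EFin \o (fun t => `|g t|)).
  by apply: integrable_abse ig.
apply: is_derive0_const => b bu.
have dP1 x y : `]u, v[%classic x -> Ioy y -> derivable (P ^~ y) x 1.
  by move=> xu; rewrite /= in_itv/= andbT => y0; case: (dP x y xu y0).
have Pg1 x y : `]u, v[%classic x -> Ioy y -> `|partial1of2 P x y| <= `|g y|.
  move=> xu; rewrite /= in_itv/= andbT => y0.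
  by rewrite /partial1of2 d1E// (le_trans (Pg _ _ xu y0))// ler_norm.
have bu' : `]u, v[%classic b by [].
have := @derivable_under_integral R _ _ lebesgue_measure P Ioy (measurable_itv _)
  b u v bu' iP dP1 _ g0 ig' Pg1.
have := @differentiation_under_integral R _ _ lebesgue_measure P Ioy (measurable_itv _)
  b u v bu' iP dP1 _ g0 ig' Pg1.
move=> E D; split => //; rewrite -derive1E E.
transitivity (\int[mu]_(y in Ioy) P' b y).
  apply: eq_Rintegral => t; rewrite inE/= in_itv/= andbT => t0.
  exact: d1E.
rewrite -[RHS](subrr (0 : R)); apply: (@FTC_oy _ (X b)).
- apply: le_integrable ig => //.
    by apply/measurable_EFinP; apply: measurable_continuous_oy => t; exact: cP'.
  move=> t; rewrite /= in_itv/= andbT => t0.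
  by rewrite lee_fin (le_trans (Pg _ _ bu t0))// ler_norm.
- by move=> t; exact: dX.
- by move=> t; exact: cP'.
- exact: X0.
- exact: Xoo.
Qed.

End ParametricIntegral.

(** * Changes of variables *)

Section ChangeOfVariables.
Context {R : realType}.
Implicit Types (f F G h : R -> R).
Local Notation mu := (@lebesgue_measure R).
Local Notation Ioy := (`]0%R, +oo[%classic : set R).

Lemma ge0_integral_oy_limit (a : nat -> R) G :
  nonincreasing_seq a -> (forall n, 0 < a n) -> a n @[n --> \oo] --> (0 : R) ->
  (forall t : R, 0 < t -> {for t, continuous G}) ->
  (forall t : R, 0 < t -> 0 <= G t) ->
  (\int[mu]_(t in `[a n, +oo[) (G t)%:E @[n --> \oo] -->
   \int[mu]_(t in Ioy) (G t)%:E)%E.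
Proof.
move=> an a0 acv cG G0.
have aI n : `[a n, +oo[ `<=` Ioy.
  by apply: subset_itv; rewrite bnd_simp.
have -> : Ioy = \bigcup_n `[a n, +oo[%classic.
  apply/seteqP; split => [t|t [n _]]; last exact: aI.
  rewrite /= in_itv/= andbT => t0.
  have /cvgrPdist_le/(_ _ t0)[N _ /(_ N)] := acv.
  rewrite /= sub0r normrN gtr0_norm// => /(_ (leqnn _)) aNt.
  by exists N => //=; rewrite in_itv/= andbT.
apply: ge0_nondecreasing_set_cvg_integral.
- move=> m n mn; rewrite subsetEset; apply: subset_itv; rewrite bnd_simp//.
  exact: an.
- by move=> n; exact: measurable_itv.
- move=> n; apply/measurable_EFinP; apply: measurable_funS (aI n) _ => //.
  exact: measurable_continuous_oy.
- by move=> n t /aI; rewrite /= in_itv/= andbT => /G0; rewrite lee_fin.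
Qed.

(** The substitution is performed on the rays starting at [1 / (n + 1)]; as
    everything is nonnegative, the limit exists on both sides without any
    hypothesis of integrability. *)
Lemma ge0_substitution_oy F f G (l : R) :
  (forall t : R, 0 < t -> is_derive t 1 F (f t)) ->
  (forall t : R, 0 < t -> 0 < f t) ->
  (forall t : R, 0 < t -> {for t, continuous f}) ->
  f t @[t --> +oo] --> l ->
  (forall t : R, 0 < t -> 0 < F t) ->
  F t @[t --> 0^'+] --> (0 : R) -> F t @[t --> +oo] --> +oo ->
  (forall t : R, 0 < t -> {for t, continuous G}) ->
  (forall t : R, 0 < t -> 0 <= G t) ->
  (\int[mu]_(t in Ioy) (G t)%:E = \int[mu]_(t in Ioy) (G (F t) * f t)%:E)%E.
Proof.
move=> dF f0 cf foo Fpos F0 Foo cG G0.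
have cF t : 0 < t -> {for t, continuous F} by move=> t0; exact: derive_continuous (dF _ t0).
have Finc : {in `]0, +oo[ &, {homo F : x y / x < y}}.
  move=> x y; rewrite !in_itv/= !andbT => x0 y0 xy.
  have [||c cxy] := @MVT _ F f x y xy.
  - by move=> t; rewrite in_itv/= => /andP[xt _]; exact: dF (lt_trans x0 xt).
  - apply: continuous_in_subspaceT => t; rewrite inE/= in_itv/= => /andP[xt _].
    exact: cF (lt_le_trans x0 xt).
  move=> H; rewrite -subr_gt0 H mulr_gt0 ?subr_gt0// f0//.
  by move: cxy; rewrite in_itv/= => /andP[xc _]; exact: lt_trans xc.
pose a n : R := n.+1%:R^-1.
have a0 n : 0 < a n by rewrite invr_gt0.
have an : nonincreasing_seq a.
  by move=> m n mn; rewrite lef_pV2 ?posrE// ler_nat.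
have Fan : nonincreasing_seq (F \o a).
  move=> m n /an /=; rewrite le_eqVlt => /predU1P[->//|mn].
  by apply/ltW/Finc; rewrite ?in_itv/= ?a0.
have A := ge0_integral_oy_limit Fan (fun n => Fpos _ (a0 n)) _ cG G0.
have cGF t : 0 < t -> {for t, continuous (fun t => G (F t) * f t)}.
  move=> t0; apply: (@cvgM _ _ _ _ (G \o F) f); last exact: cf.
  by apply: continuous_comp; [exact: cF|apply: cG; exact: Fpos].
have B := ge0_integral_oy_limit an a0 _ cGF _.
have FtcvA : (F \o a) n @[n --> \oo] --> (0 : R).
  have /cvg_at_rightP/(_ a) := F0; apply; split => //.
  exact: cvg_harmonic.
have /cvg_lim <- // := A FtcvA.
have acv : a n @[n --> \oo] --> (0 : R) by exact: cvg_harmonic.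
have GF0 t : 0 < t -> 0 <= G (F t) * f t.
  by move=> t0; rewrite mulr_ge0// ?G0 ?Fpos// ltW ?f0.
have /cvg_lim <- // := B acv GF0.
congr (limn _); apply/funext => n /=.
have F'E t : a n < t -> derive1 F t = f t.
  move=> t0; rewrite derive1E.
  by case: (dF t (lt_trans (a0 n) t0)).
rewrite (@increasing_ge0_integration_by_substitutiony R F).
- rewrite -integral_itv_obnd_cbnd; last first.
    apply/measurable_EFinP.
    apply: (@eq_measurable_fun _ _ _ _ _ (fun t => G (F t) * f t)).
      move=> t; rewrite inE/= in_itv/= andbT => /F'E E.
      by rewrite !fctE E.
    apply: (@measurable_funS _ _ _ _ Ioy) => //.
      by apply: subset_itv; rewrite bnd_simp// ltW.
    exact: measurable_continuous_oy.
  rewrite -[in RHS]integral_itv_obnd_cbnd; last first.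
    apply/measurable_EFinP.
    apply: (@measurable_funS _ _ _ _ Ioy) => //.
      by apply: subset_itv; rewrite bnd_simp// ltW.
    exact: measurable_continuous_oy.
  apply: eq_integral => t; rewrite inE/= in_itv/= andbT => /F'E E.
  by rewrite !fctE E.
- move=> x y; rewrite !in_itv/= !andbT => ax ay xy.
  by apply: Finc => //; rewrite in_itv/= andbT (lt_le_trans (a0 n)).
- move=> t; rewrite in_itv/= andbT => at_.
  rewrite /continuous_at F'E//; apply: cvg_trans (cf t (lt_trans (a0 n) at_)).
  apply: near_eq_cvg.
  near=> x; apply/esym/F'E; near: x.
  exact: lt_nbhsr.
- apply/cvg_ex; exists (f (a n)).
  apply: cvg_trans (cvg_at_right_filter (cf _ (a0 n))).
  apply: near_eq_cvg; near=> x; apply/esym/F'E.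
  by near: x; exact: nbhs_right_gt.
- apply/cvg_ex; exists l.
  apply: cvg_trans foo.
  apply: near_eq_cvg; near=> x; apply/esym/F'E.
  by near: x; apply: nbhs_pinfty_gt; exact: num_real.
- split.
    move=> t; rewrite in_itv/= andbT => at_.
    by case: (dF t (lt_trans (a0 n) at_)).
  by apply: cvg_at_right_filter; exact: cF (a0 n).
- exact: Foo.
- apply: continuous_in_subspaceT => t; rewrite inE/= in_itv/= andbT => Ft.
  by apply: cG; apply: lt_le_trans Ft; exact: Fpos.
- move=> t; rewrite in_itv/= andbT => Ft.
  by apply: G0; apply: lt_trans Ft; exact: Fpos.
Unshelve. all: end_near. Qed.

Lemma ge0_integral_scale (c : R) G : 0 < c ->
  (forall t : R, 0 < t -> {for t, continuous G}) ->
  (forall t : R, 0 < t -> 0 <= G t) ->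
  (\int[mu]_(t in Ioy) (G (c * t))%:E = c^-1%:E * \int[mu]_(t in Ioy) (G t)%:E)%E.
Proof.
move=> c0 cG G0.
have mG t : 0 < t -> {for t, continuous (fun t => G (c * t))}.
  move=> t0; apply: (@continuous_comp _ _ _ ( *%R c) G).
    exact: mulrl_continuous.
  by apply: cG; rewrite mulr_gt0.
have -> : (\int[mu]_(t in Ioy) (G t)%:E = \int[mu]_(t in Ioy) (G (c * t) * c)%:E)%E.
  apply: (@ge0_substitution_oy ( *%R c) (cst c) G c) => //.
  - by move=> t t0; apply: is_derive_eq; rewrite [LHS]mulr1.
  - by move=> t t0; exact: cvg_cst.
  - exact: cvg_cst.
  - by move=> t t0; rewrite mulr_gt0.
  - rewrite -[X in _ --> X](mulr0 c); apply: cvg_at_right_filter.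
    exact: mulrl_continuous.
  - exact: gt0_cvgMry.
under [in RHS]eq_integral do rewrite mulrC EFinM.
rewrite ge0_integralZl_EFin//=.
- by rewrite muleA -EFinM mulVf ?gt_eqF// mul1e.
- by move=> t; rewrite /= in_itv/= andbT => t0; rewrite lee_fin G0 ?mulr_gt0.
- by apply/measurable_EFinP; apply: measurable_continuous_oy => t; exact: mG.
- exact: ltW.
Qed.

(** Lebesgue measure is its own image under the reflection. *)
Lemma integral_reflect (f : R -> R) (D : set R) :
  measurable D -> measurable_fun setT f ->
  mu.-integrable (-%R @^-1` D) (EFin \o (f \o -%R)) ->
  mu.-integrable D (EFin \o f) /\
  \int[mu]_(t in D) f t = \int[mu]_(t in -%R @^-1` D) f (- t).
Proof.
move=> mD mf fi.
have muN (A : set R) : measurable A -> A `<=` D ->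
    pushforward mu (-%R : _ -> measurableTypeR R) A = mu A.
  by move=> mA _; exact: lebesgue_measureN.
have mN : measurable_fun setT (-%R : R -> measurableTypeR R) by [].
have mf' : measurable_fun setT (EFin \o f) by exact/measurable_EFinP.
have E := @integral_pushforward _ _ (measurableTypeR R)
  (measurableTypeR R) R -%R mN lebesgue_measure D (EFin \o f) mf' fi mD.
have I := @integrable_pushforward _ _ (measurableTypeR R)
  (measurableTypeR R) R -%R mN lebesgue_measure D (EFin \o f) mf' fi mD.
split.
  apply/integrableP; split; first exact: measurable_funS mf'.
  case/integrableP: I => _; rewrite (eq_measure_integral lebesgue_measure) //.
rewrite /Rintegral -[in RHS]E; congr fine.
by apply/esym/eq_measure_integral.
Qed.

End ChangeOfVariables.

(** * Differentiation rules *)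

Section DeriveRules.
Context {R : realType}.
Implicit Types (f g : R -> R) (x a b c : R).

(** Each rule takes the derivatives of the parts with their values and returns
    the value for the whole, so that the derivative of an expression is obtained
    by composing the rules along its structure. *)
Lemma dC c x : is_derive x 1 (fun _ : R => c) 0.
Proof. exact: is_derive_cst. Qed.

Lemma dI x : is_derive x 1 (fun t : R => t) 1.
Proof. exact: is_derive_id. Qed.

Lemma dD f g x a b : is_derive x 1 f a -> is_derive x 1 g b ->
  is_derive x 1 (fun t => f t + g t) (a + b).
Proof. by move=> Hf Hg; exact: is_deriveD. Qed.

Lemma dN f x a : is_derive x 1 f a -> is_derive x 1 (fun t => - f t) (- a).
Proof. by move=> Hf; exact: is_deriveN. Qed.

Lemma dB f g x a b : is_derive x 1 f a -> is_derive x 1 g b ->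
  is_derive x 1 (fun t => f t - g t) (a - b).
Proof. by move=> Hf Hg; exact: is_deriveB. Qed.

Lemma dM f g x a b : is_derive x 1 f a -> is_derive x 1 g b ->
  is_derive x 1 (fun t => f t * g t) (a * g x + f x * b).
Proof.
move=> Hf Hg; apply: (is_derive_eq (is_deriveM Hf Hg)).
by rewrite /GRing.scale/= addrC mulrC.
Qed.

Lemma dZ c f x a : is_derive x 1 f a -> is_derive x 1 (fun t => c * f t) (c * a).
Proof. by move=> Hf; exact: (is_deriveZ (f := f)). Qed.

Lemma dchain f g x a b : is_derive (g x) 1 f a -> is_derive x 1 g b ->
  is_derive x 1 (fun t => f (g t)) (a * b).
Proof. by move=> Hf Hg; exact: is_derive1_comp. Qed.

Lemma dV f x a : f x != 0 -> is_derive x 1 f a ->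
  is_derive x 1 (fun t => (f t)^-1) (- a / f x ^+ 2).
Proof.
move=> fx Hf; apply: (is_derive_eq (is_deriveV fx Hf)).
by rewrite /GRing.scale/= mulNr mulNr mulrC.
Qed.

Lemma dexp f x a : is_derive x 1 f a ->
  is_derive x 1 (fun t => expR (f t)) (expR (f x) * a).
Proof. by apply: dchain; exact: is_derive_expR. Qed.

Lemma dcos f x a : is_derive x 1 f a ->
  is_derive x 1 (fun t => cos (f t)) (- sin (f x) * a).
Proof. by apply: dchain; exact: is_derive_cos. Qed.

Lemma dsin f x a : is_derive x 1 f a ->
  is_derive x 1 (fun t => sin (f t)) (cos (f x) * a).
Proof. by apply: dchain; exact: is_derive_sin. Qed.

Lemma dX n f x a : is_derive x 1 f a ->
  is_derive x 1 (fun t => f t ^+ n) (n%:R * f x ^+ n.-1 * a).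
Proof.
move=> Hf; elim: n => [|n IH]; first by rewrite mul0r mul0r; exact: dC.
have -> : (fun t => f t ^+ n.+1) = (fun t => f t * f t ^+ n).
  by apply/funext => t; rewrite exprS.
apply: (is_derive_eq (dM Hf IH)).
case: n {IH} => [|n]; first by rewrite !mul0r mulr0 addr0 mul1r mulrC.
by rewrite -[n.+2%:R]natr1 /= !exprS; ring.
Qed.

Lemma dpowR c f x a : 0 < f x -> is_derive x 1 f a ->
  is_derive x 1 (fun t => f t `^ c) (c * f x `^ (c - 1) * a).
Proof. by move=> fx; apply: (@dchain (@powR R ^~ c)); exact: is_derive1_powR. Qed.

End DeriveRules.

Section RealIntegrable.
Context {R : realType}.
Implicit Types (f g : R -> R) (D : set R).
Local Notation mu := (@lebesgue_measure R).

Lemma integrable_RZ D c f : measurable D -> mu.-integrable D (EFin \o f) ->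
  mu.-integrable D (EFin \o (fun t => c * f t)).
Proof.
move=> mD fi; apply: (@eq_integrable _ _ _ mu D mD (fun t => c%:E * (f t)%:E)%E) => //.
exact: integrableZl.
Qed.

Lemma integrable_RD D f g : measurable D -> mu.-integrable D (EFin \o f) ->
  mu.-integrable D (EFin \o g) -> mu.-integrable D (EFin \o (fun t => f t + g t)).
Proof.
move=> mD fi gi; apply: (@eq_integrable _ _ _ mu D mD (fun t => (f t)%:E + (g t)%:E)%E) => //.
exact: integrableD.
Qed.

Lemma integrable_RB D f g : measurable D -> mu.-integrable D (EFin \o f) ->
  mu.-integrable D (EFin \o g) -> mu.-integrable D (EFin \o (fun t => f t - g t)).
Proof.
move=> mD fi gi; apply: (@eq_integrable _ _ _ mu D mD (fun t => (f t)%:E - (g t)%:E)%E) => //.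
exact: integrableB.
Qed.

End RealIntegrable.

(** * Integrability of products of powers *)

Section IntegrablePowers.
Context {R : realType}.
Implicit Types (f F G h : R -> R) (a b s t : R).
Local Notation mu := (@lebesgue_measure R).
Local Notation Ioy := (`]0%R, +oo[%classic : set R).

Lemma measurable_Ioy : measurable Ioy. Proof. exact: measurable_itv. Qed.

(** The integrals of a nonnegative function over compact intervals are variations
    of its primitive, hence bounded. *)
Lemma integrable_bounded_primitive F f (M : R) :
  (forall t : R, 0 < t -> 0 <= f t) ->
  (forall t : R, 0 < t -> is_derive t 1 F (f t)) ->
  (forall t : R, 0 < t -> {for t, continuous f}) ->
  (forall t : R, 0 < t -> `|F t| <= M) ->
  mu.-integrable Ioy (EFin \o f).
Proof.
move=> f0 dF cf FM; apply/integrableP; split.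
  by apply/measurable_EFinP; exact: measurable_continuous_oy.
have -> : (\int[mu]_(x in Ioy) `|(EFin \o f) x| = \int[mu]_(x in Ioy) (EFin \o f) x)%E.
  apply: eq_integral => t; rewrite inE/= in_itv/= andbT => /f0 ft.
  by rewrite ger0_norm.
apply: (@le_lt_trans _ _ (M + M)%:E); last exact: ltry.
have H : (\int[mu]_(x in exhaust i) (EFin \o f) x)%E @[i --> \oo] -->
    (\int[mu]_(x in Ioy) (EFin \o f) x)%E.
  rewrite -bigcup_exhaust; apply: ge0_nondecreasing_set_cvg_integral.
  - exact: exhaust_nd.
  - by move=> i; exact: measurable_itv.
  - move=> i; apply/measurable_EFinP; apply: measurable_funS (@exhaust_oy _ i) _ => //.
    exact: measurable_continuous_oy.
  - by move=> i t /exhaust_pos t0; rewrite lee_fin f0.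
rewrite -(@cvg_shiftS _ (fun i => \int[mu]_(x in exhaust i) (EFin \o f) x)%E) in H.
apply: (cvge_to_le H); apply: nearW => n.
rewrite /= /comp (FTC_exhaust _ dF cf) lee_fin (le_trans (ler_norm _))//.
by rewrite (le_trans (ler_normB _ _))// lerD// FM// invr_gt0.
Qed.

Lemma gt0_powRD (x r s : R) : 0 < x -> x `^ (r + s) = x `^ r * x `^ s.
Proof. by move=> x0; rewrite powRD// (gt_eqF x0) implybT. Qed.

Lemma gt0_powRS (r x : R) : 0 < x -> x `^ r = x * x `^ (r - 1).
Proof.
move=> x0; rewrite -[X in X * _]powRr1 ?(ltW x0)// -gt0_powRD//.
by congr (_ `^ _); ring.
Qed.

Lemma powR_continuous a t : 0 < t -> {for t, continuous (@powR R ^~ a)}.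
Proof. by move=> t0; apply: derive_continuous (is_derive1_powR _ _). Qed.

Lemma is_derive_powR1D a t : 0 <= t ->
  is_derive t 1 (fun t => (1 + t) `^ a) (a * (1 + t) `^ (a - 1)).
Proof.
move=> t0; have H : 0 < 1 + t by rewrite ltr_pwDl.
apply: (is_derive_eq (dpowR _ _ (dD (dC 1 t) (dI t)))) => //.
by rewrite add0r mulr1.
Qed.

Lemma powR1D_continuous a t : 0 <= t -> {for t, continuous (fun t => (1 + t) `^ a)}.
Proof. by move=> t0; apply: derive_continuous (is_derive_powR1D _ _). Qed.

Lemma integrable_powR1D a : a < -1 ->
  mu.-integrable Ioy (EFin \o (fun t => (1 + t) `^ a)).
Proof.
move=> a1; have a0 : a + 1 < 0 by lra.
apply: (@integrable_bounded_primitive (fun t => (a + 1)^-1 * (1 + t) `^ (a + 1)) _ (- (a + 1)^-1)).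
- by move=> t t0; exact: powR_ge0.
- move=> t t0; have := is_derive_powR1D (a + 1) (ltW t0) => D.
  apply: (is_derive_eq (dZ _ D)).
  by rewrite mulrA mulVf ?mul1r ?addrK// lt_eqF.
- by move=> t t0; apply: powR1D_continuous; exact: ltW.
- move=> t t0; rewrite normrM ltr0_norm ?invr_lt0// ger0_norm ?powR_ge0//.
  rewrite ler_piMr ?oppr_ge0 ?invr_le0 ?(ltW a0)//.
  rewrite -[leRHS](powRr0 (1 + t)) ler_powR ?(ltW a0)//.
  by rewrite lerDl ltW.
Qed.

(** A primitive is [(t / (1 + t))^s / s], which is bounded. *)
Lemma integrable_powR_powR1D s : 0 < s ->
  mu.-integrable Ioy (EFin \o (fun t => t `^ (s - 1) * (1 + t) `^ (- s - 1))).
Proof.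
move=> s0.
apply: (@integrable_bounded_primitive (fun t => s^-1 * (t `^ s * (1 + t) `^ (- s))) _ s^-1).
- by move=> t t0; rewrite mulr_ge0 ?powR_ge0.
- move=> t t0.
  have D1 := is_derive_powR1D (- s) (ltW t0).
  have D2 := is_derive1_powR s t0.
  apply: (is_derive_eq (dZ _ (dM D2 D1))).
  have t1 : 1 + t != 0 by rewrite gt_eqF// addr_gt0.
  have -> : t `^ s = t * t `^ (s - 1) by rewrite mulr_powRB1// ltW.
  have -> : (1 + t) `^ (- s) = (1 + t) * (1 + t) `^ (- s - 1).
    rewrite -[X in _ = X * _]powRr1 ?addr_ge0 ?ltW// -powRD ?t1 ?implybT//.
    by congr (_ `^ _); ring.
  by field; rewrite gt_eqF.
- move=> t t0; apply: cvgM; first exact: powR_continuous.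
  by apply: powR1D_continuous; exact: ltW.
- move=> t t0; rewrite !normrM !ger0_norm ?powR_ge0// ?invr_ge0 ?(ltW s0)//.
  rewrite ler_piMr ?invr_ge0 ?(ltW s0)// powRN ler_pdivrMr ?mul1r.
    by rewrite ge0_ler_powR ?nnegrE ?(ltW s0, ltW t0)// ?addr_ge0// ?(ltW t0)// lerDr.
  by rewrite powR_gt0// addr_gt0.
Qed.

Lemma le_integrable_pos f g : measurable_fun Ioy f ->
  (forall t, 0 < t -> `|f t| <= g t) -> mu.-integrable Ioy (EFin \o g) ->
  mu.-integrable Ioy (EFin \o f).
Proof.
move=> mf fg; apply: le_integrable => //; first exact/measurable_EFinP.
move=> t; rewrite /= in_itv/= andbT => /fg H.
by rewrite lee_fin (le_trans H)// ler_norm.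
Qed.

(** Near [0] the integrand compares with [t^a (1 + t)^(-a-2)], and beyond [1] with
    [(1 + t)^(a+b)]. *)
Lemma integrable_powR_mul a b : -1 < a -> a + b < -1 ->
  mu.-integrable Ioy (EFin \o (fun t => t `^ a * (1 + t) `^ b)).
Proof.
move=> a1 ab.
(* bounds for the powers of 1 + t on ]0, 1] and of (1 + t) / t on [1, +oo[ *)
pose C := 2 `^ `|a + b + 2|; pose C' := 2 `^ `|a|.
have cI : mu.-integrable Ioy (EFin \o (fun t =>
   C * (t `^ (a + 1 - 1) * (1 + t) `^ (- (a + 1) - 1)) + C' * (1 + t) `^ (a + b))).
  apply: integrable_RD => //; apply: integrable_RZ => //.
    by apply: integrable_powR_powR1D; lra.
  exact: integrable_powR1D.
apply: le_integrable_pos cI.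
  apply: measurable_continuous_oy => t t0; apply: cvgM; first exact: powR_continuous.
  by apply: powR1D_continuous; exact: ltW.
move=> t t0; have t1 : 0 < 1 + t by rewrite addr_gt0.
rewrite ger0_norm ?mulr_ge0 ?powR_ge0//.
have [tle1|tgt1] := leP t 1.
  apply: ler_wpDr; first by rewrite mulr_ge0 ?powR_ge0.
  rewrite addrK mulrCA ler_wpM2l ?powR_ge0//.
  have -> : b = (a + b + 2) + (- (a + 1) - 1) by ring.
  rewrite powRD; last by rewrite (gt_eqF t1) implybT.
  rewrite ler_wpM2r ?powR_ge0// /C.
  apply: (@le_trans _ _ ((1 + t) `^ `|a + b + 2|)).
    by rewrite ler_powR ?ler_norm// lerDl ltW.
  by rewrite ge0_ler_powR ?nnegrE// ?(ltW t1)//; lra.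
apply: ler_wpDl; first by rewrite !mulr_ge0 ?powR_ge0.
rewrite powRD; last by rewrite (gt_eqF t1) implybT.
rewrite mulrA ler_wpM2r ?powR_ge0// /C'.
have [a0|a0] := leP 0 a.
  apply: (@le_trans _ _ ((1 + t) `^ a)).
    by rewrite ge0_ler_powR ?nnegrE// ?(ltW t0) ?(ltW t1)//; lra.
  by rewrite ler_peMl ?powR_ge0// -[leLHS](powRr0 2) ler_powR ?ler1n.
have [c c0 ->] : exists2 c, 0 <= c & a = - c by exists (- a); rewrite ?opprK// oppr_ge0 ltW.
rewrite normrN ger0_norm//.
(* on t > 1 one has 1 + t <= 2 t *)
rewrite !powRN ler_pdivlMr ?powR_gt0// mulrC ler_pdivrMr ?powR_gt0//.
rewrite -powRM ?(ltW t0)// ge0_ler_powR ?nnegrE ?mulr_ge0 ?(ltW t0) ?(ltW t1)//.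
lra.
Qed.

(** This is the [k]-th power of [1 + t / k <= e^(t / k)], together with
    [1 + t <= k * (1 + t / k)]. *)
Lemma expRN_le_powR (k : R) : 1 <= k ->
  forall t, 0 <= t -> expR (- t) <= k `^ k * (1 + t) `^ (- k).
Proof.
move=> k1 t t0; have k0 : 0 < k by lra.
have t1 : 0 < 1 + t by lra.
rewrite powRN expRN ler_pdivlMr ?powR_gt0// mulrC ler_pdivrMr ?expR_gt0//.
have -> : expR t = (expR (t / k)) `^ k by rewrite -expRM divfK// gt_eqF.
rewrite -powRM ?expR_ge0 ?(ltW k0)//.
rewrite ge0_ler_powR ?nnegrE ?mulr_ge0 ?expR_ge0 ?(ltW k0) ?(ltW t1)//.
apply: (@le_trans _ _ (k * (1 + t / k))); last by rewrite ler_pM2l ?expR_ge1Dx.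
by rewrite mulrDr mulr1 mulrCA divff ?gt_eqF// mulr1 lerD2r.
Qed.

End IntegrablePowers.

(** * The Gamma function *)

Section GammaFunction.
Context {R : realType}.
Implicit Types (f F G h : R -> R) (a b s t : R).
Local Notation mu := (@lebesgue_measure R).
Local Notation Ioy := (`]0%R, +oo[%classic : set R).

Lemma powRN_cvgy0 b : 0 < b -> t `^ (- b) @[t --> +oo] --> (0 : R).
Proof.
move=> b0; apply/cvgrPdist_le => e e0.
near=> t; rewrite sub0r normrN ger0_norm ?powR_ge0//.
have t0 : 0 < t by near: t; apply: nbhs_pinfty_gt; exact: num_real.
have et : e `^ (- b^-1) <= t by near: t; apply: nbhs_pinfty_ge; exact: num_real.
have p0 : 0 < e `^ (- b^-1) by exact: powR_gt0.
rewrite powRN invf_ple ?posrE ?powR_gt0//.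
have -> : e^-1 = (e `^ (- b^-1)) `^ b.
  by rewrite -powRrM mulNr mulVf ?gt_eqF// powR_inv1// ltW.
by rewrite ge0_ler_powR ?nnegrE ?(ltW b0) ?(ltW p0) ?(ltW t0).
Unshelve. all: end_near. Qed.

Lemma squeeze_cvg0 (F : set_system R) f g : Filter F ->
  (\forall t \near F, `|f t| <= g t) -> g t @[t --> F] --> (0 : R) ->
  f t @[t --> F] --> (0 : R).
Proof.
move=> FF fg g0; apply: norm_cvg0.
apply: (squeeze_cvgr _ (cvg_cst 0) g0).
by apply: filterS fg => t ->; rewrite normr_ge0.
Qed.

Lemma near_oy (P : R -> Prop) : (forall t, 0 < t -> P t) -> \forall t \near +oo, P t.
Proof.
by move=> H; near=> t; apply: H; near: t; apply: nbhs_pinfty_gt; exact: num_real.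
Unshelve. all: end_near. Qed.

Lemma near_at0 (P : R -> Prop) : (forall t, 0 < t -> P t) -> \forall t \near 0^'+, P t.
Proof.
by move=> H; near=> t; apply: H; near: t; exact: nbhs_right_gt.
Unshelve. all: end_near. Qed.

Lemma powR1DN_cvgy0 b : 0 < b -> (1 + t) `^ (- b) @[t --> +oo] --> (0 : R).
Proof.
move=> b0; apply: (@squeeze_cvg0 _ _ (fun t => t `^ (- b)) _ _ (powRN_cvgy0 b0)).
apply: near_oy => t t0.
rewrite ger0_norm ?powR_ge0// !powRN lef_pV2 ?posrE ?powR_gt0 ?addr_gt0//.
by rewrite ge0_ler_powR ?nnegrE ?(ltW b0) ?(ltW t0) ?addr_ge0 ?(ltW t0)// lerDr.
Qed.

(** An exponent at least [1], for which [expRN_le_powR] applies, and large enough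
    for [t^s (1 + t)^(- expN s)] to be integrable at infinity. *)
Definition expN (s : R) : R := `|s| + 2.

Lemma powR_expRN_le s t : 0 <= t ->
  t `^ s * expR (- t) <= expN s `^ expN s * (t `^ s * (1 + t) `^ (- expN s)).
Proof.
move=> t0; rewrite mulrCA ler_wpM2l ?powR_ge0// expRN_le_powR//.
by rewrite /expN; have := normr_ge0 s; lra.
Qed.

Lemma powR_expRN_cvgy0 s : t `^ s * expR (- t) @[t --> +oo] --> (0 : R).
Proof.
apply: (@squeeze_cvg0 _ _ (fun t => expN s `^ expN s * (1 + t) `^ (- 2))).
  near=> t; have t0 : 0 < t by near: t; apply: nbhs_pinfty_gt; exact: num_real.
  have t1 : 1 <= t by near: t; apply: nbhs_pinfty_ge; exact: num_real.
  rewrite ger0_norm ?mulr_ge0 ?powR_ge0 ?expR_ge0//.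
  apply: (le_trans (powR_expRN_le s (ltW t0))); rewrite ler_wpM2l ?powR_ge0//.
  have -> : - expN s = - `|s| - 2 by rewrite /expN; ring.
  rewrite powRD; last by rewrite (gt_eqF (addr_gt0 ltr01 t0)) implybT.
  rewrite mulrA ler_piMl ?powR_ge0// powRN ler_pdivrMr ?powR_gt0 ?addr_gt0// mul1r.
  apply: (@le_trans _ _ (t `^ `|s|)); first by rewrite ler_powR ?ler_norm.
  by rewrite ge0_ler_powR ?nnegrE// ?addr_ge0 ?(ltW t0)// lerDr.
rewrite -[X in _ --> X](mulr0 (expN s `^ expN s)).
apply: cvgM; first exact: cvg_cst. by apply: (@powR1DN_cvgy0 2).
Unshelve. all: end_near. Qed.

Lemma gamma_integrand_continuous s t : 0 < t ->
  {for t, continuous (fun t => t `^ s * expR (- t))}.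
Proof.
move=> t0; exact: derive_continuous (dM (is_derive1_powR s t0) (dexp (dN (dI t)))).
Qed.

Lemma integrable_gamma s : 0 < s ->
  mu.-integrable Ioy (EFin \o (fun t => t `^ (s - 1) * expR (- t))).
Proof.
move=> s0; pose C := expN (s - 1) `^ expN (s - 1).
have I : mu.-integrable Ioy (EFin \o (fun t => C *
    (t `^ (s - 1) * (1 + t) `^ (- expN (s - 1))))).
  apply: integrable_RZ => //.
  apply: integrable_powR_mul; first lra.
  by rewrite /expN; have := ler_norm (s - 1); lra.
apply: le_integrable_pos I.
  by apply: measurable_continuous_oy => t; exact: gamma_integrand_continuous.
move=> t t0; rewrite ger0_norm ?mulr_ge0 ?powR_ge0 ?expR_ge0//.
exact/powR_expRN_le/ltW.
Qed.

Lemma integral_EFin f : mu.-integrable Ioy (EFin \o f) ->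
  (\int[mu]_(t in Ioy) (f t)%:E)%E = (\int[mu]_(t in Ioy) f t)%:E.
Proof. by move=> fi; rewrite /Rintegral fineK//; exact: integrable_fin_num. Qed.

(** The same integral as an extended real, the form in which nonnegative
    integrals are exchanged. *)
Lemma GammaE s : 0 < s ->
  (\int[mu]_(t in Ioy) (t `^ (s - 1) * expR (- t))%:E)%E = (Gamma s)%:E.
Proof. by move=> s0; rewrite integral_EFin//; exact: integrable_gamma. Qed.

Lemma gamma_scaleE s c : 0 < s -> 0 < c ->
  (\int[mu]_(t in Ioy) (t `^ (s - 1) * expR (- (c * t)))%:E)%E =
  (c `^ (- s) * Gamma s)%:E.
Proof.
move=> s0 c0.
have E := @ge0_integral_scale R c (fun t => t `^ (s - 1) * expR (- t)) c0
  (fun t => @gamma_integrand_continuous (s - 1) t) _.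
have -> : (\int[mu]_(t in Ioy) (t `^ (s - 1) * expR (- (c * t)))%:E =
  (c `^ (1 - s))%:E * \int[mu]_(t in Ioy) ((c * t) `^ (s - 1) * expR (- (c * t)))%:E)%E.
  rewrite -ge0_integralZl_EFin ?powR_ge0//.
  - apply: eq_integral => t; rewrite inE/= in_itv/= andbT => t0.
    rewrite -EFinM powRM ?(ltW c0) ?(ltW t0)// !mulrA -powRD ?(gt_eqF c0) ?implybT//.
    by rewrite addrA subrK subrr powRr0 mul1r.
  - by move=> t _; rewrite lee_fin mulr_ge0 ?powR_ge0 ?expR_ge0.
  - apply/measurable_EFinP; apply: measurable_continuous_oy => t t0.
    apply: derive_continuous (dM (dpowR (s - 1) _ (dZ c (dI t))) (dexp (dN (dZ c (dI t))))).
    by rewrite mulr_gt0.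
rewrite E; last by move=> t t0; rewrite mulr_ge0 ?powR_ge0 ?expR_ge0.
rewrite GammaE// -!EFinM mulrA; congr (_ * _)%:E.
rewrite -[c^-1]powR_inv1 ?(ltW c0)// -powRD ?(gt_eqF c0) ?implybT//.
by congr (_ `^ _); ring.
Qed.

(** The integrand is bounded below by a positive constant on [[1, 2]]. *)
Lemma Gamma_gt0 s : 0 < s -> 0 < Gamma s.
Proof.
move=> s0; rewrite -lte_fin -GammaE//.
pose c : R := 2 `^ (- `|s - 1|) * expR (- 2).
have c0 : 0 < c by rewrite mulr_gt0 ?powR_gt0 ?expR_gt0.
have m12 : measurable (`[1, 2]%classic : set R) by exact: measurable_itv.
apply: (@lt_le_trans _ _ (\int[mu]_(t in `[1%R, 2%R]) (cst c%:E t))%E).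
  rewrite integral_cst// [X in (_ < _ * X)%E](_ : _ = 1%E); last first.
    have := @lebesgue_measure_itv R (`[1, 2]%R); rewrite /= lte_fin ltr1n => ->.
    by rewrite -EFinB; congr EFin; ring.
  by rewrite mule1 lte_fin.
have S : (`[1, 2]%classic : set R) `<=` Ioy.
  by apply: subset_itv; rewrite bnd_simp.
have mf : measurable_fun Ioy (fun t => t `^ (s - 1) * expR (- t)).
  by apply: measurable_continuous_oy => t; exact: gamma_integrand_continuous.
apply: (@le_trans _ _ (\int[mu]_(t in `[1%R, 2%R]) (t `^ (s - 1) * expR (- t))%:E)%E).
  apply: ge0_le_integral => //.
  - by move=> t _; rewrite lee_fin ltW.
  - by apply/measurable_EFinP; exact: measurable_funS mf.
  - move=> t /=; rewrite in_itv/= => /andP[t1 t2]; rewrite lee_fin /c.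
    rewrite ler_pM ?powR_ge0 ?expR_ge0 ?ler_expR ?lerN2//.
    apply: (@le_trans _ _ (t `^ (- `|s - 1|))).
      rewrite !powRN lef_pV2 ?posrE ?powR_gt0//; last lra.
      by rewrite ge0_ler_powR ?nnegrE//; lra.
    by rewrite ler_powR// lerNl -normrN ler_norm.
apply: ge0_subset_integral => //.
  exact/measurable_EFinP.
by move=> t _; rewrite lee_fin mulr_ge0 ?powR_ge0 ?expR_ge0.
Qed.

(** Integration by parts: [s t^(s-1) e^-t - t^s e^-t] is the derivative of
    [t^s e^-t], which vanishes at both ends. *)
Lemma GammaS s : 0 < s -> Gamma (s + 1) = s * Gamma s.
Proof.
move=> s0; pose f t := s * (t `^ (s - 1) * expR (- t)) - t `^ (s + 1 - 1) * expR (- t).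
have i1 := integrable_gamma s0.
have i2 : mu.-integrable Ioy (EFin \o (fun t => t `^ (s + 1 - 1) * expR (- t))).
  by apply: integrable_gamma; rewrite addr_gt0.
have i1' : mu.-integrable Ioy (EFin \o (fun t => s * (t `^ (s - 1) * expR (- t)))).
  exact: integrable_RZ.
have : \int[mu]_(t in Ioy) f t = 0 - 0.
  apply: (@FTC_oy _ (fun t => t `^ s * expR (- t))).
  - exact: integrable_RB.
  - move=> t t0; apply: (is_derive_eq (dM (is_derive1_powR s t0) (dexp (dN (dI t))))).
    by rewrite /f addrK; ring.
  - move=> t t0; apply: cvgB.
      by apply: cvgM; [exact: cvg_cst|exact: gamma_integrand_continuous].
    exact: gamma_integrand_continuous.
  - rewrite -[X in _ --> X](mul0r (expR (- 0))); apply: cvgM.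
      exact: powR_cvg0.
    apply: cvg_at_right_filter; apply: derive_continuous (dexp (dN (dI _))).
  - exact: powR_expRN_cvgy0.
rewrite RintegralB// subrr RintegralZl// => /eqP; rewrite subr_eq0 => /eqP.
by rewrite /Gamma => ->.
Qed.

Lemma Gamma1 : Gamma (1 : R) = 1.
Proof.
apply: EFin_inj; rewrite -GammaE//.
transitivity (\int[mu]_(t in Ioy) (expR (- t))%:E)%E.
  by apply: eq_integral => t _; rewrite subrr powRr0 mul1r.
have -> : (1 : R) = 0 - (- 1) by rewrite opprK add0r.
apply: (@ge0_FTC_oy _ (fun t => - expR (- t))).
- by move=> t _; exact: expR_ge0.
- by move=> t t0; apply: (is_derive_eq (dN (dexp (dN (dI t))))); ring.
- move=> t t0; exact: derive_continuous (dexp (dN (dI t))).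
- apply: cvgN; rewrite -[X in _ --> X]expR0 -[X in expR X]oppr0.
  apply: cvg_at_right_filter; exact: derive_continuous (dexp (dN (dI _))).
- rewrite -oppr0; apply: cvgN.
  have := @powR_expRN_cvgy0 0; apply: cvg_trans; apply: near_eq_cvg.
  by near=> t; rewrite powRr0 mul1r.
Unshelve. all: end_near. Qed.

Lemma GammaD s n : 0 < s -> Gamma (s + n%:R) = Gamma s * \prod_(j < n) (s + j%:R).
Proof.
move=> s0; elim: n => [|n IH]; first by rewrite addr0 big_ord0 mulr1.
rewrite big_ord_recr/= -natr1 addrA GammaS ?IH; first ring.
by rewrite ltr_pwDl.
Qed.

Lemma Gamma_nat n : Gamma (n.+1%:R : R) = n`!%:R.
Proof.
elim: n => [|n IH]; first by rewrite Gamma1 fact0.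
by rewrite -natr1 GammaS// IH factS natrM.
Qed.

End GammaFunction.

(** * Exchange of integrals on the quadrant *)

Section Tonelli.
Context {R : realType}.
Implicit Types (f F G h : R -> R) (a b s t : R).
Local Notation mu := (@lebesgue_measure R).
Local Notation Ioy := (`]0%R, +oo[%classic : set R).

(** Extending the integrand by zero reduces iterated integrals over the quadrant
    to iterated integrals over the plane. *)
Lemma integral2_patch (F : R * R -> \bar R) :
  (\int[mu]_(t in Ioy) \int[mu]_(z in Ioy) F (t, z) =
   \int[mu]_t \int[mu]_z (F \_ (Ioy `*` Ioy)) (t, z))%E.
Proof.
rewrite integral_mkcond; apply: eq_integral => t _; rewrite patchE.
case: ifPn => tI.
  rewrite integral_mkcond; apply: eq_integral => z _; rewrite !patchE.
  by rewrite in_setX tI.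
rewrite integral0_eq// => z _.
by rewrite patchE in_setX/= (negbTE tI).
Qed.

Lemma integral2_patchC (F : R * R -> \bar R) :
  (\int[mu]_(z in Ioy) \int[mu]_(t in Ioy) F (t, z) =
   \int[mu]_z \int[mu]_t (F \_ (Ioy `*` Ioy)) (t, z))%E.
Proof.
rewrite integral_mkcond; apply: eq_integral => z _; rewrite patchE.
case: ifPn => zI.
  rewrite integral_mkcond; apply: eq_integral => t _; rewrite !patchE.
  by rewrite in_setX/= zI andbT.
rewrite integral0_eq// => t _.
by rewrite patchE in_setX/= (negbTE zI) andbF.
Qed.

Lemma measurable_Ioy2 : measurable (Ioy `*` Ioy).
Proof. by apply: measurableX; exact: measurable_Ioy. Qed.

Lemma tonelli_oy (F : R * R -> R) : measurable_fun setT F ->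
  (forall t z, 0 < t -> 0 < z -> 0 <= F (t, z)) ->
  (\int[mu]_(t in Ioy) \int[mu]_(z in Ioy) (F (t, z))%:E =
   \int[mu]_(z in Ioy) \int[mu]_(t in Ioy) (F (t, z))%:E)%E.
Proof.
move=> mF F0.
rewrite (integral2_patch (EFin \o F)) (integral2_patchC (EFin \o F)).
apply: (@fubini_tonelli _ _ _ _ R lebesgue_measure lebesgue_measure).
  apply/(measurable_restrictT _ measurable_Ioy2).
  by apply: measurable_funTS; exact/measurable_EFinP.
move=> [t z]; rewrite patchE; case: ifPn => //.
rewrite in_setX => /andP[/set_mem + /set_mem]; rewrite /= !in_itv/= !andbT => t0 z0.
by rewrite lee_fin F0.
Qed.

Lemma fubini_oy (F : R * R -> R) : measurable_fun setT F ->
  (\int[mu]_(t in Ioy) \int[mu]_(z in Ioy) `|F (z, t)|%:E < +oo)%E ->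
  mu.-integrable Ioy (fun z => \int[mu]_(t in Ioy) (F (z, t))%:E)%E /\
  (\int[mu]_(z in Ioy) \int[mu]_(t in Ioy) (F (z, t))%:E =
   \int[mu]_(t in Ioy) \int[mu]_(z in Ioy) (F (z, t))%:E)%E.
Proof.
move=> mF Foo.
have mp : measurable_fun setT ((EFin \o F) \_ (Ioy `*` Ioy)).
  apply/(measurable_restrictT _ measurable_Ioy2).
  by apply: measurable_funTS; exact/measurable_EFinP.
have I : (lebesgue_measure \x lebesgue_measure)%E.-integrable setT
    ((EFin \o F) \_ (Ioy `*` Ioy)).
  apply/(@integrable21ltyP _ _ _ _ R lebesgue_measure lebesgue_measure _ mp).
  rewrite (integral2_patchC (fun p => `|F p|%:E)) in Foo.
  apply: le_lt_trans Foo; rewrite le_eqVlt; apply/orP; left; apply/eqP.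
  apply: eq_integral => t _; apply: eq_integral => z _.
  by rewrite !patchE; case: ifPn => //; rewrite abse0.
split; last first.
  rewrite (integral2_patch (EFin \o F)) (integral2_patchC (EFin \o F)).
  exact: (@Fubini _ _ _ _ R lebesgue_measure lebesgue_measure).
apply/integrable_mkcond; first exact: measurable_Ioy.
have := @integrable_fubini_F _ _ _ _ R lebesgue_measure lebesgue_measure _ I.
congr (integrable _ _); apply/funext => z.
rewrite /fubini_F patchE.
case: ifPn => zI.
  rewrite [in RHS]integral_mkcond; apply: eq_integral => t _; rewrite !patchE.
  by rewrite in_setX/= zI.
rewrite integral0_eq// => t _.
by rewrite patchE in_setX/= (negbTE zI).
Qed.

End Tonelli.

(** * The beta integral *)

Section BetaIntegral.
Context {R : realType}.
Implicit Types (f F G h : R -> R) (a b s t p q rho : R).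
Local Notation mu := (@lebesgue_measure R).
Local Notation Ioy := (`]0%R, +oo[%classic : set R).

Lemma eq_integral_oy (f g : R -> \bar R) : (forall t, 0 < t -> f t = g t) ->
  (\int[mu]_(t in Ioy) f t = \int[mu]_(t in Ioy) g t)%E.
Proof.
by move=> fg; apply: eq_integral => t; rewrite inE/= in_itv/= andbT => /fg.
Qed.

Lemma ge0_integralZl_oy c f : 0 <= c ->
  measurable_fun Ioy f ->
  (forall t, 0 < t -> 0 <= f t) ->
  (\int[mu]_(t in Ioy) (c * f t)%:E = c%:E * \int[mu]_(t in Ioy) (f t)%:E)%E.
Proof.
move=> c0 mf f0; rewrite -ge0_integralZl_EFin//.
- by move=> t; rewrite /= in_itv/= andbT lee_fin => /f0.
- exact/measurable_EFinP.
Qed.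

Lemma exp_scale_continuous s c t : 0 < t ->
  {for t, continuous (fun t => t `^ s * expR (- (c * t)))}.
Proof.
move=> t0.
exact: derive_continuous (dM (is_derive1_powR s t0) (dexp (dN (dZ c (dI t))))).
Qed.

(** Write [(rho + z)^(-(p+q))] times [Gamma (p + q)] as the integral of
    [t^(p+q-1) e^(-(rho+z)t)] and integrate in [z] first: both integrals become
    scaled Gamma integrals. *)
Lemma beta_integralE p q rho : 0 < p -> 0 < q -> 0 < rho ->
  (\int[mu]_(z in Ioy) (z `^ (p - 1) * (rho + z) `^ (- (p + q)))%:E =
   (Gamma p * Gamma q / Gamma (p + q) * rho `^ (- q))%:E)%E.
Proof.
move=> p0 q0 r0.
have G0 : 0 < Gamma (p + q) by rewrite Gamma_gt0// addr_gt0.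
pose F (x : R * R) := x.1 `^ (p + q - 1) * expR (- (rho * x.1)) *
                      (x.2 `^ (p - 1) * expR (- (x.1 * x.2))).
have mF : measurable_fun setT F.
  rewrite /F; apply: measurable_funM; apply: measurable_funM.
  - exact: (measurableT_comp (measurable_powR _)).
  - apply: measurableT_comp => //; apply: measurableT_comp => //.
    exact: measurable_funM.
  - exact: (measurableT_comp (measurable_powR _)).
  - apply: measurableT_comp => //; apply: measurableT_comp => //.
    exact: measurable_funM.
have F0 t z : 0 < t -> 0 < z -> 0 <= F (t, z).
  by move=> _ _; rewrite /F/= !mulr_ge0 ?powR_ge0 ?expR_ge0.
have := tonelli_oy mF F0.
have -> : (\int[mu]_(t in Ioy) \int[mu]_(z in Ioy) (F (t, z))%:E)%E =
          (Gamma p * (rho `^ (- q) * Gamma q))%:E.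
  transitivity (\int[mu]_(t in Ioy) (Gamma p * (t `^ (q - 1) * expR (- (rho * t))))%:E)%E.
    apply: eq_integral_oy => t t0; rewrite /F/= ge0_integralZl_oy//.
    - rewrite gamma_scaleE// -EFinM; congr EFin.
      have -> : t `^ (p + q - 1) = t `^ p * t `^ (q - 1).
        by rewrite -gt0_powRD// addrA.
      by rewrite powRN; field; rewrite gt_eqF ?powR_gt0.
    - by rewrite mulr_ge0 ?powR_ge0 ?expR_ge0.
    - by apply: measurable_continuous_oy => z; exact: exp_scale_continuous.
    - by move=> z _; rewrite mulr_ge0 ?powR_ge0 ?expR_ge0.
  rewrite ge0_integralZl_oy ?gamma_scaleE//.
  - by rewrite ltW ?Gamma_gt0.
  - by apply: measurable_continuous_oy => z; exact: exp_scale_continuous.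
  - by move=> z _; rewrite mulr_ge0 ?powR_ge0 ?expR_ge0.
move=> E.
have mz : measurable_fun Ioy (fun z : R => z `^ (p - 1) * (rho + z) `^ (- (p + q))).
  apply: measurable_continuous_oy => z z0.
  apply: derive_continuous (dM (is_derive1_powR _ z0) (dpowR _ _ (dD (dC rho z) (dI z)))).
  by rewrite addr_gt0.
have E2 : (\int[mu]_(z in Ioy) \int[mu]_(t in Ioy) (F (t, z))%:E =
   (Gamma (p + q))%:E * \int[mu]_(z in Ioy) (z `^ (p - 1) * (rho + z) `^ (- (p + q)))%:E)%E.
  rewrite -ge0_integralZl_oy ?(ltW G0)//.
    apply: eq_integral_oy => z z0.
    transitivity (\int[mu]_(t in Ioy) (z `^ (p - 1) *
        (t `^ (p + q - 1) * expR (- ((rho + z) * t))))%:E)%E.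
      apply: eq_integral_oy => t t0; rewrite /F/=.
      rewrite mulrDl opprD expRD (mulrC t z); congr EFin; ring.
    rewrite ge0_integralZl_oy ?powR_ge0//.
    - rewrite gamma_scaleE ?addr_gt0// -EFinM; congr EFin; ring.
    - by apply: measurable_continuous_oy => t; exact: exp_scale_continuous.
    - by move=> t _; rewrite mulr_ge0 ?powR_ge0 ?expR_ge0.
  by move=> z _; rewrite mulr_ge0 ?powR_ge0.
rewrite E2 in E.
have -> : Gamma p * Gamma q / Gamma (p + q) * rho `^ (- q) =
   (Gamma (p + q))^-1 * (Gamma p * (rho `^ (- q) * Gamma q)).
  by field; rewrite gt_eqF.
by rewrite EFinM E muleA -EFinM mulVf ?mul1e// gt_eqF.
Qed.

(** Both [v] and [1] bound [1 - e^-v], and [2 v / (1 + v)] dominates their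
    minimum; in this form the bound integrates against powers of [v]. *)
Lemma one_sub_expRN_le (v : R) : 0 < v -> 0 <= 1 - expR (- v) <= 2 * (v / (1 + v)).
Proof.
move=> v0; have v1 : 0 < 1 + v by rewrite addr_gt0.
rewrite subr_ge0 -[leRHS]expR0 ler_expR oppr_le0 ltW//=.
rewrite mulrA ler_pdivlMr//.
have [v1'|v1'] := leP v 1.
  have H : 1 - expR (- v) <= v by have := expR_ge1Dx (- v); lra.
  have : (1 - expR (- v)) * (1 + v) <= v * 2.
    by apply: ler_pM; rewrite ?subr_ge0 -?[leRHS]expR0 ?ler_expR//; lra.
  lra.
have H := expR_ge0 (- v).
have : (1 - expR (- v)) * (1 + v) <= 1 * (1 + v) by rewrite ler_wpM2r; lra.
lra.
Qed.

Lemma one_sub_expRN_powR_continuous (a v : R) : 0 < v ->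
  {for v, continuous (fun v => (1 - expR (- v)) * v `^ a)}.
Proof.
move=> v0.
exact: derive_continuous (dM (dB (dC 1 v) (dexp (dN (dI v)))) (is_derive1_powR a v0)).
Qed.

(** Integration by parts with [- v^(-a) / a] as the primitive of [v^(-a-1)]; the
    boundary term vanishes at [0] because [a < 1] and at infinity because
    [0 < a]. *)
Lemma integral_one_sub_expRN a : 0 < a -> a < 1 ->
  (\int[mu]_(v in Ioy) ((1 - expR (- v)) * v `^ (- a - 1))%:E =
   (Gamma (1 - a) / a)%:E)%E.
Proof.
move=> a0 a1.
pose f1 (v : R) : R := (1 - expR (- v)) * v `^ (- a - 1).
pose f2 (v : R) : R := v `^ (1 - a - 1) * expR (- v).
have i2 : mu.-integrable Ioy (EFin \o f2) by apply: integrable_gamma; lra.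
have i1 : mu.-integrable Ioy (EFin \o f1).
  apply: (@le_integrable_pos _ _ (fun v : R => 2 * (v `^ (- a) * (1 + v) `^ (- 1)))).
  - by apply: measurable_continuous_oy => v; exact: one_sub_expRN_powR_continuous.
  - move=> v v0; have /andP[H1 H2] := one_sub_expRN_le v0.
    rewrite ger0_norm ?mulr_ge0 ?powR_ge0//.
    rewrite (gt0_powRS (- a) v0).
    rewrite powR_inv1 ?addr_ge0 ?(ltW v0)//.
    have -> : 2 * (v * v `^ (- a - 1) * (1 + v)^-1) = 2 * (v / (1 + v)) * v `^ (- a - 1).
      by ring.
    by rewrite ler_wpM2r ?powR_ge0.
  - apply: (@integrable_RZ _ _ 2 (fun v => v `^ (- a) * (1 + v) `^ (- 1))).
      exact: measurable_Ioy.
    by apply: integrable_powR_mul; lra.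
rewrite integral_EFin//; congr EFin.
have i2' : mu.-integrable Ioy (EFin \o (fun v => a^-1 * f2 v)).
  by apply: (@integrable_RZ _ _ _ f2) => //; exact: measurable_Ioy.
have : \int[mu]_(v in Ioy) (f1 v - a^-1 * f2 v) = 0 - 0.
  apply: (@FTC_oy R (fun v : R => - a^-1 * ((1 - expR (- v)) * v `^ (- a)))
    (fun v : R => f1 v - a^-1 * f2 v)).
  - by apply: integrable_RB => //; exact: measurable_Ioy.
  - move=> v v0; apply: (is_derive_eq (dZ _ (dM (dB (dC 1 v) (dexp (dN (dI v))))
      (is_derive1_powR (- a) v0)))).
    rewrite /f1 /f2 (_ : 1 - a - 1 = - a); last by ring.
    by field; rewrite gt_eqF.
  - move=> v v0; apply: cvgB; first exact: one_sub_expRN_powR_continuous.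
    apply: cvgM; first exact: cvg_cst.
    exact: gamma_integrand_continuous.
  - apply: (@squeeze_cvg0 _ _ _ (fun v => a^-1 * (2 * v `^ (1 - a)))).
      apply: near_at0 => v v0; have /andP[H1 H2] := one_sub_expRN_le v0.
      have ia0 : 0 <= a^-1 by rewrite invr_ge0 ltW.
      rewrite normrM normrN (ger0_norm ia0); apply: ler_wpM2l => //.
      rewrite ger0_norm ?mulr_ge0 ?powR_ge0//.
      apply: (@le_trans _ _ (2 * v * v `^ (- a))).
        rewrite ler_wpM2r ?powR_ge0//; apply: (le_trans H2).
        rewrite ler_pM2l// ler_piMr ?(ltW v0)// invf_le1 ?addr_gt0//; lra.
      rewrite -mulrA ler_pM2l// -[X in X * _](@powRr1 _ v) ?(ltW v0)//.
      by rewrite -gt0_powRD.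
    rewrite [X in _ --> X](_ : _ = a^-1 * (2 * 0)); last by rewrite !mulr0.
    apply: cvgM; first exact: cvg_cst.
    apply: cvgM; first exact: cvg_cst.
    by apply: powR_cvg0; lra.
  - apply: (@squeeze_cvg0 _ _ _ (fun v => a^-1 * v `^ (- a))).
      apply: near_oy => v v0; have /andP[H1 H2] := one_sub_expRN_le v0.
      have ia0 : 0 <= a^-1 by rewrite invr_ge0 ltW.
      rewrite normrM normrN (ger0_norm ia0); apply: ler_wpM2l => //.
      rewrite ger0_norm ?mulr_ge0 ?powR_ge0// ler_piMl ?powR_ge0//.
    rewrite -[X in _ --> X](mulr0 a^-1).
    by apply: cvgM; [exact: cvg_cst|exact: powRN_cvgy0].
have mI := @measurable_Ioy R.
rewrite RintegralB// subrr RintegralZl// => /eqP; rewrite subr_eq0 => /eqP ->.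
by rewrite mulrC.
Qed.

End BetaIntegral.

(** * The cosine transform of the Gaussian *)

Section CosineIntegral.
Context {R : realType}.
Implicit Types (f F G h : R -> R) (a b s t y : R).
Local Notation mu := (@lebesgue_measure R).
Local Notation Ioy := (`]0%R, +oo[%classic : set R).

(** Because [t^2 - t + 1/4] is a square. *)
Lemma gauss_le_expRN t : expR (- t ^+ 2) <= expR 4^-1 * expR (- t).
Proof.
rewrite -expRD ler_expR; have := sqr_ge0 (t - 2^-1); rewrite sqrrB; lra.
Qed.

Lemma dgauss t : is_derive t 1 (fun t => expR (- t ^+ 2)) (- 2 * t * expR (- t ^+ 2)).
Proof.
apply: (is_derive_eq (dexp (dN (dX 2 (dI t))))).
by rewrite /=; ring.
Qed.

Lemma integrable_expRN_affine (A B : R) :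
  mu.-integrable Ioy (EFin \o (fun t => (A + B * t) * expR (- t))).
Proof.
have I0 : mu.-integrable Ioy (EFin \o (fun t => t `^ (1 - 1) * expR (- t))).
  exact: integrable_gamma.
have I1 : mu.-integrable Ioy (EFin \o (fun t => t `^ (2 - 1) * expR (- t))).
  exact: integrable_gamma.
have I : mu.-integrable Ioy (EFin \o (fun t =>
   A * (t `^ (1 - 1) * expR (- t)) + B * (t `^ (2 - 1) * expR (- t)))).
  apply: integrable_RD; first exact: measurable_Ioy.
    by apply: integrable_RZ => //; exact: measurable_Ioy.
  by apply: integrable_RZ => //; exact: measurable_Ioy.
apply: eq_integrable I; first exact: measurable_Ioy.
move=> t; rewrite inE/= in_itv/= andbT => t0; congr EFin.
rewrite subrr powRr0 (_ : 2 - 1 = 1); last ring.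
by rewrite powRr1 ?ltW//; ring.
Qed.

(** Multiplied by [e^(y^2/4)] the integral does not depend on [y]: the derivative
    in [y] of the integrand is the derivative in [t] of
    [e^(y^2/4) sin(yt) e^(-t^2) / 2]. At [y = 0] it is the Gaussian integral. *)
Lemma gauss_cosine y :
  \int[mu]_(t in Ioy) (cos (y * t) * expR (- t ^+ 2)) =
  Num.sqrt pi / 2 * expR (- (y ^+ 2 / 4)).
Proof.
(* an open interval of parameters that contains both y and 0 *)
pose M := `|y| + 1.
have My : y \in `]- M, M[.
  rewrite in_itv/= -ltr_norml /M; lra.
have M0 : 0 \in `]- M, M[.
  rewrite in_itv/= /M; have := normr_ge0 y; lra.
pose E (b : R) := expR (b ^+ 2 / 4).
pose P b t := E b * (cos (b * t) * expR (- t ^+ 2)).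
pose P' b t := E b * ((b / 2 * cos (b * t) - t * sin (b * t)) * expR (- t ^+ 2)).
pose X b t := E b * (sin (b * t) / 2 * expR (- t ^+ 2)).
have dE b : is_derive b 1 E (b / 2 * E b).
  apply: (is_derive_eq (dexp (dM (dX 2 (dI b)) (dC 4^-1 b)))).
  by rewrite /E/=; field.
have dcosb c b : is_derive b 1 (fun b => cos (b * c)) (- sin (b * c) * c).
  apply: (is_derive_eq (dcos (dM (dI b) (dC c b)))); ring.
have dsinb c b : is_derive b 1 (fun b => sin (b * c)) (cos (b * c) * c).
  apply: (is_derive_eq (dsin (dM (dI b) (dC c b)))); ring.
have dcost c b : is_derive b 1 (fun b => cos (c * b)) (- sin (c * b) * c).
  apply: (is_derive_eq (dcos (dZ c (dI b)))); ring.
have dsint c b : is_derive b 1 (fun b => sin (c * b)) (cos (c * b) * c).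
  apply: (is_derive_eq (dsin (dZ c (dI b)))); ring.
have intP b : mu.-integrable Ioy (EFin \o P b).
  apply: (@le_integrable_pos _ _ (fun t => (E b * expR 4^-1 + 0 * t) * expR (- t))).
  - apply: measurable_continuous_oy => t _.
    exact: derive_continuous (dZ _ (dM (dcost b t) (dgauss t))).
  - move=> t t0; rewrite /P mul0r addr0 -mulrA normrM ger0_norm ?expR_ge0//.
    rewrite ler_wpM2l ?expR_ge0// normrM (ger0_norm (expR_ge0 _)).
    apply: le_trans (gauss_le_expRN t).
    by rewrite ler_piMl ?expR_ge0 ?cos_max.
  - exact: integrable_expRN_affine.
have EM b : b \in `]- M, M[ -> E b <= expR (M ^+ 2 / 4).
  rewrite in_itv/= => /andP[b1 b2]; rewrite ler_expR ler_wpM2r ?invr_ge0//.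
  have : 0 <= (M - b) * (M + b) by rewrite mulr_ge0//; lra.
  lra.
have key := @integral_const_param R (- M) M P P' X
  (fun t => (expR (M ^+ 2 / 4) * expR 4^-1 * M + expR (M ^+ 2 / 4) * expR 4^-1 * t)
            * expR (- t)).
have H : \int[mu]_(t in Ioy) P y t = \int[mu]_(t in Ioy) P 0 t.
  apply: key => //.
  - move=> b t bM t0; apply: (is_derive_eq (dM (dE b) (dM (dcosb t b) (dC (expR (- t ^+ 2)) b)))).
    by rewrite /P'; field.
  - move=> b t bM t0.
    apply: (is_derive_eq (dZ (E b) (dM (dM (dsint b t) (dC 2^-1 t)) (dgauss t)))).
    by rewrite /P'; field.
  - move=> b t bM t0; apply: derive_continuous (dZ (E b) (dM (dB (dZ (b / 2) (dcost b t))
       (dM (dI t) (dsint b t))) (dgauss t))).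
  - exact: integrable_expRN_affine.
  - move=> b t bM t0; rewrite /P' normrM (ger0_norm (expR_ge0 _)).
    have -> : (expR (M ^+ 2 / 4) * expR 4^-1 * M + expR (M ^+ 2 / 4) * expR 4^-1 * t) * expR (- t)
      = expR (M ^+ 2 / 4) * ((M + t) * (expR 4^-1 * expR (- t))) by ring.
    rewrite ler_pM ?expR_ge0 ?EM// normrM (ger0_norm (expR_ge0 _)).
    rewrite ler_pM ?expR_ge0 ?gauss_le_expRN//.
    apply: (le_trans (ler_normB _ _)); rewrite !normrM; apply: lerD.
      apply: (@le_trans _ _ (`|b| * `|2^-1|)); first by rewrite ler_piMr ?cos_max ?mulr_ge0.
      rewrite (ger0_norm (x := 2^-1))//.
      move: bM; rewrite in_itv/= -ltr_norml => bM; have := normr_ge0 b; lra.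
    by rewrite (gtr0_norm t0) ler_piMr ?sin_max ?ltW.
  - move=> b bM; rewrite [Z in _ --> Z](_ : 0 = X b 0); last by rewrite /X mulr0 sin0 !mul0r mulr0.
    apply: cvg_at_right_filter.
    exact: derive_continuous (dZ (E b) (dM (dM (dsint b 0) (dC 2^-1 0)) (dgauss 0))).
  - move=> b bM; apply: (@squeeze_cvg0 _ _ _ (fun t => E b * expR 4^-1 * (t `^ 0 * expR (- t)))).
      apply: near_oy => t t0; rewrite /X normrM (ger0_norm (expR_ge0 _)) powRr0 mul1r -[leRHS]mulrA.
      rewrite ler_wpM2l ?expR_ge0// normrM (ger0_norm (expR_ge0 _)).
      apply: le_trans (gauss_le_expRN t); rewrite ler_piMl ?expR_ge0//.
      rewrite normrM (ger0_norm (x := 2^-1))//; have := sin_max (b * t); lra.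
    rewrite -[X in _ --> X](mulr0 (E b * expR 4^-1)).
    by apply: cvgM; [exact: cvg_cst|exact: powR_expRN_cvgy0].
have E0 : \int[mu]_(t in Ioy) P 0 t = Num.sqrt pi / 2.
  rewrite /Rintegral; have /(congr1 fine) := @integral0y_gauss R.
  rewrite /= => <-; congr fine; rewrite -[RHS]integral_itv_obnd_cbnd; last first.
    apply/measurable_EFinP; apply: measurable_funTS; exact: measurable_gauss_fun.
  apply: eq_integral_oy => t t0.
  by rewrite /P /E mul0r cos0 expr0n/= mul0r expR0 !mul1r.
have Ey : E y != 0 by rewrite gt_eqF ?expR_gt0.
rewrite expRN -[expR _]/(E y) -E0 -H.
rewrite (_ : P y = fun t => E y * (cos (y * t) * expR (- t ^+ 2)))//.
rewrite RintegralZl//.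
- by rewrite [RHS]mulrC mulKf.
- have := integrable_RZ (E y)^-1 measurable_Ioy (intP y).
  apply: eq_integrable; first exact: measurable_Ioy.
  by move=> t _; congr EFin; rewrite /P mulrA mulVf ?mul1r.
Qed.

End CosineIntegral.

(** * The constant of the fractional Laplacian *)

Section OneSubCos.
Context {R : realType}.
Implicit Types (f F G h : R -> R) (a b s t y c v al : R).
Local Notation mu := (@lebesgue_measure R).
Local Notation Ioy := (`]0%R, +oo[%classic : set R).

Lemma ge0_integral_sqrt c G : 0 < c ->
  (forall t : R, 0 < t -> {for t, continuous G}) ->
  (forall t : R, 0 < t -> 0 <= G t) ->
  (\int[mu]_(t in Ioy) (G t)%:E =
   \int[mu]_(v in Ioy) (G (c * v `^ 2^-1) * (c * (2^-1 * v `^ (2^-1 - 1))))%:E)%E.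
Proof.
move=> c0 cG G0.
apply: (@ge0_substitution_oy R (fun v => c * v `^ 2^-1)
   (fun v => c * (2^-1 * v `^ (2^-1 - 1))) G 0) => //.
- by move=> v v0; exact: (dZ c (is_derive1_powR _ v0)).
- by move=> v v0; rewrite !mulr_gt0 ?powR_gt0.
- by move=> v v0; exact: derive_continuous (dZ c (dZ 2^-1 (is_derive1_powR _ v0))).
- rewrite [X in _ --> X](_ : _ = c * (2^-1 * 0)); last by rewrite !mulr0.
  apply: cvgM; first exact: cvg_cst.
  apply: cvgM; first exact: cvg_cst.
  have -> : 2^-1 - 1 = - 2^-1 :> R by lra.
  by apply: powRN_cvgy0; rewrite invr_gt0.
- by move=> v v0; rewrite mulr_gt0 ?powR_gt0.
- rewrite [X in _ --> X](_ : _ = c * 0); last by rewrite mulr0.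
  apply: cvgM; first exact: cvg_cst.
  by apply: powR_cvg0; rewrite invr_gt0.
- apply: gt0_cvgMry => //.
  apply/cvgryPge => A; near=> v.
  have v0 : 0 < v by near: v; apply: nbhs_pinfty_gt; exact: num_real.
  have Av : A ^+ 2 <= v by near: v; apply: nbhs_pinfty_ge; exact: num_real.
  rewrite powR12_sqrt ?(ltW v0)// (le_trans (ler_norm A))//.
  by rewrite -sqrtr_sqr ler_sqrt.
Unshelve. all: end_near. Qed.

Lemma powR_half_double v s : 0 < v -> (v `^ 2^-1) `^ s = v `^ (s / 2).
Proof. by move=> v0; rewrite -powRrM mulrC. Qed.

Lemma sqr_powR_half v : 0 < v -> (v `^ 2^-1) ^+ 2 = v.
Proof. by move=> v0; rewrite powR12_sqrt ?sqr_sqrtr ?ltW. Qed.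

Lemma integral_powR_gauss s : 0 < s ->
  (\int[mu]_(t in Ioy) (t `^ (s - 1) * expR (- t ^+ 2))%:E = (2^-1 * Gamma (s / 2))%:E)%E.
Proof.
move=> s0; rewrite (@ge0_integral_sqrt 1)//.
- transitivity (\int[mu]_(v in Ioy) (2^-1 * (v `^ (s / 2 - 1) * expR (- v)))%:E)%E.
    apply: eq_integral_oy => v v0; congr EFin.
    rewrite !mul1r sqr_powR_half// powR_half_double//.
    have -> : s / 2 - 1 = (s - 1) / 2 + (2^-1 - 1) by lra.
    by rewrite [in RHS]gt0_powRD//; ring.
  rewrite ge0_integralZl_oy//; first by rewrite GammaE ?divr_gt0.
    apply: measurable_continuous_oy => t; exact: gamma_integrand_continuous.
  by move=> t _; rewrite mulr_ge0 ?powR_ge0 ?expR_ge0.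
- move=> t t0; exact: derive_continuous (dM (is_derive1_powR _ t0) (dgauss t)).
- by move=> t _; rewrite mulr_ge0 ?powR_ge0 ?expR_ge0.
Qed.

Lemma integral_one_sub_gauss al : 0 < al -> al < 2 ->
  (\int[mu]_(y in Ioy) ((1 - expR (- (y ^+ 2 / 4))) * y `^ (- al - 1))%:E =
   (2 `^ (- al) * (Gamma (1 - al / 2) / al))%:E)%E.
Proof.
move=> a0 a2; rewrite (@ge0_integral_sqrt 2)//.
- transitivity (\int[mu]_(v in Ioy) (2 `^ (- al - 1) *
    ((1 - expR (- v)) * v `^ (- (al / 2) - 1)))%:E)%E.
    apply: eq_integral_oy => v v0; congr EFin.
    rewrite exprMn sqr_powR_half// powRM ?powR_ge0// powR_half_double//.
    have -> : 2 ^+ 2 * v / 4 = v by field.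
    have -> : - (al / 2) - 1 = (- al - 1) / 2 + (2^-1 - 1) by lra.
    by rewrite [in RHS](gt0_powRD _ _ v0); field.
  rewrite ge0_integralZl_oy ?powR_ge0//.
  + rewrite integral_one_sub_expRN//; [|lra|lra].
    rewrite -EFinM; congr EFin.
    by rewrite [in RHS](@gt0_powRS R (- al) 2)//; field; rewrite gt_eqF.
  + by apply: measurable_continuous_oy => v; exact: one_sub_expRN_powR_continuous.
  + move=> v v0; have /andP[H _] := one_sub_expRN_le v0.
    by rewrite mulr_ge0 ?powR_ge0.
- move=> t t0.
  exact: derive_continuous (dM (dB (dC 1 t) (dexp (dN (dM (dX 2 (dI t)) (dC 4^-1 t)))))
    (is_derive1_powR _ t0)).
- move=> t t0; rewrite mulr_ge0 ?powR_ge0// subr_ge0 -[leRHS]expR0 ler_expR oppr_le0.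
  by rewrite mulr_ge0 ?sqr_ge0.
Qed.

(** The value of the integral of [(1 - cos y) y^(-al-1)] over the half-line; see
    [integral_one_sub_cos1]. *)
Definition cos_const al : R :=
  Num.sqrt pi * 2 `^ (- al) * Gamma (1 - al / 2) / (al * Gamma ((1 + al) / 2)).

Lemma one_sub_cos_continuous t s y : 0 < y ->
  {for y, continuous (fun y => (1 - cos (t * y)) * y `^ s)}.
Proof.
move=> y0; exact: derive_continuous (dM (dB (dC 1 y) (dcos (dZ t (dI y))))
   (is_derive1_powR s y0)).
Qed.

Lemma one_sub_cos_ge0 t s y : 0 <= (1 - cos (t * y)) * y `^ s.
Proof. by rewrite mulr_ge0 ?powR_ge0// subr_ge0 cos_le1. Qed.

Lemma integral_one_sub_cos_scale al t : 0 < t ->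
  (\int[mu]_(y in Ioy) ((1 - cos (t * y)) * y `^ (- al - 1))%:E =
   (t `^ al)%:E * \int[mu]_(y in Ioy) ((1 - cos (1 * y)) * y `^ (- al - 1))%:E)%E.
Proof.
move=> t0; pose G y := (1 - cos (1 * y)) * y `^ (- al - 1).
have := @ge0_integral_scale R t G t0 (@one_sub_cos_continuous 1 (- al - 1))
   (fun y _ => one_sub_cos_ge0 1 (- al - 1) y).
move=> /(congr1 (fun z => (t `^ (al + 1))%:E * z)%E).
rewrite muleA -EFinM (_ : t `^ (al + 1) * t^-1 = t `^ al); last first.
  by rewrite [X in X / _](gt0_powRS _ t0) addrK mulrC mulKf// gt_eqF.
move=> <-; rewrite -ge0_integralZl_oy ?powR_ge0//.
- apply: eq_integral_oy => y y0; congr EFin; rewrite /G mul1r.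
  have E : t `^ (al + 1) * t `^ (- al - 1) = 1.
    by rewrite -gt0_powRD// (_ : al + 1 + (- al - 1) = 0) ?powRr0//; ring.
  by rewrite powRM ?ltW// -[RHS]mul1r -[LHS]mul1r -{1}E; ring.
- apply: measurable_continuous_oy => y y0.
  apply: (@continuous_comp _ _ _ ( *%R t) G); first exact: mulrl_continuous.
  by apply: one_sub_cos_continuous; rewrite mulr_gt0.
- by move=> y _; exact: one_sub_cos_ge0.
Qed.

(** Let [K] be the unknown value. The scaled integral with [cos (t y)] is
    [t^al K]; average it against [e^(-t^2)]. On one side this gives [K] times a
    Gamma value, and on the other, by Tonelli and [gauss_cosine], the integral of
    [(1 - e^(-y^2/4)) y^(-al-1)], which is a Gamma value as well. *)
Lemma integral_one_sub_cos1 al : 0 < al -> al < 2 ->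
  (\int[mu]_(y in Ioy) ((1 - cos (1 * y)) * y `^ (- al - 1))%:E =
   (cos_const al)%:E)%E.
Proof.
move=> a0 a2; set K := (\int[mu]_(y in Ioy) _)%E.
pose F (p : R * R) := expR (- p.1 ^+ 2) * ((1 - cos (p.1 * p.2)) * p.2 `^ (- al - 1)).
have mF : measurable_fun setT F.
  rewrite /F; apply: measurable_funM; [|apply: measurable_funM].
  - apply: measurableT_comp => //; apply: measurableT_comp => //.
    exact: measurable_funX.
  - apply: measurable_funB => //.
    apply: (@measurableT_comp _ _ _ _ _ _ (@cos R)).
      by apply: continuous_measurable_fun; exact: continuous_cos.
    exact: measurable_funM.
  - exact: (measurableT_comp (measurable_powR _)).
have F0 t y : 0 < t -> 0 < y -> 0 <= F (t, y).
  by move=> _ _; rewrite /F/= mulr_ge0 ?expR_ge0 ?one_sub_cos_ge0.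
have G0 : 0 < Gamma ((1 + al) / 2) by rewrite Gamma_gt0//; lra.
have := tonelli_oy mF F0.
(* y first: the scaling t^al K against the Gaussian *)
have -> : (\int[mu]_(t in Ioy) \int[mu]_(y in Ioy) (F (t, y))%:E)%E =
   ((2^-1 * Gamma ((1 + al) / 2))%:E * K)%E.
  rewrite -integral_powR_gauss; last lra.
  rewrite -ge0_integralZr//.
  - apply: eq_integral_oy => t t0; rewrite /F/= ge0_integralZl_oy ?expR_ge0//.
    + rewrite integral_one_sub_cos_scale// muleA -EFinM mulrC.
      by congr ((_ `^ _ * _)%:E * _)%E; ring.
    + by apply: measurable_continuous_oy => y; exact: one_sub_cos_continuous.
    + by move=> y _; exact: one_sub_cos_ge0.
  - apply/measurable_EFinP; apply: measurable_continuous_oy => t t0.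
    exact: derive_continuous (dM (is_derive1_powR _ t0) (dgauss t)).
  - by move=> t _; rewrite lee_fin mulr_ge0 ?powR_ge0 ?expR_ge0.
  - by apply: integral_ge0 => y _; rewrite lee_fin one_sub_cos_ge0.
(* t first: the cosine transform of the Gaussian *)
have ig : mu.-integrable Ioy (EFin \o (fun t => expR (- t ^+ 2))).
  have := @integrableT_gauss R; apply: integrableS => //; exact: measurable_Ioy.
have igc y : mu.-integrable Ioy (EFin \o (fun t => cos (y * t) * expR (- t ^+ 2))).
  apply: le_integrable_pos ig.
    apply: measurable_continuous_oy => t t0.
    exact: derive_continuous (dM (dcos (dZ y (dI t))) (dgauss t)).
  move=> t t0; rewrite normrM (ger0_norm (expR_ge0 _)).
  by rewrite ler_piMl ?expR_ge0 ?cos_max.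
have -> : (\int[mu]_(y in Ioy) \int[mu]_(t in Ioy) (F (t, y))%:E)%E =
   (Num.sqrt pi / 2 * (2 `^ (- al) * (Gamma (1 - al / 2) / al)))%:E.
  transitivity (\int[mu]_(y in Ioy) (Num.sqrt pi / 2 *
     ((1 - expR (- (y ^+ 2 / 4))) * y `^ (- al - 1)))%:E)%E.
    apply: eq_integral_oy => y y0.
    have H : (\int[mu]_(t in Ioy) ((1 - cos (y * t)) * expR (- t ^+ 2))%:E)%E =
       (Num.sqrt pi / 2 * (1 - expR (- (y ^+ 2 / 4))))%:E.
      have E : (EFin \o (fun t => expR (- t ^+ 2) - cos (y * t) * expR (- t ^+ 2))) =
        (fun t => ((1 - cos (y * t)) * expR (- t ^+ 2))%:E).
        by apply/funext => t /=; congr EFin; ring.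
      have i : mu.-integrable Ioy (fun t => ((1 - cos (y * t)) * expR (- t ^+ 2))%:E).
        rewrite -E; apply: integrable_RB => //; exact: measurable_Ioy.
      rewrite (@integral_EFin _ (fun t => (1 - cos (y * t)) * expR (- t ^+ 2)))//; congr EFin.
      have -> : \int[mu]_(t in Ioy) ((1 - cos (y * t)) * expR (- t ^+ 2)) =
         \int[mu]_(t in Ioy) (expR (- t ^+ 2) - cos (y * t) * expR (- t ^+ 2)).
        by apply: eq_Rintegral => t _; ring.
      rewrite RintegralB//.
      rewrite gauss_cosine.
      have := gauss_cosine (0 : R); rewrite (_ : (0 : R) ^+ 2 / 4 = 0); last ring.
      rewrite oppr0 expR0 mulr1 => g0.
      have -> : \int[mu]_(t in Ioy) expR (- t ^+ 2) = Num.sqrt pi / 2.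
        by rewrite -g0; apply: eq_Rintegral => t _; rewrite mul0r cos0 mul1r.
      by ring.
    transitivity (\int[mu]_(t in Ioy) (y `^ (- al - 1) *
       ((1 - cos (y * t)) * expR (- t ^+ 2)))%:E)%E.
      by apply: eq_integral_oy => t t0; rewrite /F/= (mulrC t y); congr EFin; ring.
    rewrite ge0_integralZl_oy ?powR_ge0//.
    - by rewrite H -EFinM; congr EFin; ring.
    - apply: measurable_continuous_oy => t t0.
      exact: derive_continuous (dM (dB (dC 1 t) (dcos (dZ y (dI t)))) (dgauss t)).
  rewrite ge0_integralZl_oy//.
  - by rewrite integral_one_sub_gauss// -EFinM.
  - apply: measurable_continuous_oy => t t0.
    exact: derive_continuous (dM (dB (dC 1 t) (dexp (dN (dM (dX 2 (dI t)) (dC 4^-1 t)))))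
      (is_derive1_powR _ t0)).
  - move=> t t0; rewrite mulr_ge0 ?powR_ge0// subr_ge0 -[leRHS]expR0 ler_expR oppr_le0.
    by rewrite mulr_ge0 ?sqr_ge0.
move=> /(congr1 (fun z => (2^-1 * Gamma ((1 + al) / 2))^-1%:E * z)%E).
rewrite muleA -!EFinM mulVf ?mul1e; last by rewrite gt_eqF ?mulr_gt0.
move=> ->; congr EFin; rewrite /cos_const.
by field; rewrite !gt_eqF.
Qed.

Lemma integral_one_sub_cos al t : 0 < al -> al < 2 -> 0 < t ->
  (\int[mu]_(y in Ioy) ((1 - cos (t * y)) * y `^ (- al - 1))%:E =
   (t `^ al * cos_const al)%:E)%E.
Proof.
by move=> a0 a2 t0; rewrite integral_one_sub_cos_scale// integral_one_sub_cos1// EFinM.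
Qed.

(** The constant normalises the operator to have symbol [|t|^al]; the factor [2]
    comes from folding the two half-lines onto one. *)
Lemma fraclap_constE al : 0 < al -> al < 2 -> fraclap_const al * (2 * cos_const al) = 1.
Proof.
move=> a0 a2; rewrite /fraclap_const /cos_const.
have -> : 2^-1 + al / 2 = (1 + al) / 2 by field.
have G1 : 0 < Gamma ((1 + al) / 2) by rewrite Gamma_gt0//; lra.
have G2 : 0 < Gamma (1 - al / 2) by rewrite Gamma_gt0//; lra.
have p0 : 0 < Num.sqrt (pi : R) by rewrite sqrtr_gt0 pi_gt0.
have -> : 2 `^ (- al) = (2 `^ al)^-1 by rewrite powRN.
have -> : 2 `^ al = 2 * 2 `^ (al - 1) by rewrite -gt0_powRS.
have t0 : 0 < 2 `^ (al - 1) :> R by rewrite powR_gt0.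
by field; rewrite !gt_eqF.
Qed.

End OneSubCos.

(** * Calculus of complex-valued functions of a real variable *)

Local Notation Re := complex.Re.
Local Notation Im := complex.Im.
Local Notation normc := ComplexField.Normc.normc.

Section ComplexCalculus.
Context {R : realType}.
Implicit Types (f g : R -> R[i]) (z w : R[i]) (x t a b : R).

Lemma ReD z w : Re (z + w) = Re z + Re w. Proof. by case: z; case: w. Qed.
Lemma ImD z w : Im (z + w) = Im z + Im w. Proof. by case: z; case: w. Qed.
Lemma ReN z : Re (- z) = - Re z. Proof. by case: z. Qed.
Lemma ImN z : Im (- z) = - Im z. Proof. by case: z. Qed.
Lemma ReM z w : Re (z * w) = Re z * Re w - Im z * Im w.
Proof. by case: z; case: w. Qed.
Lemma ImM z w : Im (z * w) = Re z * Im w + Im z * Re w.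
Proof. by case: z => a b; case: w => c d. Qed.
Lemma ReV z : Re z^-1 = Re z / (Re z ^+ 2 + Im z ^+ 2).
Proof. by case: z. Qed.
Lemma ImV z : Im z^-1 = - Im z / (Re z ^+ 2 + Im z ^+ 2).
Proof. by case: z => a b /=; rewrite mulNr. Qed.

Lemma complex_eqP z w : Re z = Re w -> Im z = Im w -> z = w.
Proof. by case: z => a b; case: w => c d /= -> ->. Qed.

Lemma ReZ (a : R) z : Re (a%:C * z) = a * Re z.
Proof. by rewrite ReM /= mul0r subr0. Qed.
Lemma ImZ (a : R) z : Im (a%:C * z) = a * Im z.
Proof. by rewrite ImM /= mul0r addr0. Qed.

Lemma normc_sqr z : normc z ^+ 2 = Re z ^+ 2 + Im z ^+ 2.
Proof. by case: z => a b /=; rewrite sqr_sqrtr// addr_ge0 ?sqr_ge0. Qed.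

Lemma normc_ge0 z : 0 <= normc z.
Proof. by case: z => a b; exact: sqrtr_ge0. Qed.

Lemma normc_Re z : `|Re z| <= normc z.
Proof. by case: z => a b /=; rewrite -sqrtr_sqr ler_sqrt ?addr_ge0 ?sqr_ge0// lerDl sqr_ge0. Qed.

Lemma normc_Im z : `|Im z| <= normc z.
Proof. by case: z => a b /=; rewrite -sqrtr_sqr ler_sqrt ?addr_ge0 ?sqr_ge0// lerDr sqr_ge0. Qed.

Lemma normc_real (a : R) : normc a%:C = `|a|.
Proof. by rewrite /= expr0n/= addr0 sqrtr_sqr. Qed.

Lemma normc_leD z w : normc (z + w) <= normc z + normc w.
Proof. exact: (@le_normcD R z w). Qed.

Lemma normc_opp z : normc (- z) = normc z.
Proof. exact: (@normcN R z). Qed.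

Lemma normcX z n : normc (z ^+ n) = normc z ^+ n.
Proof.
elim: n => [|n IH]; first by rewrite !expr0 ComplexField.Normc.normc1.
by rewrite !exprS ComplexField.Normc.normcM IH.
Qed.

Lemma cexpD z w : cexp (z + w) = cexp z * cexp w.
Proof.
rewrite /cexp ReD ImD expRD cosD sinD.
by apply: complex_eqP; rewrite !(ReM, ImM, ReZ, ImZ)/=; ring.
Qed.

Lemma cexp0 : cexp (0 : R[i]) = 1.
Proof. by rewrite /cexp /= expR0 cos0 sin0 mul1r. Qed.

Lemma cexp_neq0 z : cexp z != 0.
Proof.
apply/eqP => E; have : cexp z * cexp (- z) = 1 by rewrite -cexpD subrr cexp0.
by rewrite E mul0r => /esym/eqP; rewrite oner_eq0.
Qed.

Lemma cexpN z : cexp (- z) = (cexp z)^-1.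
Proof.
apply: (mulfI (cexp_neq0 z)); rewrite divff ?cexp_neq0//.
by rewrite -cexpD subrr cexp0.
Qed.

Lemma cexpMn z n : cexp (z *+ n) = cexp z ^+ n.
Proof.
elim: n => [|n IH]; first by rewrite mulr0n expr0 cexp0.
by rewrite mulrS exprS cexpD IH.
Qed.

Lemma normc_cexp z : normc (cexp z) = expR (Re z).
Proof.
rewrite /cexp ComplexField.Normc.normcM normc_real ger0_norm ?expR_ge0//=.
by rewrite cos2Dsin2 sqrtr1 mulr1.
Qed.

Definition cder f x z := is_derive x 1 (fun t => Re (f t)) (Re z) /\
                         is_derive x 1 (fun t => Im (f t)) (Im z).

Lemma cder_eq f x z w : cder f x z -> z = w -> cder f x w.
Proof. by move=> ? <-. Qed.

Lemma cder_ext f g x z : f =1 g -> cder f x z -> cder g x z.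
Proof. by move=> /funext ->. Qed.

Lemma cder_cst z x : cder (fun=> z) x 0.
Proof. by split; exact: dC. Qed.

Lemma cder_real (h : R -> R) x a : is_derive x 1 h a -> cder (fun t => (h t)%:C) x a%:C.
Proof. by move=> H; split => //=; exact: dC. Qed.

Lemma cder_pair (h k : R -> R) x a b : is_derive x 1 h a -> is_derive x 1 k b ->
  cder (fun t => h t +i* k t) x (a +i* b).
Proof. by []. Qed.

Lemma cderD f g x z w : cder f x z -> cder g x w -> cder (fun t => f t + g t) x (z + w).
Proof.
move=> [f1 f2] [g1 g2]; split.
  by under eq_fun do rewrite ReD; rewrite ReD; exact: dD.
by under eq_fun do rewrite ImD; rewrite ImD; exact: dD.
Qed.

Lemma cderM f g x z w : cder f x z -> cder g x w ->
  cder (fun t => f t * g t) x (z * g x + f x * w).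
Proof.
move=> [f1 f2] [g1 g2]; split.
  under eq_fun do rewrite ReM.
  apply: (is_derive_eq (dB (dM f1 g1) (dM f2 g2))).
  by rewrite ReD !ReM; ring.
under eq_fun do rewrite ImM.
apply: (is_derive_eq (dD (dM f1 g2) (dM f2 g1))).
by rewrite ImD !ImM; ring.
Qed.

Lemma cderZ w f x z : cder f x z -> cder (fun t => w * f t) x (w * z).
Proof. by move=> H; apply: (cder_eq (cderM (cder_cst w x) H)); rewrite mul0r add0r. Qed.

Lemma normc2_neq0 z : z != 0 -> Re z ^+ 2 + Im z ^+ 2 != 0.
Proof.
by case: z => a b; rewrite eq_complex/= => H; rewrite paddr_eq0 ?sqr_ge0// !sqrf_eq0.
Qed.

Lemma cderV f x z : f x != 0 -> cder f x z -> cder (fun t => (f t)^-1) x (- z / f x ^+ 2).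
Proof.
move=> fx [f1 f2]; have n0 := normc2_neq0 fx.
have N := dD (dX 2 f1) (dX 2 f2).
rewrite (_ : - z / f x ^+ 2 = - z * ((f x)^-1 * (f x)^-1)); last by rewrite expr2 invfM.
split.
  under eq_fun do rewrite ReV.
  apply: (is_derive_eq (dM f1 (@dV _ (fun t => Re (f t) ^+ 2 + Im (f t) ^+ 2) _ _ n0 N))).
  by rewrite /= !(ReM, ImM, ReN, ImN, ReV, ImV); field.
under eq_fun do rewrite ImV.
apply: (is_derive_eq (dM (dN f2) (@dV _ (fun t => Re (f t) ^+ 2 + Im (f t) ^+ 2) _ _ n0 N))).
by rewrite /= !(ReM, ImM, ReN, ImN, ReV, ImV); field.
Qed.

Lemma cderX n f x z : cder f x z ->
  cder (fun t => f t ^+ n) x (n%:R * f x ^+ n.-1 * z).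
Proof.
move=> H; elim: n => [|n IH]; first by rewrite mul0r mul0r; exact: cder_cst.
apply: (@cder_ext (fun t => f t * f t ^+ n)); first by move=> t; rewrite exprS.
apply: (cder_eq (cderM H IH)).
case: n {IH} => [|n]; first by rewrite !mul0r mulr0 addr0 mul1r mulrC.
by rewrite -[n.+2%:R]natr1 /= !exprS; ring.
Qed.

Lemma cder_exp f x z : cder f x z -> cder (fun t => cexp (f t)) x (cexp (f x) * z).
Proof.
move=> [f1 f2]; split.
  under eq_fun do rewrite /cexp ReZ /=.
  apply: (is_derive_eq (dM (dexp f1) (dcos f2))).
  by rewrite /cexp ReM ReZ ImZ/=; ring.
under eq_fun do rewrite /cexp ImZ /=.
apply: (is_derive_eq (dM (dexp f1) (dsin f2))).
by rewrite /cexp ImM ReZ ImZ/=; ring.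
Qed.

Lemma cder_cderive f x z : cder f x z -> cderivable f x /\ cderive f x = z.
Proof.
move=> [[f1 e1] [f2 e2]]; split=> //.
by rewrite /cderive !derive1E e1 e2; case: (z).
Qed.

Lemma cder_sum n (F : 'I_n -> R -> R[i]) (z : 'I_n -> R[i]) x :
  (forall i, cder (F i) x (z i)) ->
  cder (fun t => \sum_(i < n) F i t) x (\sum_(i < n) z i).
Proof.
elim: n F z => [|n IH] F z H.
  rewrite big_ord0; apply: cder_ext (cder_cst 0 x) => t.
  by rewrite big_ord0.
rewrite big_ord_recl; apply: (@cder_ext (fun t => F ord0 t + \sum_(i < n) F (lift ord0 i) t)).
  by move=> t; rewrite big_ord_recl.
by apply: cderD => //; apply: IH => i; exact: H.
Qed.

End ComplexCalculus.

Section ComplexIntegral.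
Context {R : realType}.
Implicit Types (f g : R -> R[i]) (z w : R[i]) (x t a b : R) (D : set R).
Local Notation mu := (@lebesgue_measure R).
Local Notation Ioy := (`]0%R, +oo[%classic : set R).

Definition has_cint D f z := cintegrable D f /\ cintegral D f = z.

Lemma has_cint_ext D f g z : measurable D -> (forall t, D t -> f t = g t) ->
  has_cint D f z -> has_cint D g z.
Proof.
move=> mD fg [[i1 i2] <-]; split.
  by split; [apply: eq_integrable i1|apply: eq_integrable i2] => //;
    move=> t; rewrite inE => /fg ->.
by apply: complex_eqP; apply: eq_Rintegral => t; rewrite inE => /fg ->.
Qed.

Lemma has_cintD D f g z w : measurable D -> has_cint D f z -> has_cint D g w ->
  has_cint D (fun t => f t + g t) (z + w).
Proof.
move=> mD [[f1 f2] <-] [[g1 g2] <-]; split.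
  split.
    under eq_fun do rewrite ReD; exact: (integrable_RD mD f1 g1).
  under eq_fun do rewrite ImD; exact: (integrable_RD mD f2 g2).
apply: complex_eqP; rewrite ?ReD ?ImD/= -RintegralD//; apply: eq_Rintegral => t _.
  by rewrite ReD.
by rewrite ImD.
Qed.

Lemma has_cintZ D w f z : measurable D -> has_cint D f z ->
  has_cint D (fun t => w * f t) (w * z).
Proof.
move=> mD [[f1 f2] <-].
have r1 := integrable_RZ (Re w) mD f1; have r2 := integrable_RZ (Im w) mD f2.
have r3 := integrable_RZ (Re w) mD f2; have r4 := integrable_RZ (Im w) mD f1.
split.
  split.
    under eq_fun do rewrite ReM; exact: (integrable_RB mD r1 r2).
  under eq_fun do rewrite ImM; exact: (integrable_RD mD r3 r4).
apply: complex_eqP; rewrite ?ReM ?ImM/= -!RintegralZl//.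
  by rewrite -RintegralB//; apply: eq_Rintegral => t _; rewrite ReM.
by rewrite -RintegralD//; apply: eq_Rintegral => t _; rewrite ImM.
Qed.

Lemma has_cint0 D : measurable D -> has_cint D (fun=> 0) 0.
Proof.
move=> mD; split; first by split; exact: integrable0.
apply: complex_eqP; rewrite /= /Rintegral integral0_eq//.
Qed.

Lemma has_cint_sum D n (F : 'I_n -> R -> R[i]) (z : 'I_n -> R[i]) : measurable D ->
  (forall i, has_cint D (F i) (z i)) ->
  has_cint D (fun t => \sum_(i < n) F i t) (\sum_(i < n) z i).
Proof.
move=> mD; elim: n F z => [|n IH] F z H.
  rewrite big_ord0; apply: has_cint_ext (has_cint0 mD) => // t _.
  by rewrite big_ord0.
rewrite big_ord_recl.
apply: (@has_cint_ext _ (fun t => F ord0 t + \sum_(i < n) F (lift ord0 i) t)) => //.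
  by move=> t _; rewrite big_ord_recl.
by apply: has_cintD => //; apply: IH => i; exact: H.
Qed.

Lemma cintegrable_dominated f (df : R -> R[i]) (g : R -> R) :
  (forall t, 0 < t -> cder f t (df t)) ->
  mu.-integrable Ioy (EFin \o g) ->
  (forall t, 0 < t -> normc (f t) <= g t) -> cintegrable Ioy f.
Proof.
move=> fd ig fg; split.
  apply: le_integrable_pos ig.
    by apply: measurable_continuous_oy => t /fd [/derive_continuous].
  by move=> t /fg; apply: le_trans; exact: normc_Re.
apply: le_integrable_pos ig.
  by apply: measurable_continuous_oy => t /fd [_ /derive_continuous].
by move=> t /fg; apply: le_trans; exact: normc_Im.
Qed.

(** The existence of the second derivative [Q] serves only to make [P' b]
    continuous in [t]; the bound [q] controls the boundary term at both ends. *)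
Lemma cintegral_const_param (u v : R) (P P' X Q : R -> R -> R[i]) (g : R -> R)
    (q : R -> R -> R) :
  (forall b, b \in `]u, v[ -> cintegrable Ioy (P b)) ->
  (forall b t : R, b \in `]u, v[ -> 0 < t -> cder (P^~ t) b (P' b t)) ->
  (forall b t : R, b \in `]u, v[ -> 0 < t -> cder (X b) t (P' b t)) ->
  (forall b t : R, b \in `]u, v[ -> 0 < t -> cder (P' b) t (Q b t)) ->
  mu.-integrable Ioy (EFin \o g) ->
  (forall b t : R, b \in `]u, v[ -> 0 < t -> normc (P' b t) <= g t) ->
  (forall b t : R, b \in `]u, v[ -> 0 < t -> normc (X b t) <= q b t) ->
  (forall b, b \in `]u, v[ -> q b t @[t --> 0^'+] --> (0 : R)) ->
  (forall b, b \in `]u, v[ -> q b t @[t --> +oo] --> (0 : R)) ->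
  {in `]u, v[ &, forall a b, cintegral Ioy (P a) = cintegral Ioy (P b)}.
Proof.
move=> iP dP dX dP' ig Pg Xq q0 qoo a b au bu.
apply: complex_eqP => /=.
  apply: (@integral_const_param R u v (fun b t => Re (P b t)) (fun b t => Re (P' b t))
     (fun b t => Re (X b t)) g _ _ _ _ ig) => //.
  - by move=> c /iP [].
  - by move=> c t cu t0; case: (dP c t cu t0).
  - by move=> c t cu t0; case: (dX c t cu t0).
  - by move=> c t cu t0; case: (dP' c t cu t0) => /derive_continuous.
  - by move=> c t cu t0; apply: le_trans (Pg c t cu t0); exact: normc_Re.
  - move=> c cu; apply: squeeze_cvg0 (q0 c cu); apply: near_at0 => t t0.
    by apply: le_trans (Xq c t cu t0); exact: normc_Re.
  - move=> c cu; apply: squeeze_cvg0 (qoo c cu); apply: near_oy => t t0.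
    by apply: le_trans (Xq c t cu t0); exact: normc_Re.
apply: (@integral_const_param R u v (fun b t => Im (P b t)) (fun b t => Im (P' b t))
     (fun b t => Im (X b t)) g _ _ _ _ ig) => //.
- by move=> c /iP [].
- by move=> c t cu t0; case: (dP c t cu t0).
- by move=> c t cu t0; case: (dX c t cu t0).
- by move=> c t cu t0; case: (dP' c t cu t0) => _ /derive_continuous.
- by move=> c t cu t0; apply: le_trans (Pg c t cu t0); exact: normc_Im.
- move=> c cu; apply: squeeze_cvg0 (q0 c cu); apply: near_at0 => t t0.
  by apply: le_trans (Xq c t cu t0); exact: normc_Im.
- move=> c cu; apply: squeeze_cvg0 (qoo c cu); apply: near_oy => t t0.
  by apply: le_trans (Xq c t cu t0); exact: normc_Im.
Qed.

End ComplexIntegral.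

(** * Powers of [1 + i x] as Laplace transforms *)

Section ComplexPower.
Context {R : realType}.
Implicit Types (z w : R[i]) (x t a b s : R).
Local Notation mu := (@lebesgue_measure R).
Local Notation Ioy := (`]0%R, +oo[%classic : set R).

(** On the line [Re w = 1] the principal argument is an arctangent. In this form
    the principal logarithm of [1 + i x] is visibly a smooth function of [x]. *)
Definition log1 (x : R) : R[i] := (ln (1 + x ^+ 2) / 2) +i* atan x.
Definition pow1 (s x : R) : R[i] := cexp (s%:C * log1 x).

Lemma oneDsqr_gt0 x : 0 < 1 + x ^+ 2.
Proof. by rewrite ltr_wpDr ?sqr_ge0. Qed.

Lemma expR_half_ln x : 0 < x -> expR (ln x / 2) = Num.sqrt x.
Proof.
by move=> x0; rewrite -powR12_sqrt ?ltW// /powR gt_eqF// mulrC.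
Qed.

Lemma cexp_log1 x : cexp (log1 x) = 1 +i* x.
Proof.
rewrite /cexp /log1 /= expR_half_ln ?oneDsqr_gt0//.
have s0 : Num.sqrt (1 + x ^+ 2) != 0 by rewrite gt_eqF// sqrtr_gt0 oneDsqr_gt0.
have c0 : cos (atan x) != 0 by rewrite cos_atan invr_eq0.
have -> : sin (atan x) = x * cos (atan x).
  by rewrite -[X in X * _](atanK x) /tan divfK.
rewrite cos_atan; apply: complex_eqP; rewrite ?ReZ ?ImZ/=.
  by rewrite divff.
by rewrite mulrCA divff// mulr1.
Qed.

Lemma oneDi_neq0 x : 1 +i* x != 0.
Proof. by rewrite -cexp_log1 cexp_neq0. Qed.

Lemma dlog1 x : cder log1 x (Ci / (1 +i* x)).
Proof.
have n0 := oneDsqr_gt0 x.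
have H : is_derive x 1 (fun x => ln (1 + x ^+ 2)) ((1 + x ^+ 2)^-1 * (0 + 2 * x ^+ 1 * 1)).
  have L := is_derive1_ln n0. have D := dD (dC 1 x) (dX 2 (dI x)).
  have Z := @dchain R (@ln R) (fun x => 1 + x ^+ 2) x _ _ L D. exact: Z.
apply: (cder_eq (cder_pair (dM H (dC 2^-1 x)) (is_derive1_atan x))).
have n1 : 1 ^+ 2 + x ^+ 2 != 0 by rewrite expr1n gt_eqF.
have n2 : 1 + x ^+ 2 != 0 by rewrite gt_eqF.
by apply: complex_eqP; rewrite /= ?expr1n; field.
Qed.

Lemma pow1_D s t x : pow1 (s + t) x = pow1 s x * pow1 t x.
Proof. by rewrite /pow1 rmorphD mulrDl cexpD. Qed.

Lemma pow1_nat n x : pow1 n%:R x = (1 +i* x) ^+ n.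
Proof. by rewrite /pow1 rmorph_nat mulr_natl cexpMn cexp_log1. Qed.

Lemma pow1_N s x : pow1 (- s) x = (pow1 s x)^-1.
Proof. by rewrite /pow1 rmorphN mulNr cexpN. Qed.

Lemma pow1_neq0 s x : pow1 s x != 0. Proof. exact: cexp_neq0. Qed.

Lemma pow1_at0 s : pow1 s 0 = 1.
Proof.
rewrite /pow1 /log1 expr0n/= addr0 ln1 mul0r atan0.
by rewrite (_ : 0 +i* 0 = 0)// mulr0 cexp0.
Qed.

Lemma dpow1 s x : cder (pow1 s) x (pow1 s x * (s%:C * (Ci / (1 +i* x)))).
Proof. exact: cder_exp (cderZ _ (dlog1 x)). Qed.

Lemma normc_pow1 s x : normc (pow1 s x) = expR (s * (ln (1 + x ^+ 2) / 2)).
Proof. by rewrite normc_cexp ReZ. Qed.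

Lemma normc_pow1_le s x M : `|x| <= M ->
  normc (pow1 s x) <= expR (`|s| * (ln (1 + M ^+ 2) / 2)).
Proof.
move=> xM; rewrite normc_pow1 ler_expR.
have x1 : 0 <= ln (1 + x ^+ 2) by rewrite ln_ge0// lerDl sqr_ge0.
apply: (@le_trans _ _ (`|s| * (ln (1 + x ^+ 2) / 2))).
  by rewrite ler_wpM2r ?ler_norm ?divr_ge0.
rewrite ler_wpM2l// ler_wpM2r ?invr_ge0// ler_ln ?posrE ?oneDsqr_gt0// lerD2l.
by rewrite -(real_normK (num_real x)) ler_sqr ?nnegrE// (le_trans _ xM).
Qed.

Lemma normc_oneDi_ge1 x : 1 <= normc (1 +i* x).
Proof. by apply: le_trans (normc_Re _); rewrite /= normr1. Qed.

Lemma normc_oneDi_le x : normc (1 +i* x) <= 1 + `|x|.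
Proof.
have -> : 1 +i* x = 1%:C + Ci * x%:C by apply: complex_eqP => /=; ring.
rewrite (le_trans (normc_leD _ _))// normc_real normr1.
rewrite ComplexField.Normc.normcM normc_real /Ci /= expr0n/= expr1n add0r sqrtr1.
by rewrite mul1r.
Qed.

Lemma normc_Ci : normc (Ci : R[i]) = 1.
Proof. by rewrite /Ci /= expr0n/= expr1n add0r sqrtr1. Qed.

(** The integrand whose integral in [t] is [Gamma s * (1 + i x)^(-s)]. As a
    function of [x] it oscillates at the single frequency [t], which is what makes
    the fractional Laplacian of a power computable. *)
Definition laplace (s x t : R) : R[i] := (t `^ (s - 1))%:C * cexp (- (t%:C * (1 +i* x))).

Lemma normc_laplace s x t : normc (laplace s x t) = t `^ (s - 1) * expR (- t).
Proof.
rewrite /laplace ComplexField.Normc.normcM normc_real ger0_norm ?powR_ge0//.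
by rewrite normc_cexp ReN ReZ mulr1.
Qed.

Lemma dexp_mul_t x t :
  cder (fun t => cexp (- (t%:C * (1 +i* x)))) t (- (1 +i* x) * cexp (- (t%:C * (1 +i* x)))).
Proof.
have H := cderZ (- 1) (cderM (cder_real (dI t)) (cder_cst (1 +i* x) t)).
have H2 : cder (fun t => - (t%:C * (1 +i* x))) t (-1 * (1%:C * (1 +i* x) + t%:C * 0)).
  by apply: cder_ext H => u; rewrite mulN1r.
apply: (cder_eq (cder_exp H2)).
by rewrite mulr0 addr0 rmorph1 mul1r mulN1r mulrC.
Qed.

Lemma dexp_mul_x x t :
  cder (fun x => cexp (- (t%:C * (1 +i* x)))) x (- (t%:C * Ci) * cexp (- (t%:C * (1 +i* x)))).
Proof.
have H := cderZ (- t%:C) (cder_pair (dC 1 x) (dI x)).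
have H2 : cder (fun x => - (t%:C * (1 +i* x))) x (- t%:C * (0 +i* 1)).
  by apply: cder_ext H => u; rewrite mulNr.
by apply: (cder_eq (cder_exp H2)); rewrite mulrC mulNr.
Qed.

Lemma dlaplace_t s x t : 0 < t ->
  cder (laplace s x) t ((s - 1)%:C * laplace (s - 1) x t - (1 +i* x) * laplace s x t).
Proof.
move=> t0.
apply: (cder_eq (cderM (cder_real (is_derive1_powR (s - 1) t0)) (dexp_mul_t x t))).
by rewrite /laplace rmorphM/=; ring.
Qed.

Lemma cintegrable_laplace s x : 0 < s -> cintegrable Ioy (laplace s x).
Proof.
move=> s0; apply: (cintegrable_dominated (fun t => @dlaplace_t s x t) (integrable_gamma s0)).
by move=> t t0; rewrite normc_laplace.
Qed.

Lemma laplaceS s x t : 0 < t -> t%:C * laplace s x t = laplace (s + 1) x t.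
Proof.
move=> t0; rewrite /laplace addrK (gt0_powRS s t0) rmorphM/=; ring.
Qed.

(** The value at [x = 0] is the Gamma integral. Multiplied by [(1 + i x)^s], the
    integral does not depend on [x]: the derivative in [x] of the integrand is
    the derivative in [t] of [i (1 + i x)^(s-1) t^s e^(-t(1+ix))]. *)
Lemma cintegral_laplace s x : 0 < s ->
  cintegral Ioy (laplace s x) = (Gamma s)%:C * pow1 (- s) x.
Proof.
move=> s0; pose B := `|x| + 1.
have B0 : 0 <= B by rewrite addr_ge0.
have xB : x \in `]- B, B[.
  by rewrite in_itv/= -ltr_norml /B ltrDl.
have zB : 0 \in `]- B, B[.
  by rewrite in_itv/= oppr_lt0 ltr_wpDl.
have BB b : b \in `]- B, B[ -> `|b| <= B by rewrite in_itv/= -ltr_norml => /ltW.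
have n1 := @oneDi_neq0.
pose P b t := pow1 s b * laplace s b t.
pose P' b t := pow1 s b * (Ci / (1 +i* b)) * (s%:C * laplace s b t - (1 +i* b) * laplace (s + 1) b t).
pose X b t := pow1 s b * (Ci / (1 +i* b)) * laplace (s + 1) b t.
pose Q b t := pow1 s b * (Ci / (1 +i* b)) *
   (s%:C * ((s - 1)%:C * laplace (s - 1) b t - (1 +i* b) * laplace s b t) -
    (1 +i* b) * ((s + 1 - 1)%:C * laplace (s + 1 - 1) b t - (1 +i* b) * laplace (s + 1) b t)).
pose M := expR (`|s| * (ln (1 + B ^+ 2) / 2)).
pose g t := M * (s * (t `^ (s - 1) * expR (- t)) + (1 + B) * (t `^ (s + 1 - 1) * expR (- t))).
pose q (b t : R) := M * (t `^ s * expR (- t)).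
have coef b : b \in `]- B, B[ -> normc (pow1 s b * (Ci / (1 +i* b))) <= M.
  move=> bB; rewrite ComplexField.Normc.normcM (ComplexField.Normc.normcM Ci) ComplexField.Normc.normcV normc_Ci mul1r.
  apply: le_trans (normc_pow1_le s (BB b bB)).
  rewrite ler_piMr ?normc_ge0// invf_le1 ?normc_oneDi_ge1//.
  exact: lt_le_trans (normc_oneDi_ge1 b).
have H : cintegral Ioy (P x) = cintegral Ioy (P 0).
  apply: (@cintegral_const_param R (- B) B P P' X Q g q _ _ _ _ _ _ _ _ _ x 0 xB zB).
  - move=> b bB.
    by have [] := has_cintZ (pow1 s b) measurable_Ioy (conj (cintegrable_laplace b s0) erefl).
  - move=> b t bB t0.
    have D := cderM (dpow1 s b) (cderZ (t `^ (s - 1))%:C (dexp_mul_x b t)).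
    apply: (cder_eq D); rewrite /P' -laplaceS// /laplace.
    by field.
  - move=> b t bB t0.
    apply: (cder_eq (cderZ _ (dlaplace_t (s + 1) b t0))).
    by rewrite /P' addrK.
  - move=> b t bB t0.
    have D := cderZ (pow1 s b * (Ci / (1 +i* b))) (cderD (cderZ s%:C (dlaplace_t s b t0))
       (cderZ (- (1 +i* b)) (dlaplace_t (s + 1) b t0))).
    apply: (cder_eq (cder_ext _ D)); first by move=> u; rewrite /P' mulNr.
    by rewrite /Q mulNr.
  - have mI := @measurable_Ioy R.
    apply: (integrable_RZ M mI); apply: (integrable_RD mI); apply: (integrable_RZ _ mI).
      exact: integrable_gamma.
    by apply: integrable_gamma; rewrite addr_gt0.
  - move=> b t bB t0; rewrite /P' /g ComplexField.Normc.normcM.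
    rewrite ler_pM ?normc_ge0 ?coef//.
    apply: (le_trans (normc_leD _ _)).
    rewrite normc_opp (ComplexField.Normc.normcM s%:C) (ComplexField.Normc.normcM (1 +i* b)).
    rewrite !normc_laplace normc_real.
    rewrite (gtr0_norm s0) lerD2l ler_wpM2r ?mulr_ge0 ?powR_ge0 ?expR_ge0//.
    by apply: (le_trans (normc_oneDi_le b)); rewrite lerD2l BB.
  - move=> b t bB t0; rewrite /X /q ComplexField.Normc.normcM normc_laplace addrK.
    by rewrite ler_wpM2r ?mulr_ge0 ?powR_ge0 ?expR_ge0 ?coef.
  - move=> b bB; rewrite /q [Z in _ --> Z](_ : _ = M * (0 * expR (- 0))); last by rewrite mul0r mulr0.
    apply: cvgM; first exact: cvg_cst.
    apply: cvgM; first exact: powR_cvg0.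
    apply: cvg_at_right_filter; exact: derive_continuous (dexp (dN (dI 0))).
  - move=> b bB; rewrite /q [Z in _ --> Z](_ : _ = M * 0); last by rewrite mulr0.
    by apply: cvgM; [exact: cvg_cst|exact: powR_expRN_cvgy0].
have PE t : P 0 t = (t `^ (s - 1) * expR (- t))%:C.
  rewrite /P pow1_at0 mul1r /laplace rmorphM/= /cexp ReN ImN ReZ ImZ.
  by rewrite mulr1 mulr0 oppr0 cos0 sin0 mulr1.
have E0 : cintegral Ioy (P 0) = (Gamma s)%:C.
  apply: complex_eqP; first by apply: eq_Rintegral => t _; rewrite PE.
  rewrite [LHS](_ : _ = 0)// /cintegral; cbn [Im].
  by rewrite /Rintegral integral0_eq// => t _; rewrite PE.
have [_] := has_cintZ (pow1 s x) measurable_Ioy (conj (cintegrable_laplace x s0) erefl).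
rewrite -/(P x) H E0 => ->.
by rewrite pow1_N mulrC mulKf ?pow1_neq0.
Qed.

End ComplexPower.

(** * The beta integral along a rotated ray *)

Section RotatedBeta.
Context {R : realType}.
Implicit Types (x t a b s z : R).
Local Notation mu := (@lebesgue_measure R).
Local Notation Ioy := (`]0%R, +oo[%classic : set R).

Definition cis (b : R) : R[i] := cexp (0 +i* b).

Lemma cisD a b : cis (a + b) = cis a * cis b.
Proof. by rewrite /cis -cexpD; congr cexp; apply: complex_eqP => /=; rewrite ?addr0. Qed.

Lemma cis0 : cis 0 = 1. Proof. exact: cexp0. Qed.

Lemma cisE b : cis b = cos b +i* sin b.
Proof. by rewrite /cis /cexp /= expR0 mul1r. Qed.

Lemma cisN b : cis (- b) = (cis b)^-1.
Proof. by rewrite /cis -cexpN; congr cexp; apply: complex_eqP => /=; rewrite ?oppr0. Qed.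

Lemma cisMn n b : cis (n%:R * b) = cis b ^+ n.
Proof.
rewrite /cis -cexpMn; congr cexp; rewrite -[RHS]mulr_natl.
have -> : (n%:R : R[i]) = (n%:R : R)%:C by rewrite rmorph_nat.
by apply: complex_eqP; rewrite ?ReZ ?ImZ /= ?mulr0.
Qed.

Lemma cis_neq0 b : cis b != 0. Proof. exact: cexp_neq0. Qed.

Lemma normc_cis b : normc (cis b) = 1.
Proof. by rewrite /cis normc_cexp /= expR0. Qed.

Lemma dcis q b : cder (fun b => cis (q * b)) b ((0 +i* q) * cis (q * b)).
Proof.
have H : cder (fun b => 0 +i* (q * b)) b (0 +i* (q * 1)).
  exact: cder_pair (dC 0 b) (dZ q (dI b)).
by apply: (cder_eq (cder_exp H)); rewrite mulr1 mulrC.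
Qed.

Lemma cos_ge_cos (b B : R) : `|b| <= B -> B <= pi -> cos B <= cos b.
Proof.
move=> bB Bpi; rewrite -(cos_norm b).
have B0 : 0 <= B by exact: le_trans bB.
have : `|b| \in `[0, pi] by rewrite in_itv/= normr_ge0 (le_trans bB).
have : B \in `[0, pi] by rewrite in_itv/= B0.
move=> BI bI; rewrite leNgt; apply/negP; rewrite ltr_cos// => Bb.
by move: (le_lt_trans bB Bb); rewrite ltxx.
Qed.

Variables (al rho : R) (j : nat).
Hypotheses (al0 : 0 < al) (al1 : al < 1) (rho0 : 0 < rho).

Let q : R := j%:R + al.
Let zeta (b : R) : R[i] := rho%:C * cis b.
Let V (b z : R) : R[i] := (zeta b + z%:C)^-1.

Let p0 : 0 < 1 - al. Proof. by rewrite subr_gt0. Qed.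
Let q0 : 0 < q. Proof. by rewrite ltr_wpDl. Qed.

(** Euler's beta function at [(1 - al, j + al)]. *)
Definition beta_const : R := Gamma (1 - al) * Gamma (j%:R + al) / Gamma j.+1%:R.

Definition beta_kernel (z : R) : R := z `^ (- al) * (rho + z) ^- j.+1.

Lemma beta_kernelE z : 0 < z ->
  beta_kernel z = z `^ (1 - al - 1) * (rho + z) `^ (- (1 - al + q)).
Proof.
move=> z0; rewrite /beta_kernel; congr (_ `^ _ * _); first by ring.
rewrite (_ : 1 - al + q = j.+1%:R); last by rewrite /q -natr1; ring.
by rewrite powR_invn// addr_ge0 ?ltW.
Qed.

Lemma beta_kernel_continuous z : 0 < z -> {for z, continuous beta_kernel}.
Proof.
move=> z0; have rz : (rho + z) ^+ j.+1 != 0 by rewrite expf_neq0// gt_eqF// addr_gt0.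
exact: derive_continuous (dM (is_derive1_powR _ z0)
  (@dV R (fun z => (rho + z) ^+ j.+1) _ _ rz (dX j.+1 (dD (dC rho z) (dI z))))).
Qed.

Lemma beta_kernel_ge0 z : 0 < z -> 0 <= beta_kernel z.
Proof. by move=> z0; rewrite mulr_ge0 ?powR_ge0// invr_ge0 exprn_ge0// addr_ge0 ?ltW. Qed.

Lemma integral_beta_kernel :
  (\int[mu]_(z in Ioy) (beta_kernel z)%:E = (beta_const * rho `^ (- q))%:E)%E.
Proof.
rewrite (@eq_integral_oy _ _ _ (fun z (z0 : 0 < z) => congr1 EFin (beta_kernelE z0))).
rewrite (beta_integralE p0 q0 rho0) /beta_const.
by have -> : 1 - al + q = j.+1%:R by rewrite /q -natr1; ring.
Qed.

Lemma integrable_beta_kernel : mu.-integrable Ioy (EFin \o beta_kernel).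
Proof.
apply/integrableP; split.
  by apply/measurable_EFinP; apply: measurable_continuous_oy => z; exact: beta_kernel_continuous.
rewrite (@eq_integral_oy _ _ (EFin \o beta_kernel)) /=.
  by rewrite integral_beta_kernel ltry.
by move=> z z0; rewrite /= ger0_norm// beta_kernel_ge0.
Qed.

Let zetaE b : zeta b = rho * cos b +i* (rho * sin b).
Proof. by rewrite /zeta cisE; apply: complex_eqP; rewrite ?ReZ ?ImZ. Qed.

(** The difference [|zeta + z|^2 - (1 + cos b) / 2 * (rho + z)^2] equals
    [(1 - cos b) / 2 * (rho - z)^2]. Hence, as long as [b] stays away from [pi] and
    [- pi], the complex kernel is bounded by the real one. *)
Lemma normc_zetaD b z c : 0 < z -> 0 < c -> c ^+ 2 <= (1 + cos b) / 2 ->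
  c * (rho + z) <= normc (zeta b + z%:C).
Proof.
move=> z0 c0 cb; have rz : 0 < rho + z by rewrite addr_gt0.
rewrite -ler_sqr ?nnegrE ?normc_ge0 ?mulr_ge0 ?(ltW c0) ?(ltW rz)//.
rewrite normc_sqr zetaE /= addr0.
have -> : (rho * cos b + z) ^+ 2 + (rho * sin b) ^+ 2 =
   rho ^+ 2 * (cos b ^+ 2 + sin b ^+ 2) + z ^+ 2 + 2 * rho * z * cos b by ring.
rewrite cos2Dsin2 mulr1 exprMn.
apply: (@le_trans _ _ ((1 + cos b) / 2 * (rho + z) ^+ 2)); first by rewrite ler_wpM2r ?sqr_ge0.
rewrite -subr_ge0.
have -> : rho ^+ 2 + z ^+ 2 + 2 * rho * z * cos b - (1 + cos b) / 2 * (rho + z) ^+ 2 =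
  (1 - cos b) / 2 * (rho - z) ^+ 2 by field.
by rewrite mulr_ge0 ?sqr_ge0 ?divr_ge0 ?subr_ge0 ?cos_le1.
Qed.

Section Sector.
Variable (B : R).
Hypotheses (B0 : 0 < B) (Bpi : B < pi).

Let c : R := Num.sqrt ((1 + cos B) / 2).

Let c0 : 0 < c.
Proof.
rewrite sqrtr_gt0 divr_gt0// -subr_gt0.
have : cos pi < cos B by rewrite ltr_cos ?in_itv/= ?pi_ge0 ?lexx ?(ltW B0) ?(ltW Bpi).
by rewrite cospi => H; lra.
Qed.

Let cb b : b \in `]- B, B[ -> c ^+ 2 <= (1 + cos b) / 2.
Proof.
rewrite in_itv/= -ltr_norml => bB.
have H : cos B <= cos b by apply: cos_ge_cos; exact: ltW.
have HB : 0 <= 1 + cos B by have := cos_geN1 B; lra.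
rewrite /c sqr_sqrtr ?divr_ge0//; lra.
Qed.

Let zV0 b z : b \in `]- B, B[ -> 0 < z -> zeta b + z%:C != 0.
Proof.
move=> bB z0; apply/eqP => E.
have := normc_zetaD z0 c0 (cb bB); rewrite E ComplexField.Normc.normc0 leNgt.
by rewrite mulr_gt0// addr_gt0.
Qed.

Let normV b z : b \in `]- B, B[ -> 0 < z -> normc (V b z) <= c^-1 * (rho + z)^-1.
Proof.
move=> bB z0; rewrite /V ComplexField.Normc.normcV -invfM lef_pV2.
- exact: normc_zetaD (cb bB).
- rewrite posrE; apply: lt_le_trans (normc_zetaD z0 c0 (cb bB)).
  by rewrite mulr_gt0// addr_gt0.
- by rewrite posrE mulr_gt0// addr_gt0.
Qed.

Let normVX b z n : b \in `]- B, B[ -> 0 < z -> normc (V b z ^+ n) <= c^-1 ^+ n * (rho + z) ^- n.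
Proof.
move=> bB z0; rewrite normcX -exprVn -exprMn lerXn2r ?nnegrE ?normc_ge0 ?normV//.
by rewrite mulr_ge0 ?invr_ge0 ?(ltW c0)// ltW// addr_gt0.
Qed.

Let dzeta b : cder zeta b (Ci * zeta b).
Proof.
have H : cder (fun b => rho%:C * cis (1 * b)) b (rho%:C * ((0 +i* 1) * cis (1 * b))).
  exact: cderZ (dcis 1 b).
have H' : cder zeta b (rho%:C * ((0 +i* 1) * cis (1 * b))).
  by apply: cder_ext H => u; rewrite mul1r.
by apply: (cder_eq H'); rewrite /zeta mul1r /Ci; ring.
Qed.

Let dV_b n b z : b \in `]- B, B[ -> 0 < z ->
  cder (fun b => V b z ^+ n) b (- (n%:R * V b z ^+ n.+1 * (Ci * zeta b))).
Proof.
move=> bB z0.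
have H := cderX n (cderV (zV0 bB z0) (cderD (dzeta b) (cder_cst z%:C b))).
apply: (cder_eq H); rewrite addr0 -/(V b z).
case: n {H} => [|n]; first by rewrite !mul0r oppr0.
rewrite (_ : - (Ci * zeta b) / (zeta b + z%:C) ^+ 2 = - (Ci * zeta b) * V b z ^+ 2).
  by rewrite /= !exprS; ring.
by rewrite /V exprVn.
Qed.

Let dV_z n b z : b \in `]- B, B[ -> 0 < z ->
  cder (fun z => V b z ^+ n) z (- (n%:R * V b z ^+ n.+1)).
Proof.
move=> bB z0.
have H := cderX n (cderV (zV0 bB z0) (cderD (cder_cst (zeta b) z) (cder_real (dI z)))).
apply: (cder_eq H); rewrite add0r -/(V b z).
case: n {H} => [|n]; first by rewrite !mul0r oppr0.
rewrite (_ : - 1%:C / (zeta b + z%:C) ^+ 2 = - V b z ^+ 2).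
  by rewrite /= !exprS; ring.
by rewrite /V exprVn mulNr rmorph1 mul1r.
Qed.

Let n := j.+1.
Let P (b z : R) : R[i] := cis (q * b) * ((z `^ (- al))%:C * V b z ^+ n).
Let P' (b z : R) : R[i] := cis (q * b) * Ci *
  ((z `^ (- al))%:C * (q%:C * V b z ^+ n - n%:R * zeta b * V b z ^+ n.+1)).
Let X (b z : R) : R[i] := cis (q * b) * - Ci * ((z `^ (1 - al))%:C * V b z ^+ n).

Let zetaV b z : b \in `]- B, B[ -> 0 < z -> z%:C * V b z = 1 - zeta b * V b z.
Proof.
move=> bB z0; have H := zV0 bB z0.
by rewrite /V; field.
Qed.

Let dPk (k : R) m b z : b \in `]- B, B[ -> 0 < z ->
  cder (fun z => (z `^ k)%:C * V b z ^+ m) z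
   ((k * z `^ (k - 1))%:C * V b z ^+ m - (z `^ k)%:C * (m%:R * V b z ^+ m.+1)).
Proof.
move=> bB z0; apply: (cder_eq (cderM (cder_real (is_derive1_powR k z0)) (dV_z m bB z0))).
by rewrite mulrN.
Qed.

Lemma normc_nat k : normc (k%:R : R[i]) = k%:R.
Proof. by rewrite -(rmorph_nat (real_complex R)) normc_real ger0_norm. Qed.

Let normP b z : b \in `]- B, B[ -> 0 < z -> normc (P b z) <= c^-1 ^+ n * beta_kernel z.
Proof.
move=> bB z0; rewrite /P ComplexField.Normc.normcM normc_cis mul1r.
rewrite (ComplexField.Normc.normcM (z `^ (- al))%:C) normc_real ger0_norm ?powR_ge0//.
by rewrite /beta_kernel [leRHS]mulrCA ler_wpM2l ?powR_ge0// normVX.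
Qed.

Let cintP b : b \in `]- B, B[ -> cintegrable Ioy (P b).
Proof.
move=> bB; apply: (@cintegrable_dominated _ _ _ (fun z => c^-1 ^+ n * beta_kernel z)).
- by move=> z z0; exact: cderZ (dPk (- al) n bB z0).
- by apply: integrable_RZ; [exact: measurable_Ioy|exact: integrable_beta_kernel].
- by move=> z; exact: normP.
Qed.

Let K : R := c^-1 ^+ n * (q + n%:R * c^-1).

Let normP' b z : b \in `]- B, B[ -> 0 < z -> normc (P' b z) <= K * beta_kernel z.
Proof.
move=> bB z0; rewrite /P' ComplexField.Normc.normcM (ComplexField.Normc.normcM (cis _)).
rewrite normc_cis normc_Ci !mul1r.
rewrite (ComplexField.Normc.normcM (z `^ (- al))%:C) normc_real ger0_norm ?powR_ge0//.
rewrite /beta_kernel [leRHS]mulrCA ler_wpM2l ?powR_ge0//.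
have -> : K * (rho + z) ^- n = q * (c^-1 ^+ n * (rho + z) ^- n) +
   n%:R * (c^-1 * (c^-1 ^+ n * (rho + z) ^- n)) by rewrite /K; ring.
apply: (le_trans (normc_leD _ _)); rewrite normc_opp; apply: lerD.
  rewrite (ComplexField.Normc.normcM q%:C) normc_real (gtr0_norm q0).
  by rewrite ler_wpM2l ?(ltW q0) ?normVX.
rewrite -mulrA (ComplexField.Normc.normcM n%:R) normc_nat ler_wpM2l//.
rewrite exprS mulrA (ComplexField.Normc.normcM (zeta b * _)).
rewrite ler_pM ?normc_ge0 ?normVX//.
rewrite (ComplexField.Normc.normcM (zeta b)) /zeta.
rewrite (ComplexField.Normc.normcM rho%:C) normc_cis normc_real (gtr0_norm rho0) mulr1.
apply: (le_trans (ler_wpM2l (ltW rho0) (normV bB z0))).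
rewrite mulrCA ler_piMr ?invr_ge0 ?(ltW c0)// ler_pdivrMr ?addr_gt0// mul1r lerDl.
exact: ltW.
Qed.

Let qb (b z : R) : R := c^-1 ^+ n * rho ^- j * (z `^ (1 - al) * (rho + z)^-1).

Let normX b z : b \in `]- B, B[ -> 0 < z -> normc (X b z) <= qb b z.
Proof.
move=> bB z0; rewrite /X ComplexField.Normc.normcM (ComplexField.Normc.normcM (cis _)).
rewrite normc_cis normc_opp normc_Ci !mul1r.
rewrite (ComplexField.Normc.normcM (z `^ _)%:C) normc_real ger0_norm ?powR_ge0//.
have -> : qb b z = z `^ (1 - al) * (c^-1 ^+ n * (rho ^- j * (rho + z)^-1)).
  by rewrite /qb; ring.
rewrite ler_wpM2l ?powR_ge0//; apply: (le_trans (normVX n bB z0)).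
rewrite ler_wpM2l ?exprn_ge0 ?invr_ge0 ?(ltW c0)//.
rewrite /n exprS invfM mulrC ler_wpM2r ?invr_ge0 ?(ltW (addr_gt0 rho0 z0))//.
rewrite lef_pV2 ?posrE ?exprn_gt0 ?addr_gt0// lerXn2r ?nnegrE ?(ltW rho0)//.
  by rewrite ltW// addr_gt0.
by rewrite lerDl ltW.
Qed.

Let K0 : 0 <= c^-1 ^+ n * rho ^- j.
Proof. by rewrite mulr_ge0 ?exprn_ge0 ?invr_ge0 ?exprn_ge0 ?(ltW c0) ?(ltW rho0). Qed.

Let qb0 b : qb b z @[z --> 0^'+] --> (0 : R).
Proof.
apply: (@squeeze_cvg0 _ _ _ (fun z => c^-1 ^+ n * rho ^- j * (rho^-1 * z `^ (1 - al)))).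
  apply: near_at0 => z z0.
  have rz : 0 < rho + z by rewrite addr_gt0.
  rewrite ger0_norm /qb; last by rewrite (mulr_ge0 K0)// mulr_ge0 ?powR_ge0// invr_ge0 ltW.
  rewrite ler_wpM2l// mulrC ler_wpM2r ?powR_ge0// lef_pV2 ?posrE//.
  by rewrite lerDl ltW.
rewrite [Z in _ --> Z](_ : _ = c^-1 ^+ n * rho ^- j * (rho^-1 * 0)); last by rewrite !mulr0.
apply: cvgM; first exact: cvg_cst.
by apply: cvgM; [exact: cvg_cst|exact: powR_cvg0].
Qed.

Let qboo b : qb b z @[z --> +oo] --> (0 : R).
Proof.
apply: (@squeeze_cvg0 _ _ _ (fun z => c^-1 ^+ n * rho ^- j * z `^ (- al))).
  apply: near_oy => z z0.
  have rz : 0 < rho + z by rewrite addr_gt0.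
  rewrite ger0_norm /qb; last by rewrite (mulr_ge0 K0)// mulr_ge0 ?powR_ge0// invr_ge0 ltW.
  rewrite ler_wpM2l// (gt0_powRS _ z0) (_ : 1 - al - 1 = - al); last ring.
  rewrite mulrAC ler_piMl ?powR_ge0// ler_pdivrMr// mul1r lerDr.
  exact: ltW.
rewrite [Z in _ --> Z](_ : _ = c^-1 ^+ n * rho ^- j * 0); last by rewrite mulr0.
by apply: cvgM; [exact: cvg_cst|exact: powRN_cvgy0].
Qed.

(** Rotating [zeta] is the same as rotating the ray of integration, because the
    integrand is homogeneous of degree [- al - n] in [(zeta, z)]. The boundary
    term [X] is [- i z] times the integrand: Euler's identity turns the angular
    derivative of the integral into an integral of a [z]-derivative. The estimates
    are uniform only in a sector [|b| < B < pi], away from the pole at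
    [zeta = - z]. *)
Lemma cintegral_rotate : {in `]- B, B[ &, forall a b, cintegral Ioy (P a) = cintegral Ioy (P b)}.
Proof.
pose Q b z := cis (q * b) * Ci *
  (q%:C * ((- al * z `^ (- al - 1))%:C * V b z ^+ n - (z `^ (- al))%:C * (n%:R * V b z ^+ n.+1))
   + - (n%:R * zeta b) * ((- al * z `^ (- al - 1))%:C * V b z ^+ n.+1 -
        (z `^ (- al))%:C * (n.+1%:R * V b z ^+ n.+2))).
apply: (@cintegral_const_param R (- B) B P P' X Q (fun z => K * beta_kernel z) qb).
- exact: cintP.
- move=> b z bB z0.
  apply: (cder_eq (cderM (dcis q b) (cderZ (z `^ (- al))%:C (dV_b n bB z0)))).
  rewrite (_ : 0 +i* q = q%:C * Ci); last by apply: complex_eqP => /=; ring.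
  by rewrite /P'; ring.
- move=> b z bB z0; apply: (cder_eq (cderZ _ (dPk (1 - al) n bB z0))).
  rewrite (_ : 1 - al - 1 = - al); last by ring.
  have E : (z `^ (1 - al))%:C = (z `^ (- al))%:C * z%:C.
    by rewrite (gt0_powRS _ z0) (_ : 1 - al - 1 = - al) ?rmorphM/= 1?mulrC//; ring.
  have F : z%:C * V b z ^+ n.+1 = V b z ^+ n - zeta b * V b z ^+ n.+1.
    by rewrite exprS mulrA zetaV//; ring.
  (* the degree of homogeneity: q + (1 - al) = n *)
  have G : q%:C = n%:R - (1 - al)%:C.
    by rewrite /q /n -natr1 rmorphD rmorphB rmorph1 rmorph_nat; ring.
  rewrite E rmorphM/= /P' G.
  transitivity (cis (q * b) * - Ci * ((z `^ (- al))%:C * ((1 - al)%:C * V b z ^+ n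
     - n%:R * (z%:C * V b z ^+ n.+1)))); first by ring.
  by rewrite F; ring.
- move=> b z bB z0.
  have H := cderZ (cis (q * b) * Ci) (cderD (cderZ q%:C (dPk (- al) n bB z0))
     (cderZ (- (n%:R * zeta b)) (dPk (- al) n.+1 bB z0))).
  apply: cder_ext H => u; rewrite /P'; ring.
- by apply: integrable_RZ; [exact: measurable_Ioy|exact: integrable_beta_kernel].
- exact: normP'.
- exact: normX.
- by move=> b bB; exact: qb0.
- by move=> b bB; exact: qboo.
Qed.

Lemma has_cint_rotated_sector b : b \in `]- B, B[ ->
  has_cint Ioy (fun z => (z `^ (- al))%:C * V b z ^+ j.+1)
    (cis (- (q * b)) * (beta_const * rho `^ (- q))%:C).
Proof.
move=> bB; have zB : 0 \in `]- B, B[ by rewrite in_itv/= oppr_lt0 B0.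
have E0 : cintegral Ioy (P 0) = (beta_const * rho `^ (- q))%:C.
  have PE z : 0 < z -> P 0 z = (beta_kernel z)%:C.
    move=> z0; rewrite /P mulr0 cis0 mul1r /V /zeta cis0 mulr1.
    by rewrite -rmorphD /= -fmorphV -rmorphXn -rmorphM /beta_kernel exprVn.
  apply: complex_eqP => /=.
    rewrite -[RHS]/(fine (_%:E)) -integral_beta_kernel /Rintegral; congr fine.
    by apply: eq_integral_oy => z /PE ->.
  rewrite /Rintegral (@eq_integral_oy _ _ (cst 0%E)) ?integral0//.
  by move=> z /PE ->.
have H : has_cint Ioy (P b) (beta_const * rho `^ (- q))%:C.
  by split; [exact: cintP|rewrite -E0; exact: cintegral_rotate].
apply: has_cint_ext (has_cintZ (cis (- (q * b))) measurable_Ioy H); first exact: measurable_Ioy.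
by move=> z _; rewrite /P mulrA -cisD addNr cis0 mul1r.
Qed.

End Sector.

Lemma has_cint_rotated b : `|b| < pi ->
  has_cint Ioy (fun z => (z `^ (- al))%:C * (rho%:C * cis b + z%:C) ^- j.+1)
    (cis (- ((j%:R + al) * b)) * (beta_const * rho `^ (- (j%:R + al)))%:C).
Proof.
move=> bpi; have n0 := normr_ge0 b.
(* a half-angle strictly between |b| and pi *)
have H := @has_cint_rotated_sector ((`|b| + pi) / 2) _ _ b _.
have mI := @measurable_Ioy R.
apply: has_cint_ext mI _ (H _ _ _).
- by move=> z _; rewrite /V exprVn.
- by lra.
- by lra.
- rewrite in_itv/= -ltr_norml; lra.
Qed.

End RotatedBeta.

(** * One-sided fractional integrals of powers *)

Section PowerWeylMarchaud.
Context {R : realType}.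
Implicit Types (x t al : R).
Local Notation Ioy := (`]0%R, +oo[%classic : set R).

(** The hypothesis means that [tau] is [1] or [- 1]. *)
Lemma cis_pihalf (tau : R) : tau ^+ 2 = 1 -> cis (tau * (pi / 2)) = tau%:C * Ci.
Proof.
move=> /eqP; rewrite sqrf_eq1 => /orP[] /eqP ->; rewrite cisE.
  by rewrite mul1r cos_pihalf sin_pihalf rmorph1 mul1r.
by rewrite mulN1r cosN sinN cos_pihalf sin_pihalf; apply: complex_eqP => /=; ring.
Qed.

Lemma pow1E s x : pow1 s x = (Num.sqrt (1 + x ^+ 2) `^ s)%:C * cis (s * atan x).
Proof.
have -> : (Num.sqrt (1 + x ^+ 2) `^ s)%:C = cexp ((s * (ln (1 + x ^+ 2) / 2))%:C).
  rewrite /cexp /= cos0 sin0 /powR gt_eqF ?sqrtr_gt0 ?oneDsqr_gt0//.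
  rewrite -powR12_sqrt ?(ltW (oneDsqr_gt0 x))// ln_powR (mulrC 2^-1).
  by apply: complex_eqP; rewrite ?ReZ ?ImZ/= ?mulr1 ?mulr0.
rewrite /pow1 /cis -cexpD; congr cexp.
by apply: complex_eqP; rewrite ?ReZ ?ImZ/= ?addr0 ?add0r.
Qed.

(** Factoring [i tau] out of [1 + i (x + tau z)] leaves [zeta + z], where
    [zeta = (1 + i x) / (i tau)] has modulus [sqrt (1 + x^2)] and argument
    [atan x - tau pi / 2], strictly between [- pi] and [pi]. The rotated beta integral applies,
    and the powers of [i tau] account for the phase. *)
Lemma has_cint_power al (j : nat) (tau x : R) : 0 < al -> al < 1 -> tau ^+ 2 = 1 ->
  has_cint Ioy (fun z => (1 +i* (x + tau * z)) ^- j.+1 / (z `^ al)%:C)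
    (cis (tau * (pi / 2) * (al - 1)) * (beta_const al j)%:C * pow1 (- (j%:R + al)) x).
Proof.
move=> al0 al1 tau2; set rho := Num.sqrt (1 + x ^+ 2).
have rho0 : 0 < rho by rewrite sqrtr_gt0 oneDsqr_gt0.
(* rho cis psi = (1 + i x) / (i tau) *)
pose psi := atan x - tau * (pi / 2).
have psipi : `|psi| < pi.
  have [h1 h2] : - (pi / 2) < atan x /\ atan x < pi / 2.
    by split; [exact: atan_gtNpi2|exact: atan_ltpi2].
  move: tau2 => /eqP; rewrite sqrf_eq1 /psi ltr_norml => /orP[] /eqP ->; apply/andP; split; lra.
have zE : rho%:C * cis psi = (1 +i* x) * (tau%:C * Ci)^-1.
  rewrite /psi cisD cisN cis_pihalf// mulrA; congr (_ / _).
  have := pow1E 1 x; rewrite powRr1 ?sqrtr_ge0// mul1r => <-.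
  by rewrite (pow1_nat 1).
have ti0 : tau%:C * Ci != 0 by rewrite -cis_pihalf// cis_neq0.
have mI := @measurable_Ioy R.
have := has_cintZ ((tau%:C * Ci) ^- j.+1) mI (has_cint_rotated j al0 al1 rho0 psipi).
have -> : (tau%:C * Ci) ^- j.+1 * (cis (- ((j%:R + al) * psi)) *
     (beta_const al j * rho `^ (- (j%:R + al)))%:C) =
   cis (tau * (pi / 2) * (al - 1)) * (beta_const al j)%:C * pow1 (- (j%:R + al)) x.
  rewrite pow1E -/rho -cis_pihalf// -cisMn -cisN rmorphM/=.
  transitivity (cis (- (j.+1%:R * (tau * (pi / 2)))) * cis (- ((j%:R + al) * psi)) *
    ((beta_const al j)%:C * (rho `^ (- (j%:R + al)))%:C)); first by ring.
  transitivity (cis (tau * (pi / 2) * (al - 1)) * cis (- (j%:R + al) * atan x) *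
    ((beta_const al j)%:C * (rho `^ (- (j%:R + al)))%:C)); last by ring.
  rewrite -!cisD; congr (cis _ * _).
  by rewrite /psi -natr1; ring.
apply: has_cint_ext => // z; rewrite /= in_itv/= andbT => z0.
have -> : 1 +i* (x + tau * z) = tau%:C * Ci * (rho%:C * cis psi + z%:C).
  rewrite mulrDr zE mulrCA divff// mulr1.
  by apply: complex_eqP; rewrite /Ci /=; ring.
have E : (z `^ (- al))%:C = ((z `^ al)%:C)^-1 by rewrite powRN fmorphV.
have C3 (a b c : R[i]) : a * (c * b) = a * b * c by ring.
by rewrite E [in RHS]exprMn [in RHS]invfM; exact: C3.
Qed.

End PowerWeylMarchaud.

(** * The principal value as a second difference *)

Section PrincipalValue.
Context {R : realType}.
Implicit Types (f g : R -> R) (x t a b y al eps : R).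
Local Notation mu := (@lebesgue_measure R).
Local Notation Ioy := (`]0%R, +oo[%classic : set R).

Lemma integrable_setU (A B : set R) f : measurable A -> measurable B ->
  [disjoint A & B] -> mu.-integrable A (EFin \o f) -> mu.-integrable B (EFin \o f) ->
  mu.-integrable (A `|` B) (EFin \o f).
Proof.
move=> mA mB AB /integrableP[mfA fA] /integrableP[mfB fB]; apply/integrableP.
have mf : measurable_fun (A `|` B) (EFin \o f) by apply/measurable_funU.
split => //; rewrite ge0_integral_setU//; first exact: lte_add_pinfty.
exact: measurableT_comp.
Qed.

Lemma punctured_lineE eps : 0 < eps ->
  [set y : R | eps < `|y|] = `]eps, +oo[%classic `|` `]-oo, - eps[%classic.
Proof.
move=> e0; apply/seteqP; split => y /=; rewrite !in_itv/= andbT.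
  by rewrite ltr_normr => /orP[H|H]; [left|right; rewrite ltrNr].
by move=> [H|H]; rewrite ltr_normr ?H// ltrNr H orbT.
Qed.

Lemma punctured_line_disjoint eps : 0 < eps ->
  [disjoint (`]eps, +oo[%classic : set R) & (`]-oo, - eps[%classic : set R)].
Proof.
move=> e0; apply/disj_setPS => y [] /=; rewrite !in_itv/= andbT => h1 h2.
by lra.
Qed.

Lemma integrable_tail al eps : 0 < al -> 0 < eps ->
  mu.-integrable `]eps, +oo[ (EFin \o (fun y => `|y| `^ (- (1 + al)))).
Proof.
move=> al0 e0; have b0 : 0 < 1 + al by rewrite addr_gt0.
pose C := (eps / (1 + eps)) `^ (- (1 + al)).
have mD : measurable (`]eps, +oo[%classic : set R) by exact: measurable_itv.
have S : (`]eps, +oo[%classic : set R) `<=` Ioy.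
  by apply: subset_itv; rewrite bnd_simp// ltW.
have I : mu.-integrable `]eps, +oo[ (EFin \o (fun y => C * (1 + y) `^ (- (1 + al)))).
  apply: (@integrableS _ _ R lebesgue_measure Ioy) => //.
  apply: integrable_RZ; first exact: measurable_Ioy.
  by apply: integrable_powR1D; lra.
apply: le_integrable I => //.
  apply/measurable_EFinP/measurable_funTS.
  apply: (@measurableT_comp _ _ _ _ _ _ (@powR R ^~ (- (1 + al)))) => //.
move=> y; rewrite /= in_itv/= andbT => ye; have y0 := lt_trans e0 ye.
have e1 : 0 < 1 + eps by rewrite addr_gt0.
have y1 : 0 < 1 + y by rewrite addr_gt0.
rewrite lee_fin !ger0_norm ?mulr_ge0 ?powR_ge0 ?(ltW y0)//.
rewrite /C -powRM ?(ltW y1) ?divr_ge0 ?(ltW e0) ?(ltW e1)//.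
have H : eps / (1 + eps) * (1 + y) <= y.
  by rewrite mulrAC ler_pdivrMr//; lra.
rewrite !powRN lef_pV2 ?posrE ?powR_gt0 ?mulr_gt0 ?invr_gt0//.
by rewrite ge0_ler_powR ?nnegrE ?(ltW b0) ?(ltW y0)// !mulr_ge0 ?invr_ge0 ?ltW.
Qed.

(** Dominated convergence: the truncated integrands are bounded by [|g|]. *)
Lemma integral_shrink g : mu.-integrable Ioy (EFin \o g) ->
  \int[mu]_(y in `]eps, +oo[) g y @[eps --> (0 : R)^'+] --> \int[mu]_(y in Ioy) g y.
Proof.
move=> ig; apply/cvg_at_rightP => u [u0 ucv].
have mI := @measurable_Ioy R.
have mD n : measurable (`]u n, +oo[%classic : set R) by exact: measurable_itv.
have mg : measurable_fun Ioy (EFin \o g) by case/integrableP: ig.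
pose g_ n := ((EFin \o g) \_ (`]u n, +oo[%classic : set R)).
have [] := @dominated_convergence _ _ R lebesgue_measure Ioy mI g_
   (EFin \o g) (abse \o (EFin \o g)).
- move=> n; apply/(measurable_restrict (EFin \o g) (mD n) mI).
  by apply: measurable_funS mg => //; apply: subIsetl.
- exact: mg.
- apply: aeW => t; rewrite /= in_itv/= andbT => t0.
  apply: cvg_near_cst; near=> n.
  rewrite /g_ patchE mem_set//= in_itv/= andbT; near: n.
  by have /cvgr_lt/(_ _ t0) := ucv.
- exact: integrable_abse.
- apply: aeW => t n t0; rewrite /g_ patchE; case: ifPn => // _.
  by rewrite abse0 abse_ge0.
move=> _ _ H.
have E n : (\int[mu]_(x in Ioy) g_ n x)%E = (\int[mu]_(x in `]u n, +oo[) (g x)%:E)%E.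
  rewrite /g_ -integral_mkcondr; congr (integral _ _ _).
  by apply/setIidPr; apply: subset_itv; rewrite bnd_simp// ltW.
have F : (\int[mu]_(x in Ioy) (g x)%:E)%E \is a fin_num by exact: integrable_fin_num.
rewrite /Rintegral; apply: fine_cvg; rewrite fineK//.
by move: H; under eq_fun do rewrite E.
Unshelve. all: end_near. Qed.

(** Folding the two half-lines turns the principal value into an absolutely
    convergent integral of a second difference. *)
Lemma principal_value f (M al x : R) : 0 < al -> continuous f ->
  (forall t, `|f t| <= M) ->
  let h y := (f x - f (x + y)) / `|y| `^ (1 + al) in
  let g y := (2 * f x - f (x + y) - f (x - y)) / y `^ (1 + al) in
  mu.-integrable Ioy (EFin \o g) ->
  (forall eps, 0 < eps -> mu.-integrable [set y | eps < `|y|] (EFin \o h)) /\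
  \int[mu]_(y in [set y | eps < `|y|]) h y @[eps --> (0 : R)^'+] --> \int[mu]_(y in Ioy) g y.
Proof.
move=> al0 cf fM h g ig.
have mf : measurable_fun setT f by exact: continuous_measurable_fun.
have mh : measurable_fun setT h.
  rewrite /h; under eq_fun do rewrite -powRN.
  apply: measurable_funM.
    apply: measurable_funB => //; apply: measurableT_comp => //.
    exact: measurable_funD.
  apply: (@measurableT_comp _ _ _ _ _ _ (@powR R ^~ (- (1 + al)))) => //.
have hb y : `|h y| <= 2 * M * `|y| `^ (- (1 + al)).
  rewrite /h normrM normfV (ger0_norm (powR_ge0 _ _)) powRN.
  rewrite ler_wpM2r ?invr_ge0 ?powR_ge0//.
  by apply: (le_trans (ler_normB _ _)); have := fM x; have := fM (x + y); lra.
have mP eps : measurable (`]eps, +oo[%classic : set R) by exact: measurable_itv.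
have mN eps : measurable (`]-oo, eps[%classic : set R) by exact: measurable_itv.
have iP eps : 0 < eps -> mu.-integrable `]eps, +oo[ (EFin \o h).
  move=> e0; have I := integrable_RZ (2 * M) (mP eps) (integrable_tail al0 e0).
  apply: le_integrable I => //; first by apply/measurable_EFinP; exact: measurable_funTS.
  by move=> y _; rewrite lee_fin (le_trans (hb y))// ler_norm.
have iP' eps : 0 < eps -> mu.-integrable `]eps, +oo[ (EFin \o (h \o -%R)).
  move=> e0; have I := integrable_RZ (2 * M) (mP eps) (integrable_tail al0 e0).
  apply: le_integrable I => //.
    apply/measurable_EFinP/measurable_funTS; exact: measurableT_comp.
  by move=> y _; rewrite lee_fin (le_trans (hb (- y)))// normrN ler_norm.
have pre eps : (-%R @^-1` (`]-oo, - eps[%classic : set R)) = `]eps, +oo[%classic.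
  by apply/seteqP; split => y /=; rewrite !in_itv/= ltrN2 andbT.
have neg eps : 0 < eps -> mu.-integrable `]-oo, - eps[ (EFin \o h) /\
   \int[mu]_(y in `]-oo, - eps[) h y = \int[mu]_(y in `]eps, +oo[) h (- y).
  move=> e0; have H := integral_reflect (mN (- eps)) mh.
  by rewrite pre in H; exact: H (iP' _ e0).
have iU eps : 0 < eps -> mu.-integrable [set y | eps < `|y|] (EFin \o h).
  move=> e0; rewrite punctured_lineE//; apply: integrable_setU => //.
  - exact: punctured_line_disjoint.
  - exact: iP.
  - by case: (neg _ e0).
split => //.
apply: cvg_trans (integral_shrink ig); apply: near_eq_cvg; near=> eps.
have e0 : 0 < eps by near: eps; exact: nbhs_right_gt.
have I := iU _ e0; rewrite (punctured_lineE e0) in I *.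
rewrite (@Rintegral_setU _ _ R lebesgue_measure _ _ h (mP eps) (mN (- eps)) I
  (punctured_line_disjoint e0)).
case: (neg _ e0) => _ ->.
rewrite -RintegralD//; [|exact: iP|exact: iP'].
apply: eq_Rintegral => y; rewrite inE/= in_itv/= andbT => ye.
have y0 := lt_trans e0 ye.
by rewrite /g /h normrN gtr0_norm//; ring.
Unshelve. all: end_near. Qed.

End PrincipalValue.

(** * Principal values and their exchange with the Laplace transform *)

Section FracLapPower.
Context {R : realType}.
Implicit Types (x t a b y al s : R) (f : R -> R) (u : R -> R[i]) (z v w : R[i]).
Local Notation mu := (@lebesgue_measure R).
Local Notation Ioy := (`]0%R, +oo[%classic : set R).

Lemma Re_div z a : Re (z / a%:C) = Re z / a.
Proof. by rewrite -fmorphV mulrC ReZ mulrC. Qed.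

Lemma Im_div z a : Im (z / a%:C) = Im z / a.
Proof. by rewrite -fmorphV mulrC ImZ mulrC. Qed.

(** The normalising constant of the fractional Laplacian is left out: the value
    [v] found below contains the factor [2 * cos_const al] that it cancels. *)
Definition has_pv al u x v :=
  [/\ forall eps : R, 0 < eps ->
        cintegrable [set y : R | eps < `|y|] (fraclap_integrand al u x),
      Re (fraclap_trunc al u x eps) @[eps --> (0 : R)^'+] --> Re v &
      Im (fraclap_trunc al u x eps) @[eps --> (0 : R)^'+] --> Im v].

Lemma has_pv_fraclap al u x v : has_pv al u x v ->
  fraclap_converges al u x /\ fraclap al u x = (fraclap_const al)%:C * v.
Proof.
move=> [i c1 c2]; split; first by split=> //; apply/cvg_ex; [exists (Re v)|exists (Im v)].
rewrite /fraclap; congr (_ * _); apply: complex_eqP => /=; exact: cvg_lim.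
Qed.

(** The real and imaginary parts of [u] are treated by [principal_value]
    separately. *)
Lemma has_pv_second_difference al u (du : R -> R[i]) x (M : R) v :
  0 < al -> (forall t, cder u t (du t)) -> (forall t, normc (u t) <= M) ->
  has_cint Ioy (fun y => (2 * u x - u (x + y) - u (x - y)) / (y `^ (1 + al))%:C) v ->
  has_pv al u x v.
Proof.
move=> al0 ud uM [[i1 i2] <-].
have c1 : continuous (fun t => Re (u t)).
  by move=> t; case: (ud t) => /derive_continuous.
have c2 : continuous (fun t => Im (u t)).
  by move=> t; case: (ud t) => _ /derive_continuous.
have M1 t : `|Re (u t)| <= M by apply: le_trans (normc_Re _) (uM t).
have M2 t : `|Im (u t)| <= M by apply: le_trans (normc_Im _) (uM t).
have two z : (Re (2 * z) = 2 * Re z) * (Im (2 * z) = 2 * Im z).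
  have -> : (2 : R[i]) = (2 : R)%:C by rewrite rmorph_nat.
  by rewrite ReZ ImZ.
have E1 : (fun y => Re ((2 * u x - u (x + y) - u (x - y)) / (y `^ (1 + al))%:C)) =
   (fun y => (2 * Re (u x) - Re (u (x + y)) - Re (u (x - y))) / y `^ (1 + al)).
  by apply/funext => y; rewrite Re_div !ReD !ReN two.
have E2 : (fun y => Im ((2 * u x - u (x + y) - u (x - y)) / (y `^ (1 + al))%:C)) =
   (fun y => (2 * Im (u x) - Im (u (x + y)) - Im (u (x - y))) / y `^ (1 + al)).
  by apply/funext => y; rewrite Im_div !ImD !ImN two.
have F1 : (fun y => Re (fraclap_integrand al u x y)) =
   (fun y => (Re (u x) - Re (u (x + y))) / `|y| `^ (1 + al)).
  by apply/funext => y; rewrite /fraclap_integrand Re_div ReD ReN.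
have F2 : (fun y => Im (fraclap_integrand al u x y)) =
   (fun y => (Im (u x) - Im (u (x + y))) / `|y| `^ (1 + al)).
  by apply/funext => y; rewrite /fraclap_integrand Im_div ImD ImN.
have i1' : mu.-integrable Ioy (EFin \o
   (fun y => (2 * Re (u x) - Re (u (x + y)) - Re (u (x - y))) / y `^ (1 + al))).
  by rewrite -E1; exact: i1.
have i2' : mu.-integrable Ioy (EFin \o
   (fun y => (2 * Im (u x) - Im (u (x + y)) - Im (u (x - y))) / y `^ (1 + al))).
  by rewrite -E2; exact: i2.
have [h1 l1] := principal_value al0 c1 M1 i1'.
have [h2 l2] := principal_value al0 c2 M2 i2'.
split.
- move=> eps e0; split.
    have := h1 eps e0; rewrite -F1; exact.
  have := h2 eps e0; rewrite -F2; exact.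
- rewrite /fraclap_trunc /cintegral; cbn [Re]; rewrite E1.
  by under eq_fun do rewrite F1; exact: l1.
- rewrite /fraclap_trunc /cintegral; cbn [Im]; rewrite E2.
  by under eq_fun do rewrite F2; exact: l2.
Qed.

Lemma measurable_punctured (eps : R) : 0 < eps -> measurable [set y : R | eps < `|y|].
Proof.
by move=> e0; rewrite punctured_lineE//; apply: measurableU; exact: measurable_itv.
Qed.

Lemma has_pv_ext al u u' x v : u =1 u' -> has_pv al u x v -> has_pv al u' x v.
Proof. by move=> /funext ->. Qed.

Lemma has_pvD al u u' x v v' : has_pv al u x v -> has_pv al u' x v' ->
  has_pv al (fun t => u t + u' t) x (v + v').
Proof.
move=> [i1 r1 m1] [i2 r2 m2].
have H eps : 0 < eps -> has_cint [set y : R | eps < `|y|]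
    (fraclap_integrand al (fun t => u t + u' t) x)
    (fraclap_trunc al u x eps + fraclap_trunc al u' x eps).
  move=> e0; have mD := measurable_punctured e0.
  apply: has_cint_ext (has_cintD mD (conj (i1 _ e0) erefl) (conj (i2 _ e0) erefl)) => // y _.
  by rewrite /fraclap_integrand -mulrDl; congr (_ / _); ring.
split.
- by move=> eps /H [].
- rewrite ReD; apply: cvg_trans (cvgD r1 r2); apply: near_eq_cvg; near=> eps.
  have e0 : 0 < eps by near: eps; exact: nbhs_right_gt.
  by case: (H eps e0) => _; rewrite /fraclap_trunc => ->; rewrite ReD.
- rewrite ImD; apply: cvg_trans (cvgD m1 m2); apply: near_eq_cvg; near=> eps.
  have e0 : 0 < eps by near: eps; exact: nbhs_right_gt.
  by case: (H eps e0) => _; rewrite /fraclap_trunc => ->; rewrite ImD.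
Unshelve. all: end_near. Qed.

Lemma has_pvZ al w u x v : has_pv al u x v -> has_pv al (fun t => w * u t) x (w * v).
Proof.
move=> [i1 r1 m1].
have H eps : 0 < eps -> has_cint [set y : R | eps < `|y|]
    (fraclap_integrand al (fun t => w * u t) x) (w * fraclap_trunc al u x eps).
  move=> e0; have mD := measurable_punctured e0.
  apply: has_cint_ext (has_cintZ w mD (conj (i1 _ e0) erefl)) => // y _.
  by rewrite /fraclap_integrand mulrA mulrBr.
split.
- by move=> eps /H [].
- rewrite ReM; apply: cvg_trans (cvgB (cvgM (cvg_cst (Re w)) r1) (cvgM (cvg_cst (Im w)) m1)).
  apply: near_eq_cvg; near=> eps.
  have e0 : 0 < eps by near: eps; exact: nbhs_right_gt.
  by case: (H eps e0) => _; rewrite /fraclap_trunc => ->; rewrite ReM.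
- rewrite ImM; apply: cvg_trans (cvgD (cvgM (cvg_cst (Re w)) m1) (cvgM (cvg_cst (Im w)) r1)).
  apply: near_eq_cvg; near=> eps.
  have e0 : 0 < eps by near: eps; exact: nbhs_right_gt.
  by case: (H eps e0) => _; rewrite /fraclap_trunc => ->; rewrite ImM.
Unshelve. all: end_near. Qed.

Lemma has_pv_cst al w x : has_pv al (fun=> w) x 0.
Proof.
have H eps : 0 < eps -> has_cint [set y : R | eps < `|y|] (fraclap_integrand al (fun=> w) x) 0.
  move=> e0; have mD := measurable_punctured e0.
  apply: has_cint_ext (has_cint0 mD) => // y _.
  by rewrite /fraclap_integrand subrr mul0r.
split.
- by move=> eps /H [].
- apply: cvg_near_cst; near=> eps.
  have e0 : 0 < eps by near: eps; exact: nbhs_right_gt.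
  by case: (H eps e0) => _; rewrite /fraclap_trunc => ->.
- apply: cvg_near_cst; near=> eps.
  have e0 : 0 < eps by near: eps; exact: nbhs_right_gt.
  by case: (H eps e0) => _; rewrite /fraclap_trunc => ->.
Unshelve. all: end_near. Qed.

Lemma has_pv_sum al n (F : 'I_n -> R -> R[i]) (v : 'I_n -> R[i]) x :
  (forall i, has_pv al (F i) x (v i)) ->
  has_pv al (fun t => \sum_(i < n) F i t) x (\sum_(i < n) v i).
Proof.
elim: n F v => [|n IH] F v H.
  rewrite big_ord0; apply: has_pv_ext (has_pv_cst al 0 x) => t.
  by rewrite big_ord0.
rewrite big_ord_recl; apply: (@has_pv_ext _ (fun t => F ord0 t + \sum_(i < n) F (lift ord0 i) t)).
  by move=> t; rewrite big_ord_recl.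
by apply: has_pvD => //; apply: IH => i; exact: H.
Qed.

Lemma le_weight2 (a b c : R) : 0 <= b -> 0 <= c -> a <= 2 -> c * (a * b) <= 2 * b * c.
Proof.
move=> b0 c0 a2; have -> : c * (a * b) = a * (b * c) by ring.
by rewrite -mulrA; apply: ler_wpM2r => //; exact: mulr_ge0.
Qed.

(** Exchanging the integrals leaves [1 - cos (t y)] against [y^(-al-1)] inside,
    that is [cos_const al * t^al]: the operator multiplies the weight of frequency
    [t] by [t^al]. The bound on [f] makes the double integral absolutely
    convergent. *)
Lemma fubini_one_sub_cos f al s : 0 < al -> al < 2 -> 0 < s ->
  measurable_fun setT f ->
  (forall t, 0 < t -> `|f t| <= t `^ (s - 1) * expR (- t)) ->
  let G y := \int[mu]_(t in Ioy) (f t * ((1 - cos (t * y)) * y `^ (- al - 1))) in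
  mu.-integrable Ioy (EFin \o G) /\
  \int[mu]_(y in Ioy) G y = cos_const al * \int[mu]_(t in Ioy) (t `^ al * f t).
Proof.
move=> al0 al2 s0 mf fb G.
have mI := @measurable_Ioy R.
have if_ : mu.-integrable Ioy (EFin \o f).
  apply: le_integrable_pos fb (integrable_gamma s0); exact: measurable_funTS.
pose F (p : R * R) := f p.2 * ((1 - cos (p.2 * p.1)) * p.1 `^ (- al - 1)).
have mF : measurable_fun setT F.
  rewrite /F; apply: measurable_funM; first exact: measurableT_comp.
  apply: measurable_funM.
    apply: measurable_funB => //.
    apply: (@measurableT_comp _ _ _ _ _ _ (@cos R)).
      by apply: continuous_measurable_fun; exact: continuous_cos.
    exact: measurable_funM.
  exact: (measurableT_comp (measurable_powR _)).
have icos t : 0 < t -> mu.-integrable Ioy (EFin \o (fun y => (1 - cos (t * y)) * y `^ (- al - 1))).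
  move=> t0; apply/integrableP; split.
    by apply/measurable_EFinP; apply: measurable_continuous_oy => y; exact: one_sub_cos_continuous.
  rewrite (@eq_integral_oy _ _ (fun y => ((1 - cos (t * y)) * y `^ (- al - 1))%:E)).
    by rewrite integral_one_sub_cos// ltry.
  by move=> y _; rewrite /= ger0_norm// one_sub_cos_ge0.
have inner t : 0 < t -> \int[mu]_(y in Ioy) F (y, t) = f t * (t `^ al * cos_const al).
  move=> t0; rewrite /F/= RintegralZl//; last exact: icos.
  by congr (_ * _); rewrite /Rintegral integral_one_sub_cos.
have iF t : 0 < t -> mu.-integrable Ioy (EFin \o (fun y => F (y, t))).
  by move=> t0; exact: (integrable_RZ (f t) mI (icos t t0)).
have isal : mu.-integrable Ioy (EFin \o (fun t => t `^ (s + al - 1) * expR (- t))).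
  by apply: integrable_gamma; rewrite addr_gt0.
have GEr y : 0 < y -> (\int[mu]_(t in Ioy) (F (y, t))%:E = (G y)%:E)%E.
  move=> y0; apply: (@integral_EFin _ (fun t => F (y, t))).
  have iabs : mu.-integrable Ioy (EFin \o (fun t => `|f t|)) by apply: integrable_abse if_.
  apply: le_integrable_pos (integrable_RZ (2 * y `^ (- al - 1)) mI iabs).
    apply: measurable_funTS; apply: (measurableT_comp mF).
    exact: measurable_fun_pair.
  move=> t t0; rewrite /F/= !normrM (ger0_norm (powR_ge0 _ _)).
  apply: le_weight2; [exact: powR_ge0|exact: normr_ge0|].
  by rewrite ger0_norm ?subr_ge0 ?cos_le1//; have := cos_geN1 (t * y); lra.
have it : mu.-integrable Ioy (EFin \o (fun t => t `^ al * f t)).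
  apply: le_integrable_pos isal; first by apply: measurable_funTS; exact: measurable_funM.
  move=> t t0; rewrite normrM ger0_norm ?powR_ge0//.
  rewrite (_ : s + al - 1 = al + (s - 1)); last by ring.
  by rewrite gt0_powRD// -mulrA ler_wpM2l ?powR_ge0 ?fb.
have EZ : \int[mu]_(t in Ioy) (cos_const al * (t `^ al * f t)) =
   cos_const al * \int[mu]_(t in Ioy) (t `^ al * f t) by rewrite RintegralZl.
(* absolute convergence, with the nonnegative y-integral computed exactly *)
have Foo : (\int[mu]_(t in Ioy) \int[mu]_(y in Ioy) `|F (y, t)|%:E < +oo)%E.
  have -> : (\int[mu]_(t in Ioy) \int[mu]_(y in Ioy) `|F (y, t)|%:E =
     \int[mu]_(t in Ioy) (cos_const al * (t `^ al * `|f t|))%:E)%E.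
    apply: eq_integral_oy => t t0.
    rewrite (@eq_integral_oy _ _ (fun y => (`|f t| * ((1 - cos (t * y)) * y `^ (- al - 1)))%:E)).
      rewrite ge0_integralZl_oy//.
      - by rewrite integral_one_sub_cos// -EFinM; congr EFin; ring.
      - by apply: measurable_continuous_oy => y; exact: one_sub_cos_continuous.
      - by move=> y _; exact: one_sub_cos_ge0.
    by move=> y y0; rewrite /F/= normrM (ger0_norm (one_sub_cos_ge0 _ _ _)).
  have I : mu.-integrable Ioy (EFin \o (fun t => cos_const al * (t `^ al * `|f t|))).
    apply: integrable_RZ => //; apply: le_integrable_pos isal.
      apply: measurable_funTS; apply: measurable_funM => //.
      exact: measurableT_comp.
    move=> t t0; rewrite ger0_norm ?mulr_ge0 ?powR_ge0//.
    rewrite (_ : s + al - 1 = al + (s - 1)); last by ring.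
    by rewrite gt0_powRD// -mulrA ler_wpM2l ?powR_ge0 ?fb.
  by rewrite integral_EFin// ltry.
have [iG GE] := fubini_oy mF Foo.
split.
  move: iG {GE Foo}; apply: eq_integrable; first exact: measurable_Ioy.
  by move=> y; rewrite inE/= in_itv/= andbT => /GEr.
rewrite -EZ.
rewrite /Rintegral -(eq_integral_oy GEr) GE; congr fine.
apply: eq_integral_oy => t t0.
have -> := @integral_EFin _ (fun y => F (y, t)) (iF t t0).
by rewrite (inner t t0); congr EFin; ring.
Qed.

End FracLapPower.

(** * The fractional Laplacian of a power *)

Section LaplaceSecondDifference.
Context {R : realType}.
Implicit Types (x t a b y al s : R).
Local Notation mu := (@lebesgue_measure R).
Local Notation Ioy := (`]0%R, +oo[%classic : set R).

Lemma ReZr (z : R[i]) a : Re (z * a%:C) = Re z * a.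
Proof. by rewrite mulrC ReZ mulrC. Qed.

Lemma ImZr (z : R[i]) a : Im (z * a%:C) = Im z * a.
Proof. by rewrite mulrC ImZ mulrC. Qed.

Lemma complex_scale_assoc (g c k : R) (p : R[i]) :
  2 / g%:C * (c%:C * (k%:C * p)) = (2 * c * (k / g))%:C * p.
Proof. by rewrite !rmorphM/= fmorphV rmorph_nat; ring. Qed.

Lemma laplace_shift s x y t : laplace s (x + y) t = laplace s x t * cis (- (t * y)).
Proof.
rewrite /laplace /cis -mulrA -cexpD; congr (_ * cexp _).
by apply: complex_eqP => /=; ring.
Qed.

Lemma cisD_cisN a : cis (- a) + cis a = (2 * cos a)%:C.
Proof. by rewrite !cisE cosN sinN; apply: complex_eqP => /=; ring. Qed.

(** Translation by [y] multiplies the frequency [t] by [e^(-ity)], so that the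
    symmetric second difference multiplies it by the real number
    [2 (1 - cos (ty))]. *)
Lemma laplace_second_difference s x y t :
  2 * laplace s x t - laplace s (x + y) t - laplace s (x - y) t =
  2 * (laplace s x t * (1 - cos (t * y))%:C).
Proof.
rewrite !laplace_shift mulrN opprK.
rewrite -[LHS]addrA -opprD -mulrDr cisD_cisN rmorphM rmorphB rmorph1 rmorph_nat/=.
ring.
Qed.

Lemma Re_laplace s x t : Re (laplace s x t) = t `^ (s - 1) * (expR (- t) * cos (- (t * x))).
Proof. by rewrite /laplace ReZ /cexp ReZ ReN ImN ReZ ImZ /= mulr1. Qed.

Lemma Im_laplace s x t : Im (laplace s x t) = t `^ (s - 1) * (expR (- t) * sin (- (t * x))).
Proof. by rewrite /laplace ImZ /cexp ImZ ReN ImN ReZ ImZ /= mulr1. Qed.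

Lemma measurable_laplace s x :
  measurable_fun setT (fun t => Re (laplace s x t)) /\
  measurable_fun setT (fun t => Im (laplace s x t)).
Proof.
have m1 : measurable_fun setT (fun t => expR (- t)).
  by apply: measurableT_comp.
have m2 : measurable_fun setT (fun t => - (t * x)).
  by apply: measurableT_comp => //; exact: measurable_funM.
split.
  under eq_fun do rewrite Re_laplace.
  apply: measurable_funM => //; apply: measurable_funM => //.
  apply: (@measurableT_comp _ _ _ _ _ _ (@cos R)) => //.
  by apply: continuous_measurable_fun; exact: continuous_cos.
under eq_fun do rewrite Im_laplace.
apply: measurable_funM => //; apply: measurable_funM => //.
apply: (@measurableT_comp _ _ _ _ _ _ (@sin R)) => //.
by apply: continuous_measurable_fun; exact: continuous_sin.
Qed.

Lemma powR_laplace s al x t : 0 < t -> (t `^ al)%:C * laplace s x t = laplace (s + al) x t.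
Proof.
move=> t0; rewrite /laplace mulrA -rmorphM/= -gt0_powRD//.
by congr ((_ `^ _)%:C * _); ring.
Qed.

Lemma has_cint_laplace s x : 0 < s -> has_cint Ioy (laplace s x) ((Gamma s)%:C * pow1 (- s) x).
Proof. by move=> s0; split; [exact: cintegrable_laplace|exact: cintegral_laplace]. Qed.

Lemma has_cint_laplace_cos s x y : 0 < s ->
  has_cint Ioy (fun t => laplace s x t * (1 - cos (t * y))%:C)
   ((Gamma s)%:C / 2 * (2 * pow1 (- s) x - pow1 (- s) (x + y) - pow1 (- s) (x - y))).
Proof.
move=> s0; have mI := @measurable_Ioy R.
have := has_cintD mI (has_cintD mI (has_cint_laplace x s0)
  (has_cintZ (- 2^-1) mI (has_cint_laplace (x + y) s0)))
  (has_cintZ (- 2^-1) mI (has_cint_laplace (x - y) s0)).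
set v := (X in has_cint _ _ X -> _); set v' := (X in _ -> has_cint _ _ X).
have -> : v = v' by rewrite /v /v'; field.
apply: has_cint_ext => // t _.
have two : (2 : R[i]) != 0 by rewrite pnatr_eq0.
by apply: (mulfI two); rewrite -laplace_second_difference; field.
Qed.

(** Insert the Laplace representation of the powers, exchange the integrals by
    [fubini_one_sub_cos], and recognise the Laplace representation of exponent
    [s + al]. *)
Lemma has_cint_pow1_second_difference s al x : 0 < s -> 0 < al -> al < 2 ->
  has_cint Ioy
   (fun y => (2 * pow1 (- s) x - pow1 (- s) (x + y) - pow1 (- s) (x - y)) / (y `^ (1 + al))%:C)
   ((2 * cos_const al * (Gamma (s + al) / Gamma s))%:C * pow1 (- (s + al)) x).
Proof.
move=> s0 al0 al2; have mI := @measurable_Ioy R.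
have G0 : (Gamma s)%:C != 0 :> R[i].
  by apply/eqP => /complexI H; have := Gamma_gt0 s0; rewrite H ltxx.
have [mRe mIm] := measurable_laplace s x.
have bRe t : 0 < t -> `|Re (laplace s x t)| <= t `^ (s - 1) * expR (- t).
  by move=> _; rewrite -(normc_laplace s x t) normc_Re.
have bIm t : 0 < t -> `|Im (laplace s x t)| <= t `^ (s - 1) * expR (- t).
  by move=> _; rewrite -(normc_laplace s x t) normc_Im.
have [iR eR] := fubini_one_sub_cos al0 al2 s0 mRe bRe.
have [iI eI] := fubini_one_sub_cos al0 al2 s0 mIm bIm.
pose H (y : R) : R[i] :=
  (\int[mu]_(t in Ioy) (Re (laplace s x t) * ((1 - cos (t * y)) * y `^ (- al - 1)))) +i*
  (\int[mu]_(t in Ioy) (Im (laplace s x t) * ((1 - cos (t * y)) * y `^ (- al - 1)))).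
have HH : has_cint Ioy H ((cos_const al)%:C * ((Gamma (s + al))%:C * pow1 (- (s + al)) x)).
  split; first by split; [exact: iR|exact: iI].
  have sal : 0 < s + al by rewrite addr_gt0.
  rewrite -(cintegral_laplace x sal).
  apply: complex_eqP; rewrite ?ReZ ?ImZ.
    rewrite [LHS]eR; congr (_ * _).
    apply: eq_Rintegral => t; rewrite inE => tI.
    have t0 : 0 < t by move: tI; rewrite /= in_itv/= andbT.
    by rewrite -(powR_laplace s al x t0); exact/esym/ReZ.
  rewrite [LHS]eI; congr (_ * _).
  apply: eq_Rintegral => t; rewrite inE => tI.
  have t0 : 0 < t by move: tI; rewrite /= in_itv/= andbT.
  by rewrite -(powR_laplace s al x t0); exact/esym/ImZ.
have HE y : 0 < y -> H y = (y `^ (- al - 1))%:C *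
    cintegral Ioy (fun t => laplace s x t * (1 - cos (t * y))%:C).
  move=> y0.
  have [[ic1 ic2] _] := has_cint_laplace_cos x y s0.
  apply: complex_eqP; rewrite ?ReZ ?ImZ /H; cbn [Re Im cintegral].
    rewrite -RintegralZl//; apply: eq_Rintegral => t _.
    by rewrite (ReZr (laplace s x t)); ring.
  rewrite -RintegralZl//; apply: eq_Rintegral => t _.
  by rewrite (ImZr (laplace s x t)); ring.
have := has_cintZ (2 / (Gamma s)%:C) mI HH.
rewrite complex_scale_assoc; apply: has_cint_ext => // y; rewrite /= in_itv/= andbT => y0.
rewrite HE//; case: (has_cint_laplace_cos x y s0) => _ ->.
have -> : (y `^ (1 + al))%:C = ((y `^ (- al - 1))%:C)^-1.
  by rewrite -fmorphV -powRN; congr (_ `^ _)%:C; ring.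
have y1 : (y `^ (- al - 1))%:C != 0 :> R[i].
  by apply/eqP => /complexI E; have := powR_gt0 (- al - 1) y0; rewrite E ltxx.
by field; rewrite y1.
Qed.

Lemma normc_pow1N_le1 s x : 0 < s -> normc (pow1 (- s) x) <= 1.
Proof.
move=> s0; rewrite normc_pow1 -[leRHS]expR0 ler_expR mulNr oppr_le0.
by rewrite mulr_ge0 ?(ltW s0)// divr_ge0// ln_ge0// lerDl sqr_ge0.
Qed.

Lemma dpow1_dir s (sg : R) x :
  cder (fun x => pow1 s (sg * x)) x (sg%:C * (pow1 s (sg * x) * (s%:C * (Ci / (1 +i* (sg * x)))))).
Proof.
have [d1 d2] := dpow1 s (sg * x).
have D : is_derive x 1 (fun x => sg * x) sg.
  by apply: (is_derive_eq (dZ sg (dI x))); rewrite mulr1.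
split; rewrite ?ReZ ?ImZ mulrC.
  exact: (dchain (f := fun t => Re (pow1 s t)) d1 D).
exact: (dchain (f := fun t => Im (pow1 s t)) d2 D).
Qed.

Lemma has_pv_pow1 s al (sg : R) x : 0 < s -> 0 < al -> al < 2 -> sg ^+ 2 = 1 ->
  has_pv al (fun x => pow1 (- s) (sg * x)) x
   ((2 * cos_const al * (Gamma (s + al) / Gamma s))%:C * pow1 (- (s + al)) (sg * x)).
Proof.
move=> s0 al0 al2 sg2.
apply: (has_pv_second_difference al0 (fun t => dpow1_dir (- s) sg t)).
  by move=> t; exact: normc_pow1N_le1.
have H := has_cint_pow1_second_difference (sg * x) s0 al0 al2.
apply: has_cint_ext H; first exact: measurable_Ioy.
move=> y _; congr (_ / _).
move: sg2 => /eqP; rewrite sqrf_eq1 => /orP[] /eqP ->.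
  by rewrite !mul1r.
have -> : -1 * (x + y) = -1 * x - y by ring.
have -> : -1 * (x - y) = -1 * x + y by ring.
by rewrite [LHS]addrAC.
Qed.

End LaplaceSecondDifference.

(** * The terminating hypergeometric series *)

Section Hypergeometric.
Context {R : realType}.
Implicit Types (x al s : R) (m n N : nat).

Lemma clog_log1 x : clog (1 +i* x) = log1 x.
Proof.
have n0 := oneDsqr_gt0 x.
have nE : normc (1 +i* x) = Num.sqrt (1 + x ^+ 2) by rewrite /= expr1n.
rewrite /clog /log1 nE; congr (_ +i* _).
  by rewrite -powR12_sqrt ?ltW// ln_powR mulrC.
rewrite /carg nE; cbn [Re Im]; rewrite mul1r -cos_atan.
have pi0 := @pi_gt0 R.
case: ifPn => [x0|]; last rewrite -ltNge => x0.
  have a0 : 0 <= atan x by rewrite -[leLHS]atan0; exact: le_atan.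
  by rewrite cosK// in_itv/= a0/=; have := atan_ltpi2 x; lra.
have a0 : atan x <= 0 by rewrite -[leRHS]atan0; apply: le_atan; exact: ltW.
by rewrite cosKN ?opprK// a0 andbT; have := atan_gtNpi2 x; lra.
Qed.

Lemma cpow_pow1 s x : cpow (1 +i* x) s%:C = pow1 s x.
Proof. by rewrite /cpow (negbTE (oneDi_neq0 x)) clog_log1. Qed.

Lemma pochhammerS (z : R[i]) n : pochhammer z n.+1 = pochhammer z n * (z + n%:R).
Proof. by rewrite /pochhammer big_ord_recr. Qed.

(** Both sides are [m (1 - m) (2 - m)] up to [n - m]; for [n >= m] both contain
    the factor [0]. *)
Lemma pochhammer_one_sub m n :
  m%:R * pochhammer (1 - m%:R : R[i]) n = (-1) ^+ n * (m ^_ n.+1)%:R.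
Proof.
elim: n => [|n IH]; first by rewrite /pochhammer big_ord0 expr0 ffactn1 mulr1 mul1r.
rewrite pochhammerS mulrA IH [(m ^_ n.+2)%N]ffactnSr natrM exprS.
have [mn|nm] := leqP n.+1 m.
  by rewrite natrB// -natr1; ring.
by rewrite ffact_small// !(mul0r, mulr0).
Qed.

Lemma pochhammer_two n : pochhammer (2 : R[i]) n = n.+1`!%:R.
Proof.
elim: n => [|n IH]; first by rewrite /pochhammer big_ord0.
by rewrite pochhammerS IH [in RHS]factS natrM -natr1 -natr1; ring.
Qed.

Lemma Gamma_pochhammer s n : 0 < s ->
  (Gamma s)%:C * pochhammer s%:C n = (Gamma (s + n%:R))%:C.
Proof.
move=> s0; rewrite GammaD// rmorphM rmorph_prod/=; congr (_ * _).
by apply: eq_bigr => j _; rewrite rmorphD rmorph_nat.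
Qed.

(** The coefficient of [w^-(n+1)] in [(1 - 2/w)^m]. The index is shifted because
    the constant term is killed by all the operators considered. *)
Definition higgins_coef m n : R[i] := 'C(m, n.+1)%:R * (- 2) ^+ n.+1.

(** The expansion of [(1 - 2/w)^m], [w = 1 + i x], with every power [w^(-s)]
    replaced by its fractional Laplacian [Gamma (s + al) / Gamma s * w^(-s-al)].
    All the operators turn out to be multiples of this sum, at [sgn k * x] in
    place of [x]. *)
Definition higgins_fraclap m al x : R[i] :=
  \sum_(n < m) higgins_coef m n * ((Gamma (n.+1%:R + al) / Gamma n.+1%:R)%:C *
     pow1 (- (n.+1%:R + al)) x).

(** The factor [1 - m + (m - 1) = 0] occurs in [(1 - m)_N] as soon as [m <= N]. *)
Lemma hyp2F1_terminating m (b c z : R[i]) : (0 < m)%N ->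
  hyp2F1 (1 - m%:R) b c z = hyp2F1_sum (1 - m%:R) b c z m.
Proof.
move=> m0; have E N : (m <= N)%N -> hyp2F1_sum (1 - m%:R) b c z N = hyp2F1_sum (1 - m%:R) b c z m.
  elim: N => [|N IH]; first by rewrite leqn0 => /eqP ->.
  rewrite leq_eqVlt => /predU1P[<-//|mN].
  rewrite /hyp2F1_sum big_ord_recr/= -/(hyp2F1_sum _ _ _ _ N) IH//.
  have -> : pochhammer (1 - m%:R : R[i]) N = 0.
    have mm : (m%:R : R[i]) != 0 by rewrite pnatr_eq0 -lt0n.
    apply: (mulfI mm); rewrite pochhammer_one_sub ffact_small//.
    by rewrite !mulr0.
  by rewrite !mul0r addr0.
rewrite /hyp2F1; apply: complex_eqP => /=.
  apply: cvg_lim => //; apply: cvg_near_cst; exists m => // N /= mN.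
  by rewrite E.
apply: cvg_lim => //; apply: cvg_near_cst; exists m => // N /= mN.
by rewrite E.
Qed.

(** The two sums agree term by term, by [pochhammer_one_sub], [(2)_n = (n+1)!] and
    [Gamma (1 + al) (1 + al)_n = Gamma (1 + al + n)]. *)
Lemma higgins_fraclap_hyp2F1 m al x : 0 < al ->
  higgins_fraclap m al x =
  - (2 * m%:R * (Gamma (1 + al))%:C / cpow (1 +i* x) (1 + al)%:C *
     hyp2F1 (1 - m%:R) (1 + al)%:C 2 (2 / (1 +i* x))).
Proof.
move=> al0; rewrite cpow_pow1.
have [->|m0] := posnP m; first by rewrite /higgins_fraclap big_ord0 mulr0 !mul0r oppr0.
rewrite hyp2F1_terminating// /hyp2F1_sum mulr_sumr -sumrN.
apply: eq_bigr => n _.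
rewrite pochhammer_two Gamma_nat /higgins_coef.
have -> : n.+1%:R + al = (1 + al) + n%:R :> R by rewrite -natr1; ring.
have al1 : 0 < 1 + al by rewrite addr_gt0.
rewrite rmorphM/= -Gamma_pochhammer// fmorphV rmorph_nat.
have -> : pow1 (- (1 + al + n%:R)) x = (pow1 (1 + al) x)^-1 * ((1 +i* x) ^+ n)^-1.
  by rewrite pow1_N (pow1_D (1 + al)) pow1_nat invfM.
have f0 k : (k`!%:R : R[i]) != 0 by rewrite pnatr_eq0 -lt0n fact_gt0.
have mP := pochhammer_one_sub m n.
rewrite -bin_ffact natrM in mP.
have H : m%:R * pochhammer (1 - m%:R) n / n.+1`!%:R = (-1) ^+ n * 'C(m, n.+1)%:R :> R[i].
  by rewrite mP; field.
rewrite exprMn exprVn exprSr exprNn.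
transitivity (- (2 * (m%:R * pochhammer (1 - m%:R) n / n.+1`!%:R) *
  ((Gamma (1 + al))%:C * pochhammer (1 + al)%:C n) / pow1 (1 + al) x * 2 ^+ n / (1 +i* x) ^+ n / n`!%:R)).
  by rewrite H; field; rewrite f0 pow1_neq0 expf_neq0 ?oneDi_neq0.
by field; rewrite !f0 pow1_neq0 expf_neq0 ?oneDi_neq0.
Qed.

End Hypergeometric.

(** * The operators on the Higgins functions *)

Section HigginsExpansion.
Context {R : realType}.
Implicit Types (x t al be sg : R) (m n : nat).
Local Notation Ioy := (`]0%R, +oo[%classic : set R).

(** For [k < 0] the quotient is inverted, which amounts to replacing [x] by
    [- x]. *)
Lemma higginsE (k : int) x :
  higgins k x = (1 - 2 / (1 +i* ((Num.sg k)%:~R * x))) ^+ `|k|%N.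
Proof.
rewrite /higgins.
have -> : Ci * x%:C - 1 = (- 1) +i* x :> R[i] by apply: complex_eqP => /=; ring.
have -> : Ci * x%:C + 1 = 1 +i* x :> R[i] by apply: complex_eqP => /=; ring.
have n1 := oneDi_neq0 x; have n2 := oneDi_neq0 (- x).
have E y : 1 +i* (- y) = - ((- 1) +i* y) :> R[i] by apply: complex_eqP => /=; ring.
have F y : 1 +i* y = ((- 1) +i* y) + 2 :> R[i] by apply: complex_eqP => /=; ring.
case: k => [[|m]|m].
- by rewrite expr0z expr0.
- rewrite gtr0_sg// mul1r -exprnP /=; congr (_ ^+ _).
  apply: (mulIf n1); rewrite divfK// mulrBl mul1r divfK//.
  by rewrite F; ring.
- rewrite NegzE sgrN gtr0_sg// rmorphN rmorph1 mulN1r -exprnN abszN /=.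
  rewrite -exprVn; congr (_ ^+ _); rewrite invf_div.
  apply: (mulIf n2); rewrite mulrBl mul1r divfK// E.
  have n3 : ((- 1) +i* x) != 0 :> R[i] by rewrite E oppr_eq0 in n2.
  by rewrite mulrN divfK// F; ring.
Qed.

Lemma one_sub_expr m x : (1 - 2 / (1 +i* x)) ^+ m =
  1 + \sum_(n < m) higgins_coef m n * pow1 (- n.+1%:R) x.
Proof.
rewrite exprDn big_ord_recl/= subn0 expr1n mul1r bin0 mulr1n; congr (_ + _).
apply: eq_bigr => n _; rewrite expr1n mul1r /bump/= add1n.
by rewrite pow1_N pow1_nat -mulNr exprMn exprVn -mulr_natl /higgins_coef mulrA.
Qed.

Lemma higgins_sum (k : int) x :
  higgins k x = 1 + \sum_(n < `|k|%N) higgins_coef `|k|%N n *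
     pow1 (- n.+1%:R) ((Num.sg k)%:~R * x).
Proof. by rewrite higginsE one_sub_expr. Qed.

Variables (k : int).
Let sg : R := (Num.sg k)%:~R.
Let m : nat := `|k|%N.

Let sgn2 (i : 'I_m) : sg ^+ 2 = 1.
Proof.
have k0 : k != 0 by rewrite -absz_eq0 -lt0n; exact: leq_ltn_trans (ltn_ord i).
by rewrite -rmorphXn/= sqr_sg k0.
Qed.

(** The condition that the slope has square [1] is available term by term: it
    fails only for [k = 0], when there is no term. *)
Lemma has_pv_higgins al x : 0 < al -> al < 2 ->
  has_pv al (higgins k) x ((2 * cos_const al)%:C * higgins_fraclap m al (sg * x)).
Proof.
move=> al0 al2.
have H : has_pv al (fun t => 1 + \sum_(n < m) higgins_coef m n * pow1 (- n.+1%:R) (sg * t)) x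
   (0 + \sum_(n < m) higgins_coef m n * ((2 * cos_const al * (Gamma (n.+1%:R + al) / Gamma n.+1%:R))%:C *
     pow1 (- (n.+1%:R + al)) (sg * x))).
  apply: has_pvD; first exact: has_pv_cst.
  apply: has_pv_sum => n; apply: has_pvZ.
  by apply: has_pv_pow1 => //; exact: sgn2 n.
have -> : (2 * cos_const al)%:C * higgins_fraclap m al (sg * x) =
  0 + \sum_(n < m) higgins_coef m n * ((2 * cos_const al * (Gamma (n.+1%:R + al) / Gamma n.+1%:R))%:C *
     pow1 (- (n.+1%:R + al)) (sg * x)).
  rewrite add0r /higgins_fraclap mulr_sumr; apply: eq_bigr => n _.
  by rewrite [in RHS](rmorphM (real_complex R) (2 * cos_const al)); ring.
by apply: has_pv_ext H => t; rewrite higgins_sum.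
Qed.

Lemma fraclap_higgins al x : 0 < al -> al < 2 ->
  fraclap_converges al (higgins k) x /\
  fraclap al (higgins k) x = higgins_fraclap m al (sg * x).
Proof.
move=> al0 al2; have [h ->] := has_pv_fraclap (has_pv_higgins x al0 al2).
split; first exact: h.
by rewrite mulrA -rmorphM fraclap_constE// rmorph1 mul1r.
Qed.

Lemma cderive_higgins t : cderive (higgins k) t =
  \sum_(n < m) (higgins_coef m n * (- (n.+1%:R * (sg%:C * Ci)))) * (1 +i* (sg * t)) ^- n.+2.
Proof.
apply: (proj2 (cder_cderive _)).
have D := cderD (cder_cst (1 : R[i]) t)
  (cder_sum (fun n : 'I_m => cderZ (higgins_coef m n) (dpow1_dir (- n.+1%:R) sg t))).
apply: cder_ext; first by move=> u; rewrite higgins_sum.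
apply: (cder_eq D); rewrite add0r; apply: eq_bigr => n _.
rewrite pow1_N pow1_nat rmorphN rmorph_nat.
have n1 := oneDi_neq0 (sg * t).
rewrite [(1 +i* (sg * t)) ^+ n.+2]exprS invfM; ring.
Qed.

(** Differentiating [w^(-n-1-be)] produces the factor [n + 1 + be], which the
    functional equation absorbs into [Gamma (n + 1 + be)]: up to [- i sg] the
    derivative has the same form with [be + 1] in place of [be]. *)
Lemma dhiggins_fraclap be x : 0 < be ->
  cder (fun t => higgins_fraclap m be (sg * t)) x
    (- (sg%:C * Ci) * higgins_fraclap m (be + 1) (sg * x)).
Proof.
move=> be0.
apply: (cder_eq (cder_sum (fun n : 'I_m => cderZ (higgins_coef m n)
  (cderZ (Gamma (n.+1%:R + be) / Gamma n.+1%:R)%:C (dpow1_dir (- (n.+1%:R + be)) sg x))))).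
rewrite /higgins_fraclap mulr_sumr; apply: eq_bigr => n _.
have nb : 0 < n.+1%:R + be :> R by rewrite addr_gt0.
rewrite addrA GammaS//.
have -> : pow1 (- (n.+1%:R + be + 1)) (sg * x) = pow1 (- (n.+1%:R + be)) (sg * x) / (1 +i* (sg * x)).
  by rewrite (opprD _ 1) pow1_D (pow1_N 1) (pow1_nat 1) expr1.
rewrite !rmorphM/= rmorphN/=; ring.
Qed.

Lemma mulN_comm (a b : R[i]) : a * - b = - (b * a).
Proof. by rewrite mulrN mulrC. Qed.

(** The factor [i tau] is a rotation by [tau pi / 2]; this is how [i sgn k] from a
    derivative completes the phase of order [a] to that of order [a + 1]. *)
Lemma cis_step (tau a : R) : tau ^+ 2 = 1 ->
  tau%:C * Ci * cis (tau * (pi / 2) * a) = cis (tau * (pi / 2) * (a + 1)).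
Proof.
by move=> tau2; rewrite -cis_pihalf// -cisD; congr cis; ring.
Qed.

Lemma Gamma_neq0 (s : R) : 0 < s -> Gamma s != 0.
Proof. by move=> s0; rewrite gt_eqF// Gamma_gt0. Qed.

Lemma frac_assoc (a b c d : R) : a * b * (d^-1 * c^-1) = a * (b / c) / d.
Proof. ring. Qed.

Lemma frac_cancel (c N S e G F P : R[i]) : N != 0 ->
  c * - (N * S) * (e * (G * F * N^-1) * P) = G * - (S * e) * (c * (F * P)).
Proof. by move=> N0; field. Qed.

(** The slope [tau] of the argument in [z] is [- sg] for the operator looking to
    the left and [sg] for the one looking to the right. For [k = 0] both vanish,
    but then the sum is empty. *)
Lemma has_cint_higgins be tau x : 0 < be -> be < 1 -> ((0 < m)%N -> tau ^+ 2 = 1) ->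
  has_cint Ioy (fun z => \sum_(n < m) (higgins_coef m n * (- (n.+1%:R * (sg%:C * Ci)))) *
        (1 +i* (sg * x + tau * z)) ^- n.+2 / (z `^ be)%:C)
    ((Gamma (1 - be))%:C * (- (sg%:C * Ci * cis (tau * (pi / 2) * (be - 1)))) *
       higgins_fraclap m be (sg * x)).
Proof.
move=> be0 be1 tau2; have mI := @measurable_Ioy R.
rewrite /higgins_fraclap mulr_sumr.
apply: has_cint_sum => // n.
have t2 : tau ^+ 2 = 1 by apply: tau2; exact: leq_ltn_trans (ltn_ord n).
have := has_cintZ (higgins_coef m n * (- (n.+1%:R * (sg%:C * Ci)))) mI
  (has_cint_power n.+1 (sg * x) be0 be1 t2).
set v := (X in has_cint _ _ X -> _); set v' := (X in _ -> has_cint _ _ X).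
have -> : v = v'.
  have E : beta_const be n.+1 = Gamma (1 - be) * (Gamma (n.+1%:R + be) / Gamma n.+1%:R) / n.+1%:R.
    rewrite /beta_const -[n.+2%:R]natr1 (GammaS (ltr0Sn R n)) invfM; exact: frac_assoc.
  rewrite /v /v' E (rmorphM (real_complex R) _ n.+1%:R^-1) fmorphV rmorph_nat.
  rewrite (rmorphM (real_complex R) (Gamma (1 - be))).
  have n0 : (n.+1%:R : R[i]) != 0 by rewrite pnatr_eq0.
  exact: frac_cancel.
by apply: has_cint_ext => // z _; exact: mulrA.
Qed.

Lemma weyl_marchaud_higgins be x : 0 < be -> be < 1 ->
  wm_converges be (higgins k) x /\
  weyl_marchaud be (higgins k) x = cis (- (sg * be * (pi / 2))) * higgins_fraclap m be (sg * x).
Proof.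
move=> be0 be1; have mI := @measurable_Ioy R.
have tau2 : (0 < m)%N -> (- sg) ^+ 2 = 1.
  by move=> m0; rewrite sqrrN; exact: sgn2 (Ordinal m0).
have [ic iE] : has_cint Ioy (wm_integrand be (higgins k) x)
   ((Gamma (1 - be))%:C * (- (sg%:C * Ci * cis (- sg * (pi / 2) * (be - 1)))) *
       higgins_fraclap m be (sg * x)).
  apply: has_cint_ext (has_cint_higgins x be0 be1 tau2) => // z _.
  rewrite /wm_integrand cderive_higgins mulr_suml; apply: eq_bigr => n _.
  by rewrite mulrBr mulNr.
split; first exact: ic.
rewrite /weyl_marchaud iE fmorphV.
have G1 : (Gamma (1 - be))%:C != 0 :> R[i].
  by rewrite fmorph_eq0 Gamma_neq0// subr_gt0.
rewrite -mulrA mulKf//.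
have [m0|m0] := posnP m.
  by rewrite m0 /higgins_fraclap big_ord0 !mulr0.
have s2 := sgn2 (Ordinal m0).
congr (_ * _).
transitivity ((- sg)%:C * Ci * cis (- sg * (pi / 2) * (be - 1))).
  by rewrite rmorphN !mulNr.
by rewrite cis_step ?sqrrN// subrK mulNr mulNr mulrAC.
Qed.

Lemma weyl_marchaud_bar_higgins be x : 0 < be -> be < 1 ->
  wm_bar_converges be (higgins k) x /\
  weyl_marchaud_bar be (higgins k) x =
    - (cis (sg * be * (pi / 2)) * higgins_fraclap m be (sg * x)).
Proof.
move=> be0 be1; have mI := @measurable_Ioy R.
have tau2 : (0 < m)%N -> sg ^+ 2 = 1 by move=> m0; exact: sgn2 (Ordinal m0).
have [ic iE] : has_cint Ioy (wm_bar_integrand be (higgins k) x)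
   ((Gamma (1 - be))%:C * (- (sg%:C * Ci * cis (sg * (pi / 2) * (be - 1)))) *
       higgins_fraclap m be (sg * x)).
  apply: has_cint_ext (has_cint_higgins x be0 be1 tau2) => // z _.
  rewrite /wm_bar_integrand cderive_higgins mulr_suml; apply: eq_bigr => n _.
  by rewrite mulrDr.
split; first exact: ic.
rewrite /weyl_marchaud_bar iE fmorphV.
have G1 : (Gamma (1 - be))%:C != 0 :> R[i].
  by rewrite fmorph_eq0 Gamma_neq0// subr_gt0.
rewrite -mulrA mulKf// mulNr.
have [m0|m0] := posnP m.
  by rewrite m0 /higgins_fraclap big_ord0 !mulr0.
have s2 := sgn2 (Ordinal m0).
by congr (- (_ * _)); rewrite cis_step// subrK mulrAC.
Qed.

Lemma cderive_weyl_marchaud_higgins be x : 0 < be -> be < 1 ->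
  cderivable (weyl_marchaud be (higgins k)) x /\
  cderive (weyl_marchaud be (higgins k)) x =
    cis (- (sg * (be + 1) * (pi / 2))) * higgins_fraclap m (be + 1) (sg * x).
Proof.
move=> be0 be1; apply: cder_cderive.
apply: cder_ext; first by move=> t; case: (weyl_marchaud_higgins t be0 be1) => _ ->.
apply: (cder_eq (cderZ _ (dhiggins_fraclap x be0))).
have [m0|m0] := posnP m; first by rewrite m0 /higgins_fraclap !big_ord0 !mulr0.
have s2 := sgn2 (Ordinal m0).
rewrite (mulrA (cis _)); congr (_ * _).
transitivity ((- sg)%:C * Ci * cis (- sg * (pi / 2) * be)).
  rewrite mulN_comm (_ : - sg * (pi / 2) * be = - (sg * be * (pi / 2))).
    by rewrite (rmorphN (real_complex R)) !mulNr.
  by rewrite !mulNr mulrAC.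
by rewrite cis_step ?sqrrN// !mulNr mulrAC.
Qed.

Lemma cderive_weyl_marchaud_bar_higgins be x : 0 < be -> be < 1 ->
  cderivable (weyl_marchaud_bar be (higgins k)) x /\
  cderive (weyl_marchaud_bar be (higgins k)) x =
    cis (sg * (be + 1) * (pi / 2)) * higgins_fraclap m (be + 1) (sg * x).
Proof.
move=> be0 be1; apply: cder_cderive.
apply: (@cder_ext _ (fun t => - cis (sg * be * (pi / 2)) * higgins_fraclap m be (sg * t))).
  by move=> t; case: (weyl_marchaud_bar_higgins t be0 be1) => _ ->; rewrite mulNr.
apply: (cder_eq (cderZ _ (dhiggins_fraclap x be0))).
have [m0|m0] := posnP m; first by rewrite m0 /higgins_fraclap !big_ord0 !mulr0.
have s2 := sgn2 (Ordinal m0).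
rewrite (mulrA (- cis _)); congr (_ * _); rewrite mulrNN (mulrC (cis _)).
by rewrite (mulrAC sg be) cis_step// mulrAC.
Qed.

End HigginsExpansion.

(** * The operators in closed form *)

Theorem theorem2p1 (R : realType) (k : int) (x : R) :
  let s : R := (Num.sg k)%:~R in
  let lam : R -> R[i] := @higgins R k in
  let e_minus (alpha : R) : R[i] := cexp (- (Ci * (s * alpha * (pi / 2))%:C)) in
  let e_plus (alpha : R) : R[i] := cexp (Ci * (s * alpha * (pi / 2))%:C) in
  let den : R[i] := Ci * (s * x)%:C + 1 in
  let F (alpha : R) : R[i] :=
    hyp2F1 (1 - `|k|%:~R) (1 + alpha)%:C 2 (2 / den) in
  let A (alpha : R) : R[i] := 2 * `|k|%:~R * (Gamma (1 + alpha))%:C in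
  (forall alpha : R, 0 < alpha -> alpha < 1 ->
    [/\ fraclap_converges alpha lam x,
        [/\ wm_converges alpha lam x,
            weyl_marchaud alpha lam x = e_minus alpha * fraclap alpha lam x &
            e_minus alpha * fraclap alpha lam x =
              - (A alpha * e_minus alpha / cpow den (1 + alpha)%:C * F alpha)] &
        [/\ wm_bar_converges alpha lam x,
            weyl_marchaud_bar alpha lam x =
              - (e_plus alpha * fraclap alpha lam x) &
            - (e_plus alpha * fraclap alpha lam x) =
              A alpha * e_plus alpha / cpow den (1 + alpha)%:C * F alpha]])
  /\
  (forall alpha : R, 1 < alpha -> alpha < 2 ->
    [/\ fraclap_converges alpha lam x,
        [/\ forall t : R, wm_converges (alpha - 1) lam t,
            cderivable (weyl_marchaud (alpha - 1) lam) x,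
            cderive (weyl_marchaud (alpha - 1) lam) x =
              e_minus alpha * fraclap alpha lam x &
            e_minus alpha * fraclap alpha lam x =
              - (A alpha * e_minus alpha / cpow den (1 + alpha)%:C * F alpha)] &
        [/\ forall t : R, wm_bar_converges (alpha - 1) lam t,
            cderivable (weyl_marchaud_bar (alpha - 1) lam) x,
            cderive (weyl_marchaud_bar (alpha - 1) lam) x =
              e_plus alpha * fraclap alpha lam x &
            e_plus alpha * fraclap alpha lam x =
              - (A alpha * e_plus alpha / cpow den (1 + alpha)%:C * F alpha)]]).
Proof.
move=> s lam e_minus e_plus den F A.
have emE al : e_minus al = cis (- (s * al * (pi / 2))).
  by rewrite /e_minus /cis; congr cexp; apply: complex_eqP => /=; ring.
have epE al : e_plus al = cis (s * al * (pi / 2)).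
  by rewrite /e_plus /cis; congr cexp; apply: complex_eqP => /=; ring.
have denE : den = 1 +i* (s * x) by apply: complex_eqP => /=; ring.
have kE : `|k|%:~R = `|k|%N%:R :> R[i] by rewrite -abszE.
have closed al (e : R[i]) : 0 < al -> al < 2 ->
    e * fraclap al lam x = - (A al * e / cpow den (1 + al)%:C * F al).
  move=> al0 al2; have [_ ->] := fraclap_higgins k x al0 al2.
  by rewrite higgins_fraclap_hyp2F1// /A /F denE kE mulrN; congr (- _); ring.
split=> al h1 h2.
  have al2 : al < 2 by lra.
  have [fc fE] := fraclap_higgins k x h1 al2.
  have [wc wE] := weyl_marchaud_higgins k x h1 h2.
  have [bc bE] := weyl_marchaud_bar_higgins k x h1 h2.
  split; [exact: fc| |].
    by split; [exact: wc|rewrite wE emE fE|exact: closed].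
  split; [exact: bc|by rewrite bE epE fE|].
  by rewrite closed// opprK.
have b0 : 0 < al - 1 by lra.
have b1 : al - 1 < 1 by lra.
have al0 : 0 < al by lra.
have [fc fE] := fraclap_higgins k x al0 h2.
have [wd wE] := cderive_weyl_marchaud_higgins k x b0 b1.
have [bd bE] := cderive_weyl_marchaud_bar_higgins k x b0 b1.
split; [exact: fc| |].
  split; [|exact: wd| |exact: closed].
    by move=> t; case: (weyl_marchaud_higgins k t b0 b1).
  by rewrite wE subrK emE fE.
split; [|exact: bd| |exact: closed].
  by move=> t; case: (weyl_marchaud_bar_higgins k t b0 b1).
by rewrite bE subrK epE fE.
Qed.
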